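(* Let $\rho^{A_1\ldots A_m}$ be an $m$-partite quantum state. Then $$D(\rho)\ \ge\ \max_{i\in[m]}\ \min_{\emptyset\ne J\subseteq[m]\setminus\{i\}}\frac{I(A_J\rangle A_{[m]\setminus J})_\rho}{|J|}.$$
   Context: $[m]=\{1,\ldots,m\}$, $A_J$ denotes the joint system $(A_j:j\in J)$. The coherent information is $I(A\rangle B)_\rho=S(B)_\rho-S(AB)_\rho$ with $S$ the von Neumann entropy; so $I(A_J\rangle A_{[m]\setminus J})_\rho=S(A_{[m]\setminus J})_\rho-S(A_{[m]})_\rho$. $\log$ base 2. GHZ distillation capacity: let $|\Gamma_m\rangle=\frac1{\sqrt2}(|0\rangle^{\otimes m}+|1\rangle^{\otimes m})$. An $(n,\varepsilon)$-protocol of rate $k/n$ is an $m$-partite channel $\Lambda$ on $A_1^n\ldots A_m^n$ implementable by local operations and classical communication (LOCC) with $F(|\Gamma_m\rangle\langle\Gamma_m|^{\otimes k},\Lambda(\rho^{\otimes n}))\ge1-\varepsilon$, where $F(\rho,\sigma)=\|\sqrt\rho\sqrt\sigma\|_1$ is the fidelity and the $i$-th qubit of each GHZ state is held by party $i$. $R$ is achievable if for every $n$ there are $(n,\varepsilon_n)$-protocols with $\varepsilon_n\to0$ and $k/n\to R$; $D(\rho)=\sup\{R:R\text{ achievable}\}$. *)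

(* Defs.v *)
(* MathComp + MathComp-Analysis (+ mathcomp-real-closed's complex numbers R[i]). *)
From HB Require Import structures.
From mathcomp Require Import all_boot all_order all_algebra.
From mathcomp Require Import all_classical all_reals all_analysis.
From mathcomp Require Import complex.

Set Implicit Arguments.
Unset Strict Implicit.
Unset Printing Implicit Defensive.

Import Order.TTheory GRing.Theory Num.Theory.
Local Open Scope ring_scope.
Local Open Scope classical_set_scope.
Import numFieldNormedType.Exports.

(* Finite-dimensional quantum mechanics over C := R[i], R : realType.       *)
(* A system is described by a finite type T (an orthonormal basis);        *)
(* an operator T -> T' is given by its matrix entries  A y x = <y|A|x>.      *)

Section Quantum.
Variable R : realType.
Local Notation C := R[i].

Definition op (T T' : finType) := T' -> T -> C.

(* the matrix of an operator, w.r.t. the enumeration of the basis *)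
Definition tomx (T : finType) (A : op T T) : 'M[C]_#|T| :=
  \matrix_(i, j) A (enum_val i) (enum_val j).

(* conjugate transpose of a matrix *)
Definition adjmx n (M : 'M[C]_n) : 'M[C]_n := map_mx (fun z : C => z^*) (trmx M).

(* density operator: positive semidefinite with unit trace *)
Definition is_state (T : finType) (rho : op T T) : Prop :=
  (forall v : T -> C, 0 <= \sum_(x : T) \sum_(y : T) (v x)^* * rho x y * v y)
  /\ \sum_(x : T) rho x x = 1.

(* matrix square root of a positive semidefinite matrix, through the      *)
(* spectral decomposition M = P^-1 diag(l) P, P unitary (spectral.v)       *)
Definition sqrtmx n (M : 'M[C]_n) : 'M[C]_n :=
  adjmx (spectralmx M) *m diag_mx (map_mx sqrtC (spectral_diag M))
        *m spectralmx M.

(* trace norm  ||X||_1 = Tr sqrt(X^dagger X) *)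
Definition trnorm n (X : 'M[C]_n) : R := complex.Re (\tr (sqrtmx (adjmx X *m X))).

(* fidelity F(rho, sigma) = || sqrt rho sqrt sigma ||_1 *)
Definition fidelity (T : finType) (rho sigma : op T T) : R :=
  trnorm (sqrtmx (tomx rho) *m sqrtmx (tomx sigma)).

(* von Neumann entropy, log base 2, with 0 log 0 = 0 *)
Definition log2 (t : R) : R := ln t / ln 2.
Definition xlog2x (t : R) : R := if t == 0 then 0 else t * log2 t.
Definition entropy (T : finType) (rho : op T T) : R :=
  - \sum_(i < #|T|) xlog2x (complex.Re (spectral_diag (tomx rho) 0 i)).

(* m-partite systems: party j has local basis L j; joint basis = tuples.    *)
Variable m : nat.

Definition joint (L : 'I_m -> finType) : finType := {dffun forall j : 'I_m, L j}.

(* subsystem A_K, K a set of parties *)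
Definition subsys (L : 'I_m -> finType) (K : {set 'I_m}) : finType :=
  {dffun forall j : {j : 'I_m | j \in K}, L (val j)}.

Definition restr (L : 'I_m -> finType) (K : {set 'I_m}) (x : joint L) : subsys L K :=
  [ffun j : {j : 'I_m | j \in K} => x (val j)].

(* reduced state rho_{A_K} = Tr_{A_{[m]\K}} rho (partial trace) *)
Definition ptrace (L : 'I_m -> finType) (K : {set 'I_m}) (rho : op (joint L) (joint L))
  : op (subsys L K) (subsys L K) :=
  fun a b => \sum_(x : joint L) \sum_(y : joint L |
      [&& restr K x == a, restr K y == b & restr (~: K) x == restr (~: K) y]) rho x y.

(* coherent information I(A_J > A_{[m]\J}) = S(A_{[m]\J}) - S(A_[m]) *)
Definition coh_info (L : 'I_m -> finType) (rho : op (joint L) (joint L)) (J : {set 'I_m}) : R :=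
  entropy (@ptrace L (~: J) rho) - entropy rho.

(* LOCC channels (finite number of rounds).  In each round every party j    *)
(* applies a local instrument, given by Kraus operators K j k : L j -> L1 j  *)
(* (k < r j) with sum_k (K j k)^dagger (K j k) = Id; all outcomes are         *)
(* broadcast, and the rest of the protocol may depend on them.              *)
Definition kraus_complete (X Y : finType) (r : nat) (K : 'I_r -> op X Y) : Prop :=
  forall x x' : X,
    \sum_(k < r) \sum_(y : Y) (K k y x)^* * K k y x' = (x == x')%:R.

Definition outcome (r : 'I_m -> nat) : finType := {dffun forall j : 'I_m, 'I_(r j)}.

(* rho |-> (K_o) rho (K_o)^dagger, with K_o = tensor_j K j (o j) *)
Definition apply_local_kraus (L L1 : 'I_m -> finType) (r : 'I_m -> nat)
  (K : forall j : 'I_m, 'I_(r j) -> op (L j) (L1 j)) (o : outcome r)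
  (rho : op (joint L) (joint L)) : op (joint L1) (joint L1) :=
  fun x1 y1 => \sum_(x : joint L) \sum_(y : joint L)
     (\prod_(j < m) K j (o j) (x1 j) (x j)) * rho x y
     * (\prod_(j < m) K j (o j) (y1 j) (y j))^*.

Inductive LOCC : forall (L L' : 'I_m -> finType),
    (op (joint L) (joint L) -> op (joint L') (joint L')) -> Prop :=
| LOCC_id (L : 'I_m -> finType) : @LOCC L L id
| LOCC_round (L L1 L' : 'I_m -> finType) (r : 'I_m -> nat)
    (K : forall j : 'I_m, 'I_(r j) -> op (L j) (L1 j))
    (Phi : outcome r -> op (joint L1) (joint L1) -> op (joint L') (joint L')) :
    (forall j, kraus_complete (K j)) ->
    (forall o, @LOCC L1 L' (Phi o)) ->
    @LOCC L L' (fun rho => fun a b =>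
         \sum_(o : outcome r) Phi o (apply_local_kraus K o rho) a b).

(* n copies: party j holds A_j^n, basis {ffun 'I_n -> L j} *)
Definition ncopies (L : 'I_m -> finType) (n : nat) : 'I_m -> finType :=
  fun j => {ffun 'I_n -> L j} : finType.

Definition slice (L : 'I_m -> finType) (n : nat) (x : joint (ncopies L n)) (k : 'I_n)
  : joint L := [ffun j => x j k].

Definition tensor_pow (L : 'I_m -> finType) (rho : op (joint L) (joint L)) (n : nat)
  : op (joint (ncopies L n)) (joint (ncopies L n)) :=
  fun x y => \prod_(k < n) rho (slice x k) (slice y k).

(* k copies of the m-party GHZ state; party j holds k qubits *)
Definition qubits (k : nat) : 'I_m -> finType := fun _ => {ffun 'I_k -> bool} : finType.

Definition ghz_amp (z : 'I_m -> bool) : C :=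
  if [forall j, z j == false] || [forall j, z j == true] then (sqrtC 2)^-1 else 0.

Definition ghz_pow (k : nat) : op (joint (qubits k)) (joint (qubits k)) :=
  fun x y => \prod_(l < k) (ghz_amp (fun j => x j l) * (ghz_amp (fun j => y j l))^*).

(* achievable rates and GHZ distillation capacity *)
Definition achievable (L : 'I_m -> finType) (rho : op (joint L) (joint L)) (Rt : R) : Prop :=
  exists (k : nat -> nat) (eps : nat -> R),
    (forall n : nat, exists Lam,
        @LOCC (ncopies L n) (qubits (k n)) Lam /\
        1 - eps n <= fidelity (ghz_pow (k := k n)) (Lam (tensor_pow rho (n := n))))
    /\ eps @ \oo --> 0
    /\ (fun n => (k n)%:R / n%:R : R) @ \oo --> Rt.

Definition ghz_capacity (L : 'I_m -> finType) (rho : op (joint L) (joint L)) : \bar R :=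
  ereal_sup [set (Rt%:E) | Rt in achievable rho].

End Quantum.

(* Main.v *)
(** Fix i and a rate r below the minimum. Every party j <> i ("sender") measures its n copies with
   Hadamard vectors carrying random signs and a random permutation of the basis, grouped into blocks of
   K = 2^k outcomes with k = floor(n r): the block is announced, the position inside the block stays
   coherent. On average over the signs and permutations this decouples the positions of the senders
   from the purifying reference, so that a Powers-Stormer bound and an Uhlmann isometry give party i
   a decoder recovering all the positions at once. Party i then measures the differences of the
   positions to its own one and tells the senders to shift accordingly, which leaves k GHZ states.
   To control the decoupling error, write t_j for the measurement kernel of party j and d_j for its
   mean, the completely depolarizing kernel. The product of the t_j minus that of the d_j is the sum
   over nonempty sets J of senders of prod_{j in J} (t_j - d_j) prod_{j notin J} d_j. The term of J sees
   only the marginal on A_J and the reference, whose entropy is that of the complementary marginal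
   rho_{[m] \ J}. Each term is therefore restricted to typical eigenvectors of its own marginal, and
   no smoothing has to work for all the marginals simultaneously. The term of J has second moment
   about (6K)^{|J|} times 2^{-n I(A_J > A_{[m] \ J})}, which is exponentially small. *)
Require Import Defs.
From HB Require Import structures.
From mathcomp Require Import all_boot all_order all_algebra fingroup perm.
From mathcomp Require Import all_classical all_reals all_analysis.
From mathcomp Require Import complex.
From mathcomp Require Import ring lra.
Import Order.TTheory GRing.Theory Num.Theory.
Local Open Scope ring_scope.

Set Implicit Arguments.
Unset Strict Implicit.
Unset Printing Implicit Defensive.

(** * Complex sums *)

(** The coherent information arises from two dimension counts. The decoder needs a trace norm bound,
    while only the Hilbert-Schmidt norm can be averaged; passing between them costs a dimension. Its
    part due to outcomes and positions is the m-th power of D = 2^(k+l) and cancels the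
    normalization of the kernels. What remains is the size of the reference, cut down to typical
    eigenvectors of the state, about 2^{n S(rho)}. It meets the purity of the truncated marginal,
    about 2^{-n S(rho_{[m] \ J})}. The atypical rest has no small purity, and t_j - d_j is not
    positive. The kernel of J is therefore expanded there into a signed sum of completely positive
    maps, each of which preserves the atypical weight. Party i is made to look like a sender: it
    draws a dummy block and position, whose kernel is exactly d_i, so that all products run over all
    parties while J avoids i. On the operational side only the weight on the GHZ vector is tracked.
    All outcomes contribute nonnegatively, so Kraus families may be subnormalized and unwanted
    outcomes dropped. *)

Section ComplexSums.
Variable R : realType.
Local Notation C := R[i].

Lemma conjE (z : C) : z^* = (conjc z).
Proof. by []. Qed.

Lemma cReD (x y : C) : complex.Re (x + y) = complex.Re x + complex.Re y.
Proof. by case: x; case: y. Qed.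

Lemma cRe_sum (I : Type) (s : seq I) (P : pred I) (F : I -> C) :
  complex.Re (\sum_(i <- s | P i) F i) = \sum_(i <- s | P i) complex.Re (F i).
Proof. by apply: (big_morph _ cReD). Qed.

Lemma cReMl (a : R) (z : C) : complex.Re (a%:C%C * z) = a * complex.Re z.
Proof. by case: z => x y /=; ring. Qed.

Lemma cRe_realC (a : R) : complex.Re (a%:C%C : C) = a.
Proof. by []. Qed.

Lemma cReN (x : C) : complex.Re (- x) = - complex.Re x.
Proof. by case: x. Qed.

(** The squared modulus, taken in [R] so that all estimates are sums of real numbers. *)
Definition sqn (z : C) : R := complex.Re z ^+ 2 + complex.Im z ^+ 2.

Lemma sqn_ge0 z : 0 <= sqn z.
Proof. by rewrite addr_ge0 ?sqr_ge0. Qed.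

Lemma sqn0 : sqn 0 = 0.
Proof. by rewrite /sqn /= expr0n addr0. Qed.

Lemma sqnM z w : sqn (z * w) = sqn z * sqn w.
Proof. by case: z => a b; case: w => c d; rewrite /sqn /=; ring. Qed.

Lemma sqn_real (a : R) : sqn (a%:C%C) = a ^+ 2.
Proof. by rewrite /sqn /= expr0n addr0. Qed.

Lemma sqn_conj z : sqn (z^*) = sqn z.
Proof. by case: z => a b; rewrite /sqn /= sqrrN. Qed.

Lemma sqnD2 z w : sqn (z + w) <= 2 * sqn z + 2 * sqn w.
Proof.
case: z => a b; case: w => c d; rewrite /sqn /= -subr_ge0.
have -> : 2 * (a ^+ 2 + b ^+ 2) + 2 * (c ^+ 2 + d ^+ 2)
  - ((a + c) ^+ 2 + (b + d) ^+ 2) = (a - c) ^+ 2 + (b - d) ^+ 2 by ring.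
by rewrite addr_ge0 ?sqr_ge0.
Qed.

Lemma mul_conj_sqn z : z * z^* = (sqn z)%:C%C.
Proof.
case: z => a b; rewrite conjE; simpc; rewrite /sqn /=.
by congr (Complex _ _); ring.
Qed.

Lemma sqn_Re2 z : complex.Re z ^+ 2 <= sqn z.
Proof. by rewrite lerDl sqr_ge0. Qed.

Lemma sum_sqn_ge0 (I : Type) (s : seq I) (P : pred I) (F : I -> C) :
  0 <= \sum_(i <- s | P i) sqn (F i).
Proof. by apply: sumr_ge0 => i _; apply: sqn_ge0. Qed.

Lemma realC_sum (I : Type) (s : seq I) (P : pred I) (F : I -> R) :
  (\sum_(i <- s | P i) F i)%:C%C = \sum_(i <- s | P i) (F i)%:C%C.
Proof. exact: (rmorph_sum (real_complex R)). Qed.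

Lemma realC_prod (I : Type) (s : seq I) (P : pred I) (F : I -> R) :
  (\prod_(i <- s | P i) F i)%:C%C = \prod_(i <- s | P i) (F i)%:C%C.
Proof. exact: (rmorph_prod (real_complex R)). Qed.

Lemma conj_realC (a : R) : (a%:C%C : C)^* = a%:C%C.
Proof. by rewrite conjE conjc_real. Qed.

Lemma conjM (z w : C) : (z * w)^* = z^* * w^*.
Proof. exact: rmorphM. Qed.

Lemma conjD (z w : C) : (z + w)^* = z^* + w^*.
Proof. exact: rmorphD. Qed.

Lemma conjN (z : C) : (- z)^* = - z^*.
Proof. exact: rmorphN. Qed.

Lemma conj_nat (n : nat) : (n%:R : C)^* = n%:R.
Proof. exact: rmorph_nat. Qed.

Lemma realCM (a b : R) : (a * b)%:C%C = a%:C%C * b%:C%C :> C.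
Proof. exact: rmorphM. Qed.

Lemma realCB (a b : R) : (a - b)%:C%C = a%:C%C - b%:C%C :> C.
Proof. exact: rmorphB. Qed.

Lemma realCD (a b : R) : (a + b)%:C%C = a%:C%C + b%:C%C :> C.
Proof. exact: rmorphD. Qed.

Lemma realC_nat (n : nat) : (n%:R : R)%:C%C = n%:R :> C.
Proof. exact: (rmorph_nat (real_complex R)). Qed.

Lemma conj_sum (I : Type) (s : seq I) (P : pred I) (F : I -> C) :
  (\sum_(i <- s | P i) F i)^* = \sum_(i <- s | P i) (F i)^*.
Proof. exact: rmorph_sum. Qed.

Lemma conj_prod (I : Type) (s : seq I) (P : pred I) (F : I -> C) :
  (\prod_(i <- s | P i) F i)^* = \prod_(i <- s | P i) (F i)^*.
Proof. exact: rmorph_prod. Qed.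

(** Lagrange's identity: the defect is half the double sum of the squares of
    [a i * b j - a j * b i]. *)
Lemma CS_real (I : finType) (a b : I -> R) :
  (\sum_i a i * b i) ^+ 2 <= (\sum_i a i ^+ 2) * (\sum_i b i ^+ 2).
Proof.
have h : 0 <= \sum_i \sum_j (a i * b j - a j * b i) ^+ 2.
  by apply: sumr_ge0 => i _; apply: sumr_ge0 => j _; apply: sqr_ge0.
have e : \sum_i \sum_j (a i * b j - a j * b i) ^+ 2 =
   2 * ((\sum_i a i ^+ 2) * (\sum_i b i ^+ 2)) - 2 * (\sum_i a i * b i) ^+ 2.
  have -> : \sum_i \sum_j (a i * b j - a j * b i) ^+ 2 =
    \sum_i \sum_j a i ^+ 2 * b j ^+ 2 + \sum_i \sum_j a j ^+ 2 * b i ^+ 2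
    - 2 * \sum_i \sum_j (a i * b i) * (a j * b j).
    rewrite -big_split /= mulr_sumr -sumrB; apply: eq_bigr => i _.
    rewrite -big_split /= mulr_sumr -sumrB; apply: eq_bigr => j _.
    by ring.
  rewrite [X in _ + X - _]exchange_big /=.
  have -> : \sum_i \sum_j a i ^+ 2 * b j ^+ 2 = (\sum_i a i ^+ 2) * (\sum_i b i ^+ 2).
    by rewrite mulr_suml; apply: eq_bigr => i _; rewrite mulr_sumr.
  have -> : \sum_i \sum_j (a i * b i) * (a j * b j) = (\sum_i a i * b i) ^+ 2.
    by rewrite expr2 mulr_suml; apply: eq_bigr => i _; rewrite mulr_sumr.
  by ring.
by move: h; rewrite e; lra.
Qed.

Lemma CS_sqn (I : finType) (a b : I -> C) :
  sqn (\sum_i a i * b i) <= (\sum_i sqn (a i)) * (\sum_i sqn (b i)).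
Proof.
(* rotate the sum to a nonnegative real number and apply the real inequality *)
set S := \sum_i _; have [S0|Sn0] := eqVneq (sqn S) 0.
  by rewrite S0 mulr_ge0 ?sum_sqn_ge0.
have Sp : 0 < sqn S by rewrite lt_neqAle eq_sym Sn0 sqn_ge0.
have e : sqn S = \sum_i complex.Re (S^* * a i * b i).
  rewrite -cRe_sum; under eq_bigr do rewrite -mulrA.
  by rewrite -mulr_sumr mulrC mul_conj_sqn.
have le1 : sqn S <= \sum_i Num.sqrt (sqn (S^* * a i)) * Num.sqrt (sqn (b i)).
  rewrite {1}e; apply: ler_sum => i _.
  rewrite -sqrtrM ?sqn_ge0 // -sqnM.
  apply: le_trans (ler_norm _) _; rewrite -sqrtr_sqr ler_wsqrtr //.
  exact: sqn_Re2.
have := CS_real (fun i => Num.sqrt (sqn (S^* * a i))) (fun i => Num.sqrt (sqn (b i))).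
under [X in _ <= X * _]eq_bigr do rewrite sqr_sqrtr ?sqn_ge0 // sqnM sqn_conj.
under [X in _ <= _ * X]eq_bigr do rewrite sqr_sqrtr ?sqn_ge0 //.
rewrite -mulr_sumr => h.
have h2 : sqn S ^+ 2 <= sqn S * ((\sum_i sqn (a i)) * \sum_i sqn (b i)).
  rewrite mulrA; apply: le_trans h; rewrite ler_pXn2r ?nnegrE ?sqn_ge0 //.
  exact: le_trans (sqn_ge0 _) le1.
by move: h2; rewrite expr2 ler_pM2l.
Qed.

Lemma ler_sum_inj (I J : finType) (f : I -> J) (F : J -> R) :
  injective f -> (forall j, 0 <= F j) -> \sum_i F (f i) <= \sum_j F j.
Proof.
move=> fi F0.
have -> : \sum_i F (f i) = \sum_(j in codom f) F j.
  by rewrite -big_uniq ?big_image //= map_inj_uniq ?enum_uniq.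
by rewrite [leRHS](bigID (fun j => j \in codom f)) /= lerDl sumr_ge0.
Qed.

End ComplexSums.

(** * Spectral decompositions *)

Section Spectral.
Variable R : realType.
Local Notation C := R[i].

Lemma sum_delta (V : pzRingType) (T : finType) (x : T) (F : T -> V) :
  \sum_z (z == x)%:R * F z = F x.
Proof.
rewrite (bigD1 x) //= eqxx mul1r big1 ?addr0 // => z /negbTE ->.
by rewrite mul0r.
Qed.

Definition orthobasis (T : finType) (U : 'I_#|T| -> T -> C) : Prop :=
  (forall l l', \sum_x (U l x)^* * U l' x = (l == l')%:R) /\
  (forall x y, \sum_l U l x * (U l y)^* = (x == y)%:R).

Definition hermop (T : finType) (A : op R T T) := forall x y, A y x = (A x y)^*.

Definition psdop (T : finType) (A : op R T T) :=
  forall v : T -> C, 0 <= \sum_(x : T) \sum_(y : T) (v x)^* * A x y * v y.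

(** Polarization: the form is real on vectors with entries [a] at [x] and [b] at [y], and the
    choices (1,1), (1,i), (1,0), (0,1) for (a,b) determine how the two off-diagonal entries are
    related. *)
Lemma psd_hermop (T : finType) (A : op R T T) : psdop A -> hermop A.
Proof.
move=> Apsd x y.
have key (a b : C) : complex.Im (a^* * A x x * a + a^* * A x y * b
   + b^* * A y x * a + b^* * A y y * b) = 0.
  have := Apsd (fun z => (z == x)%:R * a + (z == y)%:R * b).
  move/ger0_Im => <-; congr (complex.Im _).
  have E z : \sum_(z' : T) ((z == x)%:R * a + (z == y)%:R * b)^* * A z z' *
     ((z' == x)%:R * a + (z' == y)%:R * b) =
     (z == x)%:R * (a^* * (A z x * a + A z y * b)) +
     (z == y)%:R * (b^* * (A z x * a + A z y * b)).
    rewrite conjD !conjM !conj_nat.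
    rewrite -(sum_delta x (fun z' => A z z' * a)) -(sum_delta y (fun z' => A z z' * b)).
    rewrite -big_split /= !mulr_sumr -big_split /=; apply: eq_bigr => z' _; ring.
  under [in RHS]eq_bigr => z _ do rewrite E.
  by rewrite big_split /= !sum_delta; ring.
have k1 := key 1 1; have k2 := key 1 'i%C.
have k3 := key 1 0; have k4 := key 0 1.
move: k1 k2 k3 k4.
rewrite !conjE conjc1 conjc0.
case: (A x x) => a1 a2; case: (A x y) => b1 b2; case: (A y x) => c1 c2.
case: (A y y) => d1 d2; simpc => /=.
move=> k1 k2 k3 k4; congr (Complex _ _); lra.
Qed.

Lemma adjmxE n (M : 'M[C]_n) i j : adjmx M i j = (M j i)^*.
Proof. by rewrite !mxE. Qed.

Lemma adjmxK n (M : 'M[C]_n) : adjmx (adjmx M) = M.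
Proof. by apply/matrixP => i j; rewrite !adjmxE conjCK. Qed.

Lemma adjmxM n (M N : 'M[C]_n) : adjmx (M *m N) = adjmx N *m adjmx M.
Proof.
apply/matrixP => i j; rewrite adjmxE !mxE conj_sum.
by apply: eq_bigr => l _; rewrite !adjmxE conjM mulrC.
Qed.

Lemma unitary_adj n (P : 'M[C]_n) : P \is unitarymx -> invmx P = adjmx P.
Proof. exact: invmx_unitary. Qed.

Lemma adj_mulV n (P : 'M[C]_n) : P \is unitarymx -> adjmx P *m P = 1%:M.
Proof. by move=> h; rewrite -unitary_adj // mulVmx // unitarymx_unit. Qed.

Lemma adj_mulVr n (P : 'M[C]_n) : P \is unitarymx -> P *m adjmx P = 1%:M.
Proof. by move=> h; rewrite -unitary_adj // mulmxV // unitarymx_unit. Qed.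

Lemma herm_spectral n (M : 'M[C]_n) : adjmx M = M ->
  M = adjmx (spectralmx M) *m diag_mx (spectral_diag M) *m spectralmx M.
Proof.
move=> h; rewrite -unitary_adj ?spectral_unitarymx //.
apply/orthomx_spectralP/normalmxP.
suff -> : (map_mx Num.conj (trmx M)) = M by [].
by rewrite -[RHS]h; apply/matrixP => i j; rewrite !mxE.
Qed.

Lemma herm_spectral_diag_real n (M : 'M[C]_n) : adjmx M = M ->
  forall l, spectral_diag M 0 l = (complex.Re (spectral_diag M 0 l))%:C%C.
Proof.
move=> h l.
have h2 : diag_mx (spectral_diag M) = spectralmx M *m M *m adjmx (spectralmx M).
  rewrite [X in _ *m X *m _](herm_spectral h) !mulmxA adj_mulVr ?spectral_unitarymx //.
  by rewrite mul1mx -mulmxA adj_mulVr ?spectral_unitarymx // mulmx1.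
have h3 : adjmx (diag_mx (spectral_diag M)) = diag_mx (spectral_diag M).
  by rewrite h2 !adjmxM adjmxK h mulmxA.
have /matrixP /(_ l l) := h3; rewrite adjmxE !mxE eqxx mulr1n conjE => {h2 h3}.
case: (spectral_diag M 0 l) => a b /=; simpc => -[hb].
by congr (Complex _ _); lra.
Qed.

Lemma spectral_op (T : finType) (A : op R T T) : hermop A ->
  exists U : 'I_#|T| -> T -> C, orthobasis U /\
  forall x y, A x y = \sum_l (complex.Re (spectral_diag (tomx A) 0 l))%:C%C * U l x * (U l y)^*.
Proof.
move=> Ah.
have hM : adjmx (tomx A) = tomx A.
  by apply/matrixP => i j; rewrite adjmxE !mxE -Ah.
set P := spectralmx (tomx A).
have Pu : P \is unitarymx by apply: spectral_unitarymx.
(* [tomx A] equals P^dagger diag P, so the eigenvectors are the conjugated rows of [P]. *)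
exists (fun l x => (P l (enum_rank x))^*); split; first split.
- move=> l l'; have /matrixP /(_ l l') := adj_mulVr Pu; rewrite !mxE => <-.
  rewrite (reindex _ (onW_bij _ (@enum_val_bij T))) /=.
  by apply: eq_bigr => i _; rewrite enum_valK conjCK adjmxE.
- move=> x y; have /matrixP /(_ (enum_rank x) (enum_rank y)) := adj_mulV Pu.
  rewrite !mxE (inj_eq enum_rank_inj) => <-.
  by apply: eq_bigr => i _; rewrite conjCK adjmxE.
- move=> x y.
  have /matrixP /(_ (enum_rank x) (enum_rank y)) := herm_spectral hM.
  rewrite !mxE !enum_rankK => ->; apply: eq_bigr => l _.
  rewrite mul_mx_diag !mxE conjCK -herm_spectral_diag_real //.
  by rewrite [X in X * _]mulrC.
Qed.

Lemma spectral_eigen (T : finType) (A : op R T T) (U : 'I_#|T| -> T -> C) (lam : 'I_#|T| -> R) :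
  orthobasis U -> (forall x y, A x y = \sum_l (lam l)%:C%C * U l x * (U l y)^*) ->
  forall l x, \sum_y A x y * U l y = (lam l)%:C%C * U l x.
Proof.
move=> [U1 _] AE l x.
under eq_bigr do rewrite AE mulr_suml.
rewrite exchange_big /= (bigD1 l) //= [X in _ + X]big1 ?addr0 => [|l' /negbTE l'l].
  under eq_bigr do rewrite -mulrA.
  by rewrite -mulr_sumr U1 eqxx mulr1.
under eq_bigr do rewrite -mulrA.
by rewrite -mulr_sumr U1 l'l mulr0.
Qed.

Lemma spectral_form (T : finType) (A : op R T T) (U : 'I_#|T| -> T -> C) (lam : 'I_#|T| -> R) :
  orthobasis U -> (forall x y, A x y = \sum_l (lam l)%:C%C * U l x * (U l y)^*) ->
  forall l l', \sum_x \sum_y (U l x)^* * A x y * U l' y = (lam l)%:C%C * (l == l')%:R.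
Proof.
move=> Ub AE l l'.
under eq_bigr => x _.
  under eq_bigr do rewrite -mulrA.
  rewrite -mulr_sumr (spectral_eigen Ub AE) mulrCA.
  over.
rewrite -mulr_sumr Ub.1; case: eqP => [->//|_]; by rewrite !mulr0.
Qed.

Lemma psd_eigen_ge0 (T : finType) (A : op R T T) (U : 'I_#|T| -> T -> C) (lam : 'I_#|T| -> R) :
  psdop A ->
  orthobasis U -> (forall x y, A x y = \sum_l (lam l)%:C%C * U l x * (U l y)^*) ->
  forall l, 0 <= lam l.
Proof.
move=> Ap Ub AE l; have := Ap (U l).
by rewrite (spectral_form Ub AE) eqxx mulr1 ler0c.
Qed.

Lemma psd_factor (T : finType) (A : op R T T) : psdop A ->
  exists w : 'I_#|T| -> T -> C, forall x y, A x y = \sum_l w l x * (w l y)^*.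
Proof.
move=> Ap; have [U [Ub AE]] := spectral_op (psd_hermop Ap).
have l0 := psd_eigen_ge0 Ap Ub AE.
exists (fun l x => (Num.sqrt (complex.Re (spectral_diag (tomx A) 0 l)))%:C%C * U l x).
move=> x y; rewrite AE; apply: eq_bigr => l _.
rewrite conjM conj_realC mulrACA -realCM -expr2 sqr_sqrtr //.
by rewrite mulrA.
Qed.

(** The bound makes [c] times the identity minus M^dagger M positive, and [N] is a Gram factor of
    it: [M] stacked over [N] is a multiple of an isometry. This completes families of Kraus
    operators and turns a tensor product of bounds into one of isometries. *)
Lemma dilation (X W : finType) (M : W -> X -> C) (c : R) :
  (forall u : X -> C, \sum_w sqn (\sum_x M w x * u x) <= c * \sum_x sqn (u x)) ->
  exists N : 'I_#|X| -> X -> C, forall x x',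
    \sum_w (M w x)^* * M w x' + \sum_l (N l x)^* * N l x' = c%:C%C * (x == x')%:R.
Proof.
move=> hM.
pose A : op R X X := fun x x' => c%:C%C * (x == x')%:R - \sum_w (M w x)^* * M w x'.
have Ap : psdop A.
  move=> v; suff -> : \sum_x \sum_y (v x)^* * A x y * v y =
     (c * (\sum_x sqn (v x)) - \sum_w sqn (\sum_x M w x * v x))%:C%C.
    by rewrite ler0c subr_ge0.
  rewrite realCB realCM !realC_sum.
  have -> : c%:C%C * (\sum_x (sqn (v x))%:C%C) = \sum_x \sum_y (v x)^* * (c%:C%C * (x == y)%:R) * v y.
    rewrite mulr_sumr; apply: eq_bigr => x _.
    rewrite (eq_bigr (fun y => (y == x)%:R * (c%:C%C * ((v x)^* * v y)))); last first.
      by move=> y _; rewrite eq_sym; ring.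
    by rewrite sum_delta -mul_conj_sqn [v x * _]mulrC.
  have -> : \sum_w (sqn (\sum_x M w x * v x))%:C%C =
     \sum_x \sum_y (v x)^* * (\sum_w (M w x)^* * M w y) * v y.
    under eq_bigr do rewrite -mul_conj_sqn mulrC conj_sum mulr_suml.
    rewrite exchange_big /=; apply: eq_bigr => x _.
    under eq_bigr do rewrite mulr_sumr.
    rewrite exchange_big /=; apply: eq_bigr => y _.
    rewrite mulr_sumr mulr_suml; apply: eq_bigr => w _; rewrite conjM; ring.
  rewrite -sumrB; apply: eq_bigr => x _; rewrite -sumrB; apply: eq_bigr => y _.
  by rewrite /A; ring.
have [w wE] := psd_factor Ap.
exists (fun l x => (w l x)^*) => x x'.
have := wE x x'; rewrite /A => /eqP; rewrite subr_eq => /eqP ->.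
rewrite addrC; congr (_ + _); by apply: eq_bigr => l _; rewrite conjCK.
Qed.

Lemma parseval_fam (X L : finType) (E : L -> X -> C) (e : L -> R) (h : L -> C) :
  (forall l l', \sum_x (E l x)^* * E l' x = (l == l')%:R * (e l)%:C%C) ->
  \sum_x sqn (\sum_l E l x * h l) = \sum_l e l * sqn (h l).
Proof.
move=> hE; apply: (@complexI R); rewrite !realC_sum.
under eq_bigr do rewrite -mul_conj_sqn mulrC conj_sum mulr_suml.
rewrite exchange_big /=; apply: eq_bigr => l _.
under eq_bigr do rewrite mulr_sumr.
rewrite exchange_big /= (bigD1 l) //= [X in _ + X]big1 ?addr0 => [|l' /negbTE nl].
  rewrite (eq_bigr (fun x => ((h l)^* * h l) * ((E l x)^* * E l x))) => [|x _].
    by rewrite -mulr_sumr hE eqxx mul1r realCM -mul_conj_sqn; ring.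
  by rewrite conjM; ring.
rewrite (eq_bigr (fun x => ((h l)^* * h l') * ((E l x)^* * E l' x))) => [|x _].
  by rewrite -mulr_sumr hE eq_sym nl mul0r mulr0.
by rewrite conjM; ring.
Qed.

Lemma parseval (X : finType) (U : 'I_#|X| -> X -> C) (h : 'I_#|X| -> C) :
  orthobasis U -> \sum_x sqn (\sum_l U l x * h l) = \sum_l sqn (h l).
Proof.
move=> Ub; rewrite (@parseval_fam _ _ _ (fun _ => 1)); last first.
  by move=> l l'; rewrite Ub.1 mulr1.
by under eq_bigr do rewrite mul1r.
Qed.

Lemma parseval2 (X : finType) (U : 'I_#|X| -> X -> C) (h : X -> C) :
  orthobasis U -> \sum_l sqn (\sum_x U l x * h x) = \sum_x sqn (h x).
Proof.
move=> Ub; rewrite (@parseval_fam _ _ (fun x l => U l x) (fun _ => 1)).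
  by under eq_bigr do rewrite mul1r.
move=> x y; rewrite mulr1 eq_sym -(Ub.2 y x).
by under eq_bigr do rewrite mulrC.
Qed.

End Spectral.

(** * Powers-Stormer and Uhlmann bounds *)

Section Uhlmann.
Variable R : realType.
Local Notation C := R[i].

(** Sums of this form stand for the trace norm: they equal it in an eigenbasis of a Hermitian [D]
    and are at most that in any other basis. Cauchy-Schwarz over the basis costs the dimension
    [#|X|], which is why the reference has to be truncated. *)
Lemma diag_HS (X : finType) (U : 'I_#|X| -> X -> C) (D : X -> X -> C) : orthobasis U ->
  (\sum_l `|complex.Re (\sum_x \sum_y (U l x)^* * D x y * U l y)|) ^+ 2
   <= #|X|%:R * \sum_x \sum_y sqn (D x y).
Proof.
move=> Ub.
have := CS_real (fun _ : 'I_#|X| => 1 : R)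
  (fun l => `|complex.Re (\sum_x \sum_y (U l x)^* * D x y * U l y)|).
under eq_bigr do rewrite mul1r.
move=> /le_trans; apply.
rewrite sumr_const expr1n card_ord; apply: ler_wpM2l; first by rewrite ler0n.
apply: (@le_trans _ _ (\sum_l \sum_x sqn (\sum_y U l y * D x y))).
  apply: ler_sum => l _; rewrite real_normK ?num_real //.
  apply: le_trans (sqn_Re2 _) _.
  have -> : \sum_x \sum_y (U l x)^* * D x y * U l y =
     \sum_x (U l x)^* * \sum_y U l y * D x y.
    apply: eq_bigr => x _; rewrite mulr_sumr; apply: eq_bigr => y _; ring.
  apply: le_trans (CS_sqn _ _) _.
  suff -> : \sum_i sqn (U l i)^* = 1 by rewrite mul1r.
  under eq_bigr do rewrite sqn_conj.
  apply: (@complexI R); rewrite realC_sum.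
  under eq_bigr do rewrite -mul_conj_sqn mulrC.
  by rewrite Ub.1 eqxx.
rewrite exchange_big /=; apply: ler_sum => x _.
by rewrite (parseval2 _ Ub).
Qed.

Lemma gram_psd (X B : finType) (G : X -> B -> C) :
  psdop (fun x x' => \sum_b G x b * (G x' b)^* : C).
Proof.
move=> v.
suff -> : \sum_x \sum_y (v x)^* * (\sum_b G x b * (G y b)^*) * v y =
   (\sum_b sqn (\sum_x (G x b)^* * v x))%:C%C.
  by rewrite ler0c sum_sqn_ge0.
rewrite realC_sum; under [RHS]eq_bigr do rewrite -mul_conj_sqn mulrC conj_sum mulr_suml.
rewrite [RHS]exchange_big /=; apply: eq_bigr => x _.
under [RHS]eq_bigr do rewrite mulr_sumr.
rewrite [RHS]exchange_big /=; apply: eq_bigr => y _.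
rewrite mulr_sumr mulr_suml; apply: eq_bigr => b _; rewrite conjM conjCK; ring.
Qed.

Lemma sum_herm_eigen (X : finType) (U : 'I_#|X| -> X -> C) (a : 'I_#|X| -> R) :
  orthobasis U -> forall x y,
  \sum_z (\sum_l (a l)%:C%C * U l x * (U l z)^*) *
         (\sum_l (a l)%:C%C * U l z * (U l y)^*)
  = \sum_l (a l ^+ 2)%:C%C * U l x * (U l y)^*.
Proof.
move=> Ub x y.
under eq_bigr do rewrite mulr_suml.
rewrite exchange_big /=; apply: eq_bigr => l _.
under eq_bigr do rewrite mulr_sumr.
rewrite exchange_big /= (bigD1 l) //= [X in _ + X]big1 ?addr0 => [|l' /negbTE nl].
  rewrite (eq_bigr (fun z => ((a l ^+ 2)%:C%C * U l x * (U l y)^*) * ((U l z)^* * U l z))).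
    by rewrite -mulr_sumr Ub.1 eqxx mulr1.
  by move=> z _; rewrite expr2 realCM; ring.
rewrite (eq_bigr (fun z => ((a l)%:C%C * U l x * (a l')%:C%C * (U l' y)^*) * ((U l z)^* * U l' z))).
  by rewrite -mulr_sumr Ub.1 eq_sym nl mulr0.
by move=> z _; ring.
Qed.

Lemma sum_delta_l (T : finType) (x : T) (F : T -> C) :
  \sum_z (x == z)%:R * F z = F x.
Proof. by under eq_bigr do rewrite eq_sym; exact: sum_delta. Qed.

(* Powers-Stormer: the eigenbasis of S - diag(t) turns |S - diag t|_2^2 into
   a lower bound for the trace norm of S^2 - diag(t^2). *)
Lemma powers_stormer (X : finType) (S : X -> X -> C) (t : X -> R) (c : R) :
  (forall x, 0 <= t x) -> psdop S ->
  (forall U : 'I_#|X| -> X -> C, orthobasis U ->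
    \sum_l `|complex.Re (\sum_x \sum_y (U l x)^* *
       (\sum_z S x z * S z y - (x == y)%:R * ((t x) ^+ 2)%:C%C) * U l y)| <= c) ->
  complex.Re (\sum_x \sum_z S x z * S z x) + \sum_x t x ^+ 2 - c <=
     2 * \sum_x t x * complex.Re (S x x).
Proof.
move=> t0 Sp hc.
have Sh := psd_hermop Sp.
pose D : op R X X := fun x y => S x y - (x == y)%:R * (t x)%:C%C.
have Dh : hermop D.
  move=> x y; rewrite /D conjD conjN conjM conj_nat conj_realC -Sh eq_sym.
  by case: eqP => [->//|_]; rewrite !mul0r.
have [U [Ub DE]] := spectral_op Dh.
set mu := fun l => complex.Re (spectral_diag (tomx D) 0 l) in DE.
have DU l x : \sum_y S x y * U l y = (t x + mu l)%:C%C * U l x.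
  have := spectral_eigen Ub DE l x; rewrite /D.
  under eq_bigr do rewrite mulrBl -mulrA.
  rewrite sumrB sum_delta_l => /eqP; rewrite subr_eq => /eqP ->.
  by rewrite realCD; ring.
have Un l : \sum_x sqn (U l x) = 1.
  apply: (@complexI R); rewrite realC_sum.
  under eq_bigr do rewrite -mul_conj_sqn mulrC.
  by rewrite Ub.1 eqxx.
pose tau l := \sum_x t x * sqn (U l x).
have tau0 l : 0 <= tau l by apply: sumr_ge0 => x _; rewrite mulr_ge0 ?sqn_ge0.
have taumu l : 0 <= tau l + mu l.
  have := Sp (U l); under eq_bigr => x _.
    under eq_bigr do rewrite -mulrA.
    rewrite -mulr_sumr DU mulrCA [_^* * _]mulrC mul_conj_sqn -realCM.
    over.
  rewrite -realC_sum ler0c; under eq_bigr do rewrite mulrDl.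
  by rewrite big_split /= -mulr_sumr Un mulr1.
have HQ l : \sum_x \sum_y (U l x)^* *
       (\sum_z S x z * S z y - (x == y)%:R * ((t x) ^+ 2)%:C%C) * U l y
     = (2 * mu l * tau l + mu l ^+ 2)%:C%C.
  under eq_bigr => x _.
    under eq_bigr do rewrite mulrBr mulrBl.
    rewrite sumrB.
    have -> : \sum_y (U l x)^* * ((x == y)%:R * ((t x) ^+ 2)%:C%C) * U l y =
        (t x ^+ 2 * sqn (U l x))%:C%C.
      rewrite (eq_bigr (fun y => (x == y)%:R * ((U l x)^* * ((t x) ^+ 2)%:C%C * U l y))).
        by rewrite sum_delta_l realCM -mul_conj_sqn; ring.
      by move=> y _; ring.
    over.
  rewrite sumrB.
  have -> : \sum_x \sum_y (U l x)^* * (\sum_z S x z * S z y) * U l y =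
      \sum_z ((t z + mu l) ^+ 2 * sqn (U l z))%:C%C.
    transitivity (\sum_z (\sum_x S z x * U l x)^* * (\sum_y S z y * U l y)).
      under [RHS]eq_bigr do rewrite conj_sum mulr_suml.
      rewrite [RHS]exchange_big /=; apply: eq_bigr => x _.
      under [RHS]eq_bigr do rewrite mulr_sumr.
      rewrite [RHS]exchange_big /=; apply: eq_bigr => y _.
      rewrite mulr_sumr mulr_suml; apply: eq_bigr => z _.
      by rewrite conjM -Sh; ring.
    apply: eq_bigr => z _.
    by rewrite DU conjM conj_realC realCM -mul_conj_sqn expr2 realCM; ring.
  rewrite -realC_sum -realC_sum -realCB -sumrB; congr (_%:C%C).
  transitivity (\sum_x (2 * mu l * (t x * sqn (U l x)) + mu l ^+ 2 * sqn (U l x))).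
    by apply: eq_bigr => x _; ring.
  by rewrite big_split /= -!mulr_sumr Un mulr1.
(* The form at [U l] is mu (2 tau + mu). Since tau >= 0 and tau + mu >= 0, its modulus is at least
   mu^2 for either sign of mu. *)
have le1 : \sum_l mu l ^+ 2 <= c.
  apply: le_trans (hc U Ub); apply: ler_sum => l _.
  rewrite HQ /=; have := tau0 l; have := taumu l.
  have [m0|m0] := leP 0 (mu l); move=> h1 h2.
    by rewrite ger0_norm; nra.
  by rewrite ler0_norm; nra.
have e2 : \sum_l mu l ^+ 2 = complex.Re (\sum_x \sum_z S x z * S z x)
    + \sum_x t x ^+ 2 - 2 * \sum_x t x * complex.Re (S x x).
  have trDD : \sum_x \sum_z D x z * D z x = (\sum_l mu l ^+ 2)%:C%C.
    under eq_bigr => x _.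
      under eq_bigr do rewrite (DE x) (DE _ x).
      rewrite (sum_herm_eigen mu Ub).
      over.
    rewrite exchange_big /= realC_sum; apply: eq_bigr => l _.
    rewrite (eq_bigr (fun x => (mu l ^+ 2)%:C%C * ((U l x)^* * U l x))); last first.
      by move=> x _; ring.
    by rewrite -mulr_sumr Ub.1 eqxx mulr1.
  have /(congr1 (@complex.Re R)) /= <- := trDD.
  rewrite mulr_sumr.
  have -> : \sum_x \sum_z D x z * D z x = \sum_x (\sum_z S x z * S z x +
     (t x ^+ 2)%:C%C - (2 * t x)%:C%C * S x x).
    apply: eq_bigr => x _; rewrite /D.
    rewrite (eq_bigr (fun z => S x z * S z x - (x == z)%:R * ((t x)%:C%C * S z x)
       - (z == x)%:R * (S x z * (t z)%:C%C)
       + (x == z)%:R * ((z == x)%:R * ((t x)%:C%C * (t z)%:C%C)))); last first.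
      by move=> z _; ring.
    rewrite big_split /= !sumrB !sum_delta_l sum_delta eqxx mul1r.
    by rewrite expr2 !realCM realC_nat; ring.
  rewrite sumrB big_split cReD cReN cReD -realC_sum cRe_realC; congr (_ + _ - _).
  rewrite cRe_sum; apply: eq_bigr => x _.
  by rewrite cReMl mulrA.
by move: le1; rewrite e2; lra.
Qed.

(* V is the conjugate of the coisometric part of G = S W, S = sqrt(G G^+) *)
Lemma uhlmann (X B : finType) (G : X -> B -> C) (t : X -> R) (c : R) :
  (forall x, 0 <= t x) ->
  (forall U : 'I_#|X| -> X -> C, orthobasis U ->
    \sum_l `|complex.Re (\sum_x \sum_y (U l x)^* *
       (\sum_b G x b * (G y b)^* - (x == y)%:R * ((t x) ^+ 2)%:C%C) * U l y)| <= c) ->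
  exists V : X -> B -> C,
    (forall u : B -> C, \sum_x sqn (\sum_b V x b * u b) <= \sum_b sqn (u b)) /\
    (\sum_x \sum_b sqn (G x b) + \sum_x t x ^+ 2 - c) / 2 <=
     complex.Re (\sum_x (t x)%:C%C * \sum_b G x b * V x b).
Proof.
move=> t0 hc.
pose H : op R X X := fun x x' => \sum_b G x b * (G x' b)^*.
have Hp : psdop H := gram_psd G.
have [U [Ub HE]] := spectral_op (psd_hermop Hp).
have lam0 := psd_eigen_ge0 Hp Ub HE.
set lam := fun l => complex.Re (spectral_diag (tomx H) 0 l) in HE lam0.
pose s l := Num.sqrt (lam l).
have s2 l : s l ^+ 2 = lam l by rewrite sqr_sqrtr ?lam0.
pose g l b := \sum_x (U l x)^* * G x b.
have gg l l' : \sum_b g l b * (g l' b)^* = (lam l)%:C%C * (l == l')%:R.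
  rewrite -(spectral_form Ub HE) /g.
  under eq_bigr do rewrite mulr_suml.
  rewrite exchange_big /=; apply: eq_bigr => x _.
  under eq_bigr do rewrite conj_sum mulr_sumr.
  rewrite exchange_big /=; apply: eq_bigr => y _.
  rewrite /H mulr_sumr mulr_suml; apply: eq_bigr => b _.
  by rewrite conjM conjCK; ring.
have GE x b : G x b = \sum_l U l x * g l b.
  rewrite /g; under eq_bigr do rewrite mulr_sumr.
  rewrite exchange_big /= -[LHS](sum_delta_l x (fun y => G y b)).
  apply: eq_bigr => y _; rewrite -Ub.2 mulr_suml.
  by apply: eq_bigr => l _; rewrite mulrA.
(* The inverse of a zero singular value is 0, so [W] is a partial isometry with the null directions
   removed. *)
pose W x b := \sum_l U l x * (((s l)^-1)%:C%C * g l b).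
have GW x y : \sum_b G x b * (W y b)^* = \sum_l (s l)%:C%C * U l x * (U l y)^*.
  rewrite /W; under eq_bigr do rewrite conj_sum mulr_sumr.
  rewrite exchange_big /=; apply: eq_bigr => l _.
  transitivity (\sum_l' U l' x * ((U l y)^* * ((s l)^-1)%:C%C) * \sum_b g l' b * (g l b)^*).
    under [RHS]eq_bigr do rewrite mulr_sumr.
    rewrite [RHS]exchange_big /=; apply: eq_bigr => b _.
    rewrite GE mulr_suml; apply: eq_bigr => l' _.
    by rewrite !conjM conj_realC; ring.
  rewrite (bigD1 l) //= [X in _ + X]big1 ?addr0 => [|l' /negbTE nl]; last first.
    by rewrite gg nl mulr0 mulr0.
  rewrite gg eqxx mulr1 -s2.
  have -> : (s l)%:C%C = ((s l)^-1 * s l ^+ 2)%:C%C :> C.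
    congr (_%:C%C); have [->|h] := eqVneq (s l) 0; first by rewrite expr0n mulr0.
    by rewrite expr2 mulKf.
  by rewrite realCM; ring.
exists (fun x b => (W x b)^*); split.
  move=> u.
  pose h l := ((s l)^-1)%:C%C * \sum_b g l b * (u b)^*.
  have -> : \sum_x sqn (\sum_b (W x b)^* * u b) = \sum_l sqn (h l).
    rewrite -(parseval h Ub); apply: eq_bigr => x _; rewrite -[LHS]sqn_conj conj_sum.
    congr sqn; rewrite /h /W; under eq_bigr do rewrite conjM conjCK mulr_suml.
    rewrite exchange_big /=; apply: eq_bigr => l _.
    by rewrite !mulr_sumr; apply: eq_bigr => b _; ring.
  (* [N] is the squared norm of the image of [u]. Written as a pairing of [u] with a vector of
     squared norm at most [N], it satisfies N^2 <= |u|^2 N. *)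
  set N := \sum_l _; have N0 : 0 <= N by apply: sum_sqn_ge0.
  have NE : N%:C%C = \sum_b (u b)^* * \sum_l ((s l)^-1)%:C%C * g l b * (h l)^*.
    rewrite /N realC_sum.
    under [RHS]eq_bigr do rewrite mulr_sumr.
    rewrite [RHS]exchange_big /=; apply: eq_bigr => l _.
    rewrite -mul_conj_sqn {1}/h mulr_sumr mulr_suml; apply: eq_bigr => b _; ring.
  have : sqn (N%:C%C : C) <= (\sum_b sqn (u b)) * N.
    rewrite NE; apply: le_trans (CS_sqn _ _) _.
    under eq_bigr do rewrite sqn_conj.
    apply: ler_wpM2l; first exact: sum_sqn_ge0.
    have := @parseval_fam R B _ (fun l b => ((s l)^-1)%:C%C * g l b)
       (fun l => (s l)^-1 ^+ 2 * lam l) (fun l => (h l)^*).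
    move=> ->.
      apply: ler_sum => l _; rewrite sqn_conj -[leRHS]mul1r; apply: ler_wpM2r; rewrite ?sqn_ge0 //.
      rewrite -s2 exprVn; have [->|h0] := eqVneq (s l) 0; first by rewrite expr0n mulr0.
      by rewrite mulVf // expf_neq0.
    move=> l l'.
    rewrite (eq_bigr (fun b => ((s l)^-1)%:C%C * ((s l')^-1)%:C%C * (g l' b * (g l b)^*))); last first.
      by move=> b _; rewrite conjM conj_realC; ring.
    rewrite -mulr_sumr gg eq_sym; case: eqP => [->|_]; last by rewrite mulr0 mulr0 mul0r.
    by rewrite mulr1 mul1r expr2 !realCM.
  rewrite sqn_real expr2; have [->|Nn0] := eqVneq N 0.
    by move=> _; apply: sum_sqn_ge0.
  by rewrite ler_pM2r // lt_neqAle eq_sym Nn0.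
pose S x y := \sum_l (s l)%:C%C * U l x * (U l y)^*.
have SS x y : \sum_z S x z * S z y = H x y.
  by rewrite /S (sum_herm_eigen s Ub) HE; apply: eq_bigr => l _; rewrite s2.
have Sp : psdop (S : op R X X).
  move=> v; suff -> : \sum_x \sum_y (v x)^* * S x y * v y =
     (\sum_l s l * sqn (\sum_x (U l x)^* * v x))%:C%C.
    by rewrite ler0c; apply: sumr_ge0 => l _; rewrite mulr_ge0 ?sqrtr_ge0 ?sqn_ge0.
  rewrite realC_sum; under [RHS]eq_bigr do rewrite realCM -mul_conj_sqn conj_sum mulr_suml mulr_sumr.
  rewrite [RHS]exchange_big /= [LHS]exchange_big /=; apply: eq_bigr => y _.
  under [RHS]eq_bigr do rewrite mulr_sumr mulr_sumr.
  rewrite [RHS]exchange_big /=; apply: eq_bigr => x _.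
  rewrite /S mulr_sumr mulr_suml; apply: eq_bigr => l _.
  by rewrite conjM conjCK; ring.
have := @powers_stormer X S t c t0 Sp.
have -> : complex.Re (\sum_x \sum_z S x z * S z x) = \sum_x \sum_b sqn (G x b).
  apply: (@complexI R); rewrite realC_sum.
  under eq_bigr do rewrite SS.
  have -> : \sum_x H x x = \sum_x (\sum_b sqn (G x b))%:C%C.
    apply: eq_bigr => x _; rewrite realC_sum; apply: eq_bigr => b _.
    by rewrite mul_conj_sqn.
  by rewrite -realC_sum.
move=> h; rewrite ler_pdivrMr //.
apply: le_trans (h _) _.
  move=> U' Ub'; apply: le_trans (hc U' Ub'); apply: ler_sum => l _.
  rewrite (_ : complex.Re _ = complex.Re (\sum_x \sum_y (U' l x)^* *
      (\sum_b G x b * (G y b)^* - (x == y)%:R * (t x ^+ 2)%:C%C) * U' l y)) //.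
  by congr complex.Re; apply: eq_bigr => x _; apply: eq_bigr => y _; rewrite SS.
rewrite mulrC cRe_sum; rewrite le_eqVlt; apply/orP; left; apply/eqP; congr (_ * _).
by apply: eq_bigr => x _; rewrite cReMl GW.
Qed.

End Uhlmann.

(** * Fidelity with a pure state *)

Section Fidelity.
Variable R : realType.
Local Notation C := R[i].

Lemma tomx_psd (T : finType) (A : op R T T) : psdop A ->
  exists Y : 'M[C]_#|T|, tomx A = adjmx Y *m Y.
Proof.
move=> Ap; have [w wE] := psd_factor Ap.
exists (\matrix_(l, j) (w l (enum_val j))^*); apply/matrixP => i j.
rewrite !mxE wE; apply: eq_bigr => l _.
by rewrite adjmxE !mxE conjCK.
Qed.

Lemma sqrtC_realC (a : R) : 0 <= a -> sqrtC (a%:C%C : C) = (Num.sqrt a)%:C%C.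
Proof.
move=> a0; rewrite -{1}(sqr_sqrtr a0) expr2 realCM -expr2 sqrCK //.
by rewrite ler0c sqrtr_ge0.
Qed.

Section PsdMatrix.
Variables (n : nat) (M Y : 'M[C]_n).
Hypothesis MY : M = adjmx Y *m Y.

Let Mh : adjmx M = M.
Proof. by rewrite MY adjmxM adjmxK. Qed.

Lemma psdmx_diag : exists2 d : 'I_n -> R, (forall l, 0 <= d l) &
  forall l, spectral_diag M 0 l = (d l)%:C%C.
Proof.
exists (fun l => complex.Re (spectral_diag M 0 l)); last exact: herm_spectral_diag_real.
move=> l; set P := spectralmx M.
have Pu : P \is unitarymx by apply: spectral_unitarymx.
have h2 : diag_mx (spectral_diag M) = adjmx (Y *m adjmx P) *m (Y *m adjmx P).
  rewrite adjmxM adjmxK -mulmxA (mulmxA (adjmx Y)) -MY [X in _ *m (X *m _)](herm_spectral Mh) -/P !mulmxA.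
  by rewrite adj_mulVr // mul1mx -mulmxA adj_mulVr // mulmx1.
have /matrixP /(_ l l) := h2; rewrite !mxE eqxx mulr1n => ->.
rewrite cRe_sum; apply: sumr_ge0 => i _.
by rewrite adjmxE mulrC mul_conj_sqn sqn_ge0.
Qed.

Lemma sqrtmx_adj : adjmx (sqrtmx M) = sqrtmx M.
Proof.
have [d d0 dE] := psdmx_diag.
rewrite /sqrtmx !adjmxM adjmxK mulmxA; congr (_ *m _ *m _).
apply/matrixP => i j; rewrite adjmxE !mxE eq_sym; case: eqP => [->|_].
  by rewrite !mulr1n dE sqrtC_realC // conj_realC.
by rewrite !mulr0n conjE conjc0.
Qed.

Lemma sqrtmx_sqr : sqrtmx M *m sqrtmx M = M.
Proof.
rewrite [RHS](herm_spectral Mh) /sqrtmx.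
rewrite -!mulmxA (mulmxA (spectralmx M)) adj_mulVr ?spectral_unitarymx // mul1mx.
congr (_ *m _); rewrite !mulmxA; congr (_ *m _).
apply/matrixP => i j; rewrite mul_mx_diag !mxE.
by case: eqP => [->|_]; rewrite ?mulr1n ?mulr0n ?mul0r // -expr2 sqrtCK.
Qed.

(** The square of the sum of all [Num.sqrt (d l)] contains every [d l] among its nonnegative
    terms. *)
Lemma tr_sqrtmx_ge : Num.sqrt (complex.Re (\tr M)) <= complex.Re (\tr (sqrtmx M)).
Proof.
have [d d0 dE] := psdmx_diag.
have trM : \tr M = (\sum_l d l)%:C%C.
  rewrite (herm_spectral Mh) mxtrace_mulC mulmxA adj_mulVr ?spectral_unitarymx // mul1mx.
  rewrite mxtrace_diag realC_sum; apply: eq_bigr => l _; exact: dE.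
have trS : \tr (sqrtmx M) = (\sum_l Num.sqrt (d l))%:C%C.
  rewrite /sqrtmx mxtrace_mulC mulmxA adj_mulVr ?spectral_unitarymx // mul1mx.
  rewrite mxtrace_diag realC_sum; apply: eq_bigr => l _.
  by rewrite !mxE dE sqrtC_realC.
rewrite trM trS !cRe_realC.
have s0 : 0 <= \sum_l Num.sqrt (d l) by apply: sumr_ge0 => l _; apply: sqrtr_ge0.
rewrite -[leRHS]ger0_norm // -sqrtr_sqr ler_wsqrtr //.
rewrite expr2 mulr_suml; apply: ler_sum => l _.
rewrite -{1}(sqr_sqrtr (d0 l)) expr2; apply: ler_wpM2l; rewrite ?sqrtr_ge0 //.
by rewrite (bigD1 l) //= lerDl; apply: sumr_ge0 => i _; apply: sqrtr_ge0.
Qed.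

End PsdMatrix.

Lemma trnorm_ge n (X : 'M[C]_n) :
  Num.sqrt (complex.Re (\tr (adjmx X *m X))) <= trnorm X.
Proof.
rewrite /trnorm; set M := (Y in sqrtmx Y).
have MX : M = adjmx X *m X by [].
rewrite -MX; exact: tr_sqrtmx_ge MX.
Qed.

(** The trace norm dominates the Hilbert-Schmidt norm of sqrt(P) sqrt(s), whose square is the trace
    of P s. For the projector on a pure state this is the weight of [s] on that state. *)
Lemma fidelity_ge (T : finType) (P s : op R T T) : psdop P -> psdop s ->
  Num.sqrt (complex.Re (\sum_x \sum_y P x y * s y x)) <= fidelity P s.
Proof.
move=> /tomx_psd[Y PY] /tomx_psd[Z sZ].
rewrite /fidelity; set X := _ *m _.
apply: le_trans (trnorm_ge X).
rewrite le_eqVlt; apply/orP; left; apply/eqP; congr (Num.sqrt (complex.Re _)).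
rewrite /X adjmxM (sqrtmx_adj PY) (sqrtmx_adj sZ).
rewrite -mulmxA (mulmxA (sqrtmx (tomx P))) (sqrtmx_sqr PY).
rewrite mxtrace_mulC -mulmxA (sqrtmx_sqr sZ); symmetry.
rewrite [RHS](reindex _ (onW_bij _ (@enum_val_bij T))) /=; apply: eq_bigr => i _.
rewrite mxE [RHS](reindex _ (onW_bij _ (@enum_val_bij T))) /=; apply: eq_bigr => j _.
by rewrite !mxE.
Qed.

End Fidelity.

(** * Sums and products over dependent functions *)

Section DependentProducts.

(** The local index types differ from party to party, so distributivity is stated for dependent
    functions; [fprod] supplies its tagged form. *)
Lemma sum_dffun_prod (V : comPzRingType) (I : finType) (T : I -> finType)
   (F : forall i, T i -> V) :
  \sum_(f : {dffun forall i, T i}) \prod_i F i (f i) = \prod_i \sum_(t : T i) F i t.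
Proof.
transitivity (\sum_(f : fprod T) \prod_i F i (f i)).
  rewrite (reindex _ (onW_bij _ (@dffun_of_fprod_bij I T))) /=.
  by apply: eq_bigr => f _; apply: eq_bigr => i _; rewrite ffunE.
pose P i : {ffun T i -> V} := [ffun t => F i t].
transitivity (\sum_(f : fprod T) \prod_(i in I) P i (f i)).
  by apply: eq_bigr => f _; apply: eq_bigr => i _; rewrite ffunE.
rewrite (@big_fprod V 0 1 *%R +%R I T P).
rewrite -(bigA_distr_big_dep (fun i j => j \in tagged_with T i)
   (fun i j => untag 0 (P i) j)) /=.
apply: eq_bigr => i _; rewrite (big_tag (fun i t => F i t)).
apply: eq_bigr => j _; congr (untag _ _ _); apply: funext => t; exact: ffunE.
Qed.

Lemma sum_dffun_pair (V : nmodType) (I : finType) (T S : I -> finType)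
    (F : {dffun forall i, T i} -> {dffun forall i, S i} -> V) :
  \sum_(w : {dffun forall i, (T i * S i)%type}) F [ffun i => (w i).1] [ffun i => (w i).2]
  = \sum_f \sum_g F f g.
Proof.
rewrite pair_big /=.
pose h (w : {dffun forall i, (T i * S i)%type}) : {dffun forall i, T i} * {dffun forall i, S i} :=
  ([ffun i => (w i).1], [ffun i => (w i).2]).
rewrite (reindex h) //=.
exists (fun p : {dffun forall i, T i} * {dffun forall i, S i} =>
   [ffun i => (p.1 i, p.2 i)] : {dffun forall i, (T i * S i)%type}) => [w _|[f g] _] /=.
  by apply/ffunP => i; rewrite !ffunE -surjective_pairing.
by rewrite /h; congr (_, _); apply/ffunP => i; rewrite !ffunE.
Qed.

Lemma card_dffun (I : finType) (T : I -> finType) :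
  #|{dffun forall i, T i}| = (\prod_i #|T i|)%N.
Proof. by rewrite card_dep_ffun foldrE big_map big_enum. Qed.

End DependentProducts.

(** * Tensor products of bounded operators *)

Section Tensor.
Variable R : realType.
Local Notation C := R[i].

(* each factor dilates to a multiple of an isometry, for which the bound is an equality *)
Lemma tensor_bound (I : finType) (P W : I -> finType) (M : forall j, W j -> P j -> C) (c : I -> R) :
  (forall j (u : P j -> C),
     \sum_w sqn (\sum_p M j w p * u p) <= c j * \sum_p sqn (u p)) ->
  forall Y : {dffun forall j, P j} -> C,
  \sum_(w : {dffun forall j, W j}) sqn (\sum_(p : {dffun forall j, P j}) (\prod_j M j (w j) (p j)) * Y p)
   <= (\prod_j c j) * \sum_p sqn (Y p).
Proof.
move=> hM Y.
pose N j := projT1 (cid (dilation (hM j))).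
have NE j := projT2 (cid (dilation (hM j))).
pose Wh j : finType := (W j + 'I_#|P j|)%type.
pose Mh j (w : Wh j) (p : P j) : C :=
  match w with inl w => M j w p | inr l => N j l p end.
pose Yh (w : {dffun forall j, Wh j}) := sqn (\sum_(p : {dffun forall j, P j}) (\prod_j Mh j (w j) (p j)) * Y p).
have <- : \sum_w Yh w = (\prod_j c j) * \sum_p sqn (Y p).
  have := @parseval_fam R {dffun forall j, Wh j} {dffun forall j, P j}
    (fun (p : {dffun forall j, P j}) (w : {dffun forall j, Wh j}) => \prod_j Mh j (w j) (p j)) (fun _ => \prod_j c j) Y.
  rewrite mulr_sumr => <- // p p'.
  transitivity (\sum_(w : {dffun forall j, Wh j}) \prod_j ((Mh j (w j) (p j))^* * Mh j (w j) (p' j))).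
    by apply: eq_bigr => w _; rewrite big_split /= conj_prod.
  rewrite (@sum_dffun_prod C I Wh (fun j w => (Mh j w (p j))^* * Mh j w (p' j))).
  have -> : (p == p')%:R = \prod_j ((p j == p' j)%:R : C).
    have [->|ne] := eqVneq p p'; first by rewrite big1 // => j _; rewrite eqxx.
    have [j hj] : exists j, p j != p' j.
      apply/existsP; apply: contraNT ne => /existsPn h.
      by apply/eqP/ffunP => j; apply/eqP; rewrite -[_ == _]negbK h.
    by rewrite (bigD1 j) //= (negbTE hj) mul0r.
  rewrite realC_prod -big_split /=; apply: eq_bigr => j _.
  by rewrite mulrC -(NE j) big_sumType.
have := @ler_sum_inj R {dffun forall j, W j} {dffun forall j, Wh j}
  (fun (w : {dffun forall j, W j}) => [ffun j => inl (w j)] : {dffun forall j, Wh j}) Yh.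
move=> h; apply: le_trans (h _ _).
- apply: ler_sum => w _; rewrite /Yh.
  rewrite le_eqVlt; apply/orP; left; apply/eqP; congr sqn; apply: eq_bigr => p _.
  by congr (_ * _); apply: eq_bigr => j _; rewrite ffunE.
- move=> w w' /ffunP e; apply/ffunP => j; have := e j; rewrite !ffunE.
  by case.
- by move=> w; apply: sqn_ge0.
Qed.

End Tensor.

(** * Random Hadamard measurements *)

Section Characters.
Variable R : realType.
Local Notation C := R[i].

Definition sg (b : bool) : R := if b then -1 else 1.

Lemma sg_sqr b : sg b * sg b = 1.
Proof. by case: b; rewrite /sg ?mulrNN mulr1. Qed.

Variable T : finType.

(** The Walsh characters of (Z/2)^T. They serve twice: as entries of Hadamard matrices and, for
    two-element sets, as products of two random signs. *)
Definition chi (S : {set T}) (e : {ffun T -> bool}) : R :=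
  \prod_t (if t \in S then sg (e t) else 1).

Lemma chi_sqr S e : chi S e * chi S e = 1.
Proof.
rewrite /chi -big_split /= big1 // => t _.
by case: ifP => _; rewrite ?sg_sqr ?mulr1.
Qed.

Lemma chi_orth S S' : \sum_e chi S e * chi S' e = (S == S')%:R * 2 ^+ #|T|.
Proof.
under eq_bigr do rewrite /chi -big_split /=.
rewrite -(bigA_distr_bigA (fun t b => (if t \in S then sg b else 1) *
   (if t \in S' then sg b else 1))) /=.
have [->|ne] := eqVneq S S'.
  rewrite mul1r -prodr_const; apply: eq_bigr => t _.
  by rewrite big_bool /=; case: ifP; rewrite /sg ?mulrNN !mulr1.
have [t ht] : exists t, (t \in S) != (t \in S').
  apply/existsP; apply: contraNT ne => /existsPn h.
  by apply/eqP/setP => t; apply/eqP; rewrite -[_ == _]negbK h.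
rewrite (bigD1 t) //= big_bool /= mul0r.
suff -> : (if t \in S then sg true else 1) * (if t \in S' then sg true else 1) +
  (if t \in S then sg false else 1) * (if t \in S' then sg false else 1) = 0 by rewrite mul0r.
by move: ht; case: (t \in S); case: (t \in S') => //= _; rewrite /sg; ring.
Qed.

Lemma chi2 x y e : x != y -> chi [set x; y]%SET e = sg (e x) * sg (e y).
Proof.
move=> xy; rewrite /chi (bigD1 x) //= (bigD1 y) 1?eq_sym //= !inE !eqxx orbT mulrA.
rewrite big1 ?mulr1 // => t /andP[tx ty].
by rewrite !inE (negbTE tx) (negbTE ty).
Qed.

(** An asymmetric relation picks each unordered pair at most once, so the sign products are distinct
    characters and Parseval gives the second moment exactly. *)
Lemma sign_moment_lt (c : T -> T -> C) (lt : T -> T -> bool) :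
  (forall x, ~~ lt x x) -> (forall x y, lt x y -> ~~ lt y x) ->
  \sum_(e : {ffun T -> bool}) sqn (\sum_x \sum_(y | lt x y) (sg (e x) * sg (e y))%:C%C * c x y)
   = 2 ^+ #|T| * \sum_x \sum_(y | lt x y) sqn (c x y).
Proof.
move=> ltxx ltxy.
have h := @parseval_fam R {ffun T -> bool} (T * T)%type
  (fun l (e : {ffun T -> bool}) => (lt l.1 l.2)%:R * (chi [set l.1; l.2]%SET e)%:C%C)
  (fun l => (lt l.1 l.2)%:R * 2 ^+ #|T|) (fun l => c l.1 l.2).
have e1 (V : zmodType) (F : T -> T -> V) : \sum_x \sum_(y | lt x y) F x y =
    \sum_l (if lt l.1 l.2 then F l.1 l.2 else 0).
  rewrite -(pair_bigA _ (fun x y => if lt x y then F x y else 0)) /=.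
  by apply: eq_bigr => x _; rewrite big_mkcond.
under eq_bigr do rewrite e1.
rewrite e1 mulr_sumr; transitivity (\sum_l (lt l.1 l.2)%:R * 2 ^+ #|T| * sqn (c l.1 l.2)).
  rewrite -h.
    apply: eq_bigr => e _; congr sqn; apply: eq_bigr => -[x y] _ /=.
    case: ifP => xy; last by rewrite !mul0r.
    by rewrite mul1r chi2 //; apply: contraTneq xy => ->; apply: ltxx.
  move=> [x y] [x' y'] /=.
  rewrite (eq_bigr (fun e : {ffun T -> bool} => (lt x y && lt x' y')%:R * (chi [set x; y]%SET e * chi [set x'; y']%SET e)%:C%C)); last first.
    move=> e _; rewrite conjM conj_nat conj_realC realCM.
    by case: (lt x y); case: (lt x' y') => /=; ring.
  rewrite -mulr_sumr -realC_sum chi_orth.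
  have [[<- <-]|ne] := eqVneq (x, y) (x', y').
    by rewrite eqxx andbb mul1r mul1r realCM realC_nat.
  rewrite mul0r; case: (boolP (lt x y && lt x' y')) => [/andP[h1 h2]|_]; last by rewrite mul0r.
  suff /negbTE -> : [set x; y]%SET != [set x'; y']%SET by rewrite mul0r mulr0.
  apply: contraNneq ne => /setP es.
  have xx : x != y by apply: contraTneq h1 => ->; apply: ltxx.
  have := es x; have := es y; rewrite !inE !eqxx orbT /= => /esym/orP[]/eqP ey /esym/orP[]/eqP ex.
  - by rewrite ex ey eqxx in xx.
  - by move: (ltxy _ _ h1); rewrite ex ey h2.
  - by rewrite ex ey.
  - by rewrite ex ey eqxx in xx.
by apply: eq_bigr => l _; case: ifP => _; rewrite ?mul0r ?mulr0 // mul1r.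
Qed.

(** Each of the two orders of a pair is treated by the exact formula; joining them costs the factor
    2. *)
Lemma sign_moment (c : T -> T -> C) :
  \sum_(e : {ffun T -> bool}) sqn (\sum_x \sum_(y | x != y) (sg (e x) * sg (e y))%:C%C * c x y)
   <= 2 * 2 ^+ #|T| * \sum_x \sum_y sqn (c x y).
Proof.
pose lt (x y : T) := (enum_rank x < enum_rank y)%N.
pose gt (x y : T) := lt y x.
have split (V : zmodType) (F : T -> T -> V) : \sum_x \sum_(y | x != y) F x y =
   \sum_x \sum_(y | lt x y) F x y + \sum_x \sum_(y | gt x y) F x y.
  rewrite -big_split /=; apply: eq_bigr => x _.
  rewrite (bigID (lt x)) /=; congr (_ + _); apply: eq_bigl => y; rewrite /gt /lt.
    have [->|ne] := eqVneq x y; first by rewrite ltnn.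
    by [].
  rewrite -(inj_eq enum_rank_inj) -val_eqE /=; by case: ltngtP.
apply: (@le_trans _ _ (\sum_(e : {ffun T -> bool}) (2 * sqn (\sum_x \sum_(y | lt x y) (sg (e x) * sg (e y))%:C%C * c x y)
   + 2 * sqn (\sum_x \sum_(y | gt x y) (sg (e x) * sg (e y))%:C%C * c x y)))).
  by apply: ler_sum => e _; rewrite split; apply: sqnD2.
rewrite big_split /= -!mulr_sumr !sign_moment_lt; first last.
- by move=> x y; rewrite /lt -leqNgt; apply: ltnW.
- by move=> x; rewrite /lt ltnn.
- by move=> x y; rewrite /gt /lt -leqNgt; apply: ltnW.
- by move=> x; rewrite /gt /lt ltnn.
rewrite -mulrDr -mulrDr -split -mulrA; apply: ler_wpM2l => //.
apply: ler_wpM2l; first by rewrite exprn_ge0.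
apply: ler_sum => x _; rewrite [leRHS](bigID (fun y => x != y)) /= lerDl.
exact: sum_sqn_ge0.
Qed.

End Characters.

(** * Averaging over signs and permutations *)

Section RandomMeasurement.
Variable R : realType.
Local Notation C := R[i].

Lemma bij_of_card (A B : finType) : #|A| = #|B| -> exists f : A -> B, bijective f.
Proof.
move=> e; exists (fun a => enum_val (cast_ord e (enum_rank a))).
exists (fun b => enum_val (cast_ord (esym e) (enum_rank b))) => x.
  by rewrite enum_valK cast_ordK enum_rankK.
by rewrite enum_valK cast_ordKV enum_rankK.
Qed.

Lemma inj_of_card (A B : finType) : (#|A| <= #|B|)%N -> exists f : A -> B, injective f.
Proof.
move=> le; exists (fun a => enum_val (widen_ord le (enum_rank a))) => x y.
by move=> /enum_val_inj /(congr1 val) /= /val_inj /enum_rank_inj.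
Qed.

Lemma sum_const_neq (X : finType) (u : X) (c : R) :
  \sum_(u' | u' != u) c = c * (#|X|.-1)%:R.
Proof.
by rewrite (eq_bigl (fun u' => u' \in predC1 u)) // sumr_const cardC1 mulr_natr.
Qed.

(** The symmetric group is doubly transitive, so the average of [g (s p) (s p')] is the same for all
    pairs of distinct points. The equation is cleared of denominators. *)
Lemma sum_perm_pair (X : finType) (g : X -> X -> R) (p p' : X) : p != p' ->
  (\sum_(s : {perm X}) g (s p) (s p')) * (#|X|%:R * (#|X|.-1)%:R) =
  #|{perm X}|%:R * \sum_z \sum_(z' | z' != z) g z z'.
Proof.
move=> pp'; pose S u u' := \sum_(s : {perm X}) g (s u) (s u').
have SE u u' : u' != u -> S u u' = S p p'.
  move=> uu'; pose t : {perm X} := perm_mul (tperm u p) (tperm (tperm u p u') p').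
  have tu : t u = p.
    rewrite permM tpermL tpermD //.
    rewrite -[X in _ != X](tpermL u p) inj_eq //; exact: perm_inj.
    by rewrite eq_sym.
  have tu' : t u' = p' by rewrite permM tpermL.
  rewrite /S (reindex_inj (mulgI t)) /=; apply: eq_bigr => s _.
  by rewrite (permM t s u) (permM t s u') tu tu'.
have e1 : \sum_u \sum_(u' | u' != u) S u u' = S p p' * (#|X|%:R * (#|X|.-1)%:R).
  rewrite (eq_bigr (fun _ => S p p' * (#|X|.-1)%:R)) => [|u _].
    by rewrite sumr_const -mulr_natr; ring.
  rewrite (eq_bigr (fun _ => S p p')) => [|u' uu']; last exact: SE.
  exact: sum_const_neq.
rewrite -/(S p p') -e1.
transitivity (\sum_(s : {perm X}) \sum_u \sum_(u' | u' != u) g (s u) (s u')).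
  rewrite exchange_big /=; apply: eq_bigr => u _.
  by rewrite exchange_big.
rewrite mulr_natl -sumr_const; apply: eq_bigr => s _.
rewrite [RHS](reindex_inj (@perm_inj _ s)) /=; apply: eq_bigr => u _.
rewrite [RHS](reindex_inj (@perm_inj _ s)) /=; apply: eq_bigl => u'.
by rewrite (inj_eq perm_inj).
Qed.

(** Two distinct positions of a block land on a uniform pair of distinct points. Counting the pairs
    gives the factor (#Q - 1) / (#X - 1), which is at most #Q / #X. *)
Lemma sum_perm_blocks (X O Q : finType) (b : O * Q -> X) (g : X -> X -> R) : bijective b ->
  (forall z z', 0 <= g z z') ->
  (\sum_(s : {perm X}) \sum_o \sum_a \sum_(a' | a' != a) g (s (b (o, a))) (s (b (o, a')))) * #|X|%:R
   <= #|{perm X}|%:R * (#|Q|%:R * \sum_z \sum_z' g z z').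
Proof.
move=> bb g0.
have XE : #|X| = (#|O| * #|Q|)%N by rewrite -card_prod; apply/esym/(bij_eq_card bb).
pose G := \sum_z \sum_(z' | z' != z) g z z'.
have G0 : 0 <= G by apply: sumr_ge0 => z _; apply: sumr_ge0.
have GG : G <= \sum_z \sum_z' g z z'.
  apply: ler_sum => z _; rewrite [leRHS](bigID (fun z' => z' != z)) /= lerDl.
  exact: sumr_ge0.
apply: (@le_trans _ _ (#|{perm X}|%:R * (#|Q|%:R * G))); last first.
  by do 2! (apply: ler_wpM2l; first exact: ler0n).
set T := \sum_(s : {perm X}) _.
have TE : T = \sum_o \sum_a \sum_(a' | a' != a) \sum_(s : {perm X}) g (s (b (o, a))) (s (b (o, a'))).
  rewrite /T exchange_big /=; apply: eq_bigr => o _.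
  by rewrite exchange_big /=; apply: eq_bigr => a _; rewrite exchange_big.
have T2 : T * (#|X|%:R * (#|X|.-1)%:R) = #|X|%:R * (#|Q|.-1)%:R * (#|{perm X}|%:R * G).
  rewrite TE mulr_suml (eq_bigr (fun _ => #|Q|%:R * (#|Q|.-1)%:R * (#|{perm X}|%:R * G))).
    by rewrite sumr_const -mulr_natr XE natrM; ring.
  move=> o _; rewrite mulr_suml (eq_bigr (fun _ => (#|Q|.-1)%:R * (#|{perm X}|%:R * G))).
    by rewrite sumr_const -mulr_natr; ring.
  move=> a _; rewrite mulr_suml (eq_bigr (fun _ => (#|{perm X}|%:R * G))).
    by rewrite sum_const_neq; ring.
  move=> a' aa'; rewrite sum_perm_pair // (inj_eq (bij_inj bb)).
  by apply: contraNneq aa' => -[->].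
(* The factor [#|X|.-1] can be cancelled only for two or more points; below that no block contains
   two positions. *)
have [X1|X1] := leqP #|X| 1.
  suff -> : T = 0 by rewrite mul0r !mulr_ge0.
  rewrite TE big1 // => o _; rewrite big1 // => a _; rewrite big1 // => a' aa'.
  suff : b (o, a) = b (o, a') by move/(bij_inj bb) => -[e]; rewrite e eqxx in aa'.
  by move/card_le1_eqP: X1 => h; first [exact: h | apply/esym; exact: h].
have Q0 : (0 < #|Q|)%N by rewrite lt0n; apply: contraTneq X1 => e; rewrite XE e muln0.
have QX : (#|Q| <= #|X|)%N.
  rewrite XE leq_pmull // lt0n; apply: contraTneq X1 => e; by rewrite XE e mul0n.
have X1R : 0 < (#|X|.-1)%:R :> R by rewrite ltr0n -subn1 subn_gt0.
rewrite -(ler_pM2r X1R) -mulrA T2.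
have -> : #|{perm X}|%:R * (#|Q|%:R * G) * (#|X|.-1)%:R =
  (#|Q|%:R * (#|X|.-1)%:R) * (#|{perm X}|%:R * G) by ring.
apply: ler_wpM2r; first by rewrite mulr_ge0.
rewrite -!natrM ler_nat; case: #|Q| Q0 QX => // q _; case: #|X| X1 => // x _ /= qx.
by rewrite mulSn mulSn [(x * q)%N]mulnC leq_add2r.
Qed.
(** [A] is embedded into a Hadamard space of dimension D = 2^(k+l), whose points are cut into 2^l
    blocks of 2^k. All entries of [v] have squared modulus 1/D, so on the diagonal x = x' the terms
    with a = a' cancel exactly against the depolarizing kernel, and the permutation averages those
    with distinct positions down to a fraction 2^k / D. Off the diagonal the random signs
    decorrelate the unordered pairs. The constant 6 is 2 + 4: separating the two parts costs a
    factor 2, and the sign moment brings another 2 to the second one. *)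
Lemma random_measurement (k l : nat) (A : finType) : (#|A| <= 2 ^ (k + l))%N ->
  exists (Om : finType) (v : Om -> 'I_(2 ^ l) -> {ffun 'I_k -> bool} -> A -> C),
  [/\ (0 < #|Om|)%N,
      (forall w x x', \sum_o \sum_a (v w o a x)^* * v w o a x' = (x == x')%:R) &
      (forall Y : A -> A -> C,
        \sum_w \sum_o \sum_a \sum_a'
          sqn (\sum_x \sum_x' (v w o a x * (v w o a' x')^* -
             (a == a')%:R * (x == x')%:R * ((2 ^+ (k + l))^-1)%:C%C) * Y x x')
        <= #|Om|%:R * (6 * 2 ^+ k / 2 ^+ (k + l)) * \sum_x \sum_x' sqn (Y x x'))].
Proof.
set N := (k + l)%N; move=> cardA.
pose X : finType := {ffun 'I_N -> bool}.
pose Q : finType := {ffun 'I_k -> bool}.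
have cX : #|X| = (2 ^ N)%N by rewrite card_ffun card_bool card_ord.
have cQ : #|Q| = (2 ^ k)%N by rewrite card_ffun card_bool card_ord.
have [iota iotaI] : exists f : A -> X, injective f by apply: inj_of_card; rewrite cX.
have [b bb] : exists b : 'I_(2 ^ l) * Q -> X, bijective b.
  by apply: bij_of_card; rewrite card_prod card_ord cQ cX -expnD addnC.
pose supp (y : X) : {set 'I_N} := [set t | y t]%SET.
have suppI : injective supp.
  by move=> y y' /setP e; apply/ffunP => t; have := e t; rewrite !inE.
pose D : R := 2 ^+ N.
have D0 : 0 < D by rewrite exprn_gt0.
have DX : #|X|%:R = D by rewrite cX natrX.
pose s : R := (Num.sqrt D)^-1.
have s2 : s * s = D^-1 by rewrite -invfM -expr2 sqr_sqrtr // ltW.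
pose h (z : X) (x : A) : R := chi R (supp (iota x)) z.
have hh z x : h z x * h z x = 1 by apply: chi_sqr.
have ho x x' : \sum_z h z x * h z x' = (x == x')%:R * D.
  by rewrite chi_orth (inj_eq suppI) (inj_eq iotaI) card_ord.
pose v (w : {ffun A -> bool} * {perm X}) o a x : C :=
  (s * h (w.2 (b (o, a))) x * sg R (w.1 x))%:C%C.
exists ({ffun A -> bool} * {perm X})%type, v; split.
- by apply/card_gt0P; exists ([ffun _ => true], 1%g).
- move=> w x x'; rewrite pair_big /=.
  rewrite (eq_bigr (fun p => (s * s * (sg R (w.1 x) * sg R (w.1 x')) *
     (h (w.2 (b p)) x * h (w.2 (b p)) x'))%:C%C)); last first.
    case=> o a _; rewrite /v conj_realC -realCM /=; congr (_%:C%C); ring.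
  rewrite -realC_sum -mulr_sumr.
  have <- : \sum_z h z x * h z x' = \sum_p h (w.2 (b p)) x * h (w.2 (b p)) x'.
    rewrite (reindex_inj (@perm_inj _ w.2)) /=.
    by rewrite (reindex _ (onW_bij _ bb)).
  rewrite ho s2; have [->|_] := eqVneq x x'; last by rewrite mul0r mulr0.
  by rewrite sg_sqr mulr1 mul1r mulVf ?gt_eqF.
move=> Y; set NY := \sum_x \sum_x' sqn (Y x x').
have NY0 : 0 <= NY by apply: sumr_ge0 => x _; apply: sum_sqn_ge0.
pose Bf z z' := \sum_x (s * s * (h z x * h z' x))%:C%C * Y x x.
pose Ofn (e : {ffun A -> bool}) z z' := \sum_x \sum_(x' | x != x')
  (sg R (e x) * sg R (e x'))%:C%C * ((s * s * (h z x * h z' x'))%:C%C * Y x x').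
have val w o a a' : \sum_x \sum_x' (v w o a x * (v w o a' x')^* -
             (a == a')%:R * (x == x')%:R * ((2 ^+ N)^-1)%:C%C) * Y x x' =
   (if a' != a then Bf (w.2 (b (o, a))) (w.2 (b (o, a'))) else 0)
    + Ofn w.1 (w.2 (b (o, a))) (w.2 (b (o, a'))).
  have -> : (if a' != a then Bf (w.2 (b (o, a))) (w.2 (b (o, a'))) else 0) =
    \sum_x (v w o a x * (v w o a' x)^* - (a == a')%:R * ((2 ^+ N)^-1)%:C%C) * Y x x.
    rewrite eq_sym; have [<-|ne] := eqVneq a a' => /=.
      rewrite big1 // => x _; rewrite /v conj_realC -realCM mul1r -realCB.
      suff -> : s * h (w.2 (b (o, a))) x * sg R (w.1 x) * (s * h (w.2 (b (o, a))) x * sg R (w.1 x))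
         - (2 ^+ N)^-1 = 0 by rewrite mul0r.
      transitivity ((s * s) * (h (w.2 (b (o, a))) x * h (w.2 (b (o, a))) x) *
         (sg R (w.1 x) * sg R (w.1 x)) - D^-1); first by rewrite /D; ring.
      by rewrite hh sg_sqr s2; ring.
    apply: eq_bigr => x _; rewrite mul0r subr0 /v conj_realC -realCM; congr (_%:C%C * _).
    transitivity (s * s * (h (w.2 (b (o, a))) x * h (w.2 (b (o, a'))) x) * (sg R (w.1 x) * sg R (w.1 x))).
      by rewrite sg_sqr mulr1.
    by ring.
  rewrite /Ofn -big_split /=; apply: eq_bigr => x _.
  rewrite (bigD1 x) //= eqxx mulr1; congr (_ + _).
  rewrite (eq_bigl (fun x' => x != x')) => [|x']; last by rewrite eq_sym.
  apply: eq_bigr => x' /negbTE ->; rewrite mulr0 mul0r subr0 mulrA; congr (_ * _).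
  by rewrite /v conj_realC -!realCM; congr (_%:C%C); ring.
pose g z z' := sqn (Bf z z').
have gsum : \sum_z \sum_z' g z z' <= NY.
  have -> : \sum_z \sum_z' g z z' = \sum_x sqn (Y x x).
    rewrite pair_big /=.
    have := @parseval_fam R (X * X)%type A (fun x p => (s * s * (h p.1 x * h p.2 x))%:C%C)
       (fun _ => 1) (fun x => Y x x).
    move=> hp; under [RHS]eq_bigr do rewrite -[sqn _]mul1r.
    rewrite -hp // => x x'.
    rewrite mulr1 (eq_bigr (fun p => ((s * s * (h p.1 x * h p.1 x')) * (s * s * (h p.2 x * h p.2 x')))%:C%C)).
      rewrite -realC_sum.
      rewrite -(pair_big xpredT xpredT (fun p1 p2 => (s * s * (h p1 x * h p1 x')) * (s * s * (h p2 x * h p2 x')))) /=.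
      under eq_bigr do rewrite -mulr_sumr -mulr_sumr ho.
      rewrite -mulr_suml -mulr_sumr ho s2.
      have [_|_] := eqVneq x x'; last by rewrite mul0r mulr0 mul0r.
      by rewrite mul1r mulVf ?gt_eqF // mul1r.
    by move=> p _; rewrite conj_realC -realCM; congr (_%:C%C); ring.
  apply: ler_sum => x _; rewrite [leRHS](bigD1 x) //= lerDl.
  exact: sum_sqn_ge0.
have Osum z z' : \sum_(e : {ffun A -> bool}) sqn (Ofn e z z') <= 2 * #|{ffun A -> bool}|%:R * (D^-1 ^+ 2) * NY.
  apply: le_trans (sign_moment _) _.
  rewrite card_ffun card_bool natrX -[leRHS]mulrA; apply: ler_wpM2l.
    by rewrite mulr_ge0 // exprn_ge0.
  rewrite mulr_sumr; apply: ler_sum => x _; rewrite mulr_sumr; apply: ler_sum => x' _.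
  rewrite sqnM sqn_real s2.
  have -> : (D^-1 * (h z x * h z' x')) ^+ 2 = D^-1 ^+ 2 * ((h z x * h z x) * (h z' x' * h z' x')) by ring.
  by rewrite !hh !mulr1.
set LHS := (X in X <= _).
have step : LHS <= \sum_(w : {ffun A -> bool} * {perm X}) \sum_o \sum_a \sum_a'
   (2 * (if a' != a then g (w.2 (b (o, a))) (w.2 (b (o, a'))) else 0)
     + 2 * sqn (Ofn w.1 (w.2 (b (o, a))) (w.2 (b (o, a'))))).
  apply: ler_sum => w _; apply: ler_sum => o _; apply: ler_sum => a _; apply: ler_sum => a' _.
  rewrite val; apply: le_trans (sqnD2 _ _) _; rewrite lerD2r ler_wpM2l //.
  by case: ifP => // _; rewrite sqn0.
apply: le_trans step _.
under eq_bigr => w _ do under eq_bigr => o _ do under eq_bigr => a _ do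
  rewrite big_split /= -!mulr_sumr -big_mkcond /=.
under eq_bigr => w _ do under eq_bigr => o _ do rewrite big_split /= -!mulr_sumr.
under eq_bigr => w _ do rewrite big_split /= -!mulr_sumr.
rewrite big_split /= -!mulr_sumr.
rewrite -(pair_big xpredT xpredT (fun (e : {ffun A -> bool}) (p : {perm X}) => \sum_o \sum_a \sum_(a' | a' != a)
   g (p (b (o, a))) (p (b (o, a'))))) /=.
rewrite -(pair_big xpredT xpredT (fun (e : {ffun A -> bool}) (p : {perm X}) => \sum_o \sum_a \sum_a'
   sqn (Ofn e (p (b (o, a))) (p (b (o, a')))))) /=.
rewrite sumr_const.
set T1 := \sum_(p : {perm X}) _.
have T1le : T1 <= #|{perm X}|%:R * (2 ^+ k / D) * NY.
  have := sum_perm_blocks bb (fun z z' => sqn_ge0 (Bf z z')); rewrite DX cQ natrX -/T1 => hT.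
  rewrite -(ler_pM2r D0); apply: le_trans hT _.
  have -> : #|{perm X}|%:R * (2 ^+ k / D) * NY * D = #|{perm X}|%:R * (2 ^+ k * NY).
    by field; rewrite gt_eqF.
  by apply: ler_wpM2l => //; apply: ler_wpM2l => //; rewrite exprn_ge0.
set T2 := \sum_(e : {ffun A -> bool}) _.
have T2le : T2 <= #|{ffun A -> bool}|%:R * #|{perm X}|%:R * (2 * 2 ^+ k / D) * NY.
  rewrite /T2 exchange_big /=.
  apply: (@le_trans _ _ (\sum_(p : {perm X}) \sum_(o : 'I_(2 ^ l)) \sum_(a : Q) \sum_(a' : Q)
     2 * #|{ffun A -> bool}|%:R * (D^-1 ^+ 2) * NY)).
    apply: ler_sum => p _; rewrite exchange_big /=; apply: ler_sum => o _.
    rewrite exchange_big /=; apply: ler_sum => a _; rewrite exchange_big /=; apply: ler_sum => a' _.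
    exact: Osum.
  rewrite !sumr_const cQ card_ord -mulrnA -mulrnA -mulrnA -[leLHS]mulr_natr !natrM !natrX.
  rewrite le_eqVlt; apply/orP; left; apply/eqP.
  have -> : D = 2 ^+ k * 2 ^+ l by rewrite -exprD.
  by field; rewrite !expf_neq0.
rewrite card_prod natrM -(mulr_natr T1).
have -> : #|{ffun A -> bool}|%:R * #|{perm X}|%:R * (6 * 2 ^+ k / 2 ^+ N) * NY =
  2 * (#|{perm X}|%:R * (2 ^+ k / D) * NY * #|{ffun A -> bool}|%:R) +
  2 * (#|{ffun A -> bool}|%:R * #|{perm X}|%:R * (2 * 2 ^+ k / D) * NY).
  by rewrite /D; field; rewrite expf_neq0.
apply: lerD; apply: ler_wpM2l => //; apply: ler_wpM2r => //.
Qed.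

End RandomMeasurement.

(** * LOCC protocols *)

Section LOCCvalue.
Variable R : realType.
Local Notation C := R[i].

(** The vectors are not normalized; their squared norms carry the weights. *)
Definition mix (T I : finType) (phi : I -> T -> C) : op R T T :=
  fun x y => \sum_i phi i x * (phi i y)^*.

Lemma mix_psd (T I : finType) (phi : I -> T -> C) : psdop (mix phi).
Proof.
move=> v.
suff -> : \sum_x \sum_y (v x)^* * mix phi x y * v y =
   (\sum_i sqn (\sum_x (phi i x)^* * v x))%:C%C.
  by rewrite ler0c sum_sqn_ge0.
rewrite realC_sum; under [RHS]eq_bigr do rewrite -mul_conj_sqn mulrC conj_sum mulr_suml.
rewrite [RHS]exchange_big /=; apply: eq_bigr => x _.
under [RHS]eq_bigr do rewrite mulr_sumr.
rewrite [RHS]exchange_big /=; apply: eq_bigr => y _.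
rewrite /mix mulr_sumr mulr_suml; apply: eq_bigr => i _; rewrite conjM conjCK; ring.
Qed.

Definition dotp (T : finType) (g phi : T -> C) : C := \sum_x (g x)^* * phi x.

Variable m : nat.

Definition appM (L L1 : 'I_m -> finType) (M : forall j, op R (L j) (L1 j))
  (phi : joint L -> C) : joint L1 -> C :=
  fun y => \sum_(x : joint L) (\prod_j M j (y j) (x j)) * phi x.

Lemma appM_comp (L L1 L2 : 'I_m -> finType) (M : forall j, op R (L j) (L1 j))
  (M' : forall j, op R (L1 j) (L2 j)) (phi : joint L -> C) y :
  appM M' (appM M phi) y = appM (fun j z x => \sum_t M' j z t * M j t x) phi y.
Proof.
rewrite /appM; under eq_bigr do rewrite mulr_sumr.
rewrite exchange_big /=; apply: eq_bigr => x _.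
rewrite -(@sum_dffun_prod C _ L1 (fun j t => M' j (y j) t * M j t (x j))) mulr_suml.
by apply: eq_bigr => z _; rewrite mulrA big_split.
Qed.

Lemma apply_mix (L L1 : 'I_m -> finType) (r : 'I_m -> nat)
  (K : forall j, 'I_(r j) -> op R (L j) (L1 j)) (o : outcome r) (I : finType)
  (phi : I -> joint L -> C) :
  apply_local_kraus K o (mix phi) = mix (fun i => appM (fun j => K j (o j)) (phi i)).
Proof.
apply: funext => x1; apply: funext => y1.
rewrite /apply_local_kraus /mix /appM.
transitivity (\sum_i \sum_(x : joint L) \sum_(y : joint L)
  (\prod_(j < m) K j (o j) (x1 j) (x j)) * phi i x *
   ((\prod_(j < m) K j (o j) (y1 j) (y j)) * phi i y)^*).
  rewrite [RHS]exchange_big /=; apply: eq_bigr => x _.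
  rewrite [RHS]exchange_big /=; apply: eq_bigr => y _.
  rewrite mulr_sumr mulr_suml; apply: eq_bigr => i _.
  by rewrite conjM; ring.
apply: eq_bigr => i _; rewrite conj_sum mulr_suml; apply: eq_bigr => x _.
by rewrite mulr_sumr.
Qed.

(* h(phi) is a guaranteed contribution of an input vector phi to <g|.|g>. *)
Definition locc_val (L L' : 'I_m -> finType) (g : joint L' -> C)
    (h : (joint L -> C) -> R) : Prop :=
  exists Lam, @LOCC R m L L' Lam /\
   forall (I : finType) (phi : I -> joint L -> C),
     exists (X : finType) (xi : X -> joint L' -> C),
       Lam (mix phi) = mix xi /\
       \sum_i h (phi i) <= \sum_x sqn (dotp g (xi x)).

Lemma locc_base (L : 'I_m -> finType) (g : joint L -> C) :
  locc_val g (fun phi => sqn (dotp g phi)).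
Proof.
exists id; split; first exact: LOCC_id.
by move=> I phi; exists I, phi.
Qed.

Lemma locc_mono (L L' : 'I_m -> finType) (g : joint L' -> C) (h h' : (joint L -> C) -> R) :
  (forall phi, h' phi <= h phi) -> locc_val g h -> locc_val g h'.
Proof.
move=> hh [Lam [LL hL]]; exists Lam; split=> // I phi.
have [X [xi [e le]]] := hL I phi; exists X, xi; split=> //.
by apply: le_trans le; apply: ler_sum => i _.
Qed.

(** Subnormalized Kraus families suffice: a dilation supplies failure outcomes, which reset the
    party to its entry of [y0], and their contribution to the value is nonnegative and is
    dropped. *)
Lemma locc_step (L L1 L' : 'I_m -> finType) (g : joint L' -> C)
  (W : 'I_m -> finType) (K : forall j, W j -> op R (L j) (L1 j))
  (h : {dffun forall j, W j} -> (joint L1 -> C) -> R)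
  (y0 : joint L1) (w0 : {dffun forall j, W j}) :
  (forall j (u : L j -> C),
     \sum_w \sum_y sqn (\sum_x K j w y x * u x) <= \sum_x sqn (u x)) ->
  (forall o, locc_val g (h o)) ->
  locc_val g (fun phi => \sum_(o : {dffun forall j, W j}) h o (appM (fun j => K j (o j)) phi)).
Proof.
move=> Ksub hh.
have dil j : exists N : 'I_#|L j| -> L j -> C, forall x x',
    \sum_(w : W j * L1 j) (K j w.1 w.2 x)^* * K j w.1 w.2 x' + \sum_l (N l x)^* * N l x'
     = 1%:C%C * (x == x')%:R.
  apply: (@dilation _ _ _ (fun w x => K j w.1 w.2 x)) => u.
  by rewrite mul1r; apply: le_trans (Ksub j u); rewrite pair_big.
pose N j := projT1 (cid (dil j)).
have NE j := projT2 (cid (dil j)).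
pose Wh j : finType := (W j + 'I_#|L j|)%type.
pose Kh j (w : Wh j) : op R (L j) (L1 j) := fun y x =>
  match w with inl w => K j w y x | inr l => (y == y0 j)%:R * N j l x end.
pose r j := #|Wh j|.
pose KK j (o : 'I_(r j)) : op R (L j) (L1 j) := Kh j (enum_val o).
have KKc j : kraus_complete (@KK j).
  move=> x x'; rewrite -[RHS](mul1r) -[1 in RHS]/(1%:C%C) -NE.
  rewrite (reindex _ (onW_bij _ (@enum_rank_bij (Wh j)))) /= big_sumType /=.
  congr (_ + _).
    rewrite pair_big /=; apply: eq_bigr => -[w y] _ /=; by rewrite /KK enum_rankK.
  apply: eq_bigr => l _; rewrite (eq_bigr (fun y => (y == y0 j)%:R * ((N j l x)^* * N j l x'))).
    by rewrite sum_delta.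
  move=> y _; rewrite /KK enum_rankK /= conjM conj_nat.
  by case: (y == y0 j) => /=; ring.
(* A failure of party [j] is read as the outcome [w0 j], so that the protocol goes on after any
   outcome. *)
pose fw (o : outcome r) : {dffun forall j, W j} :=
  [ffun j => match enum_val (o j) with inl w => w | inr _ => w0 j end].
pose f (w : {dffun forall j, W j}) : outcome r := [ffun j => enum_rank (inl (w j) : Wh j)].
have fwf w : fw (f w) = w by apply/ffunP => j; rewrite !ffunE enum_rankK.
pose Lam o := projT1 (cid (hh o)).
have LamP o := projT2 (cid (hh o)).
eexists; split.
  apply: (@LOCC_round R m L L1 L' r KK (fun o => Lam (fw o)) KKc) => o.
  exact: (LamP (fw o)).1.
move=> I phi.
pose psi (o : outcome r) i := appM (fun j => KK j (o j)) (phi i).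
have ex o := (LamP (fw o)).2 I (psi o).
pose X o := projT1 (cid (ex o)).
have ex2 o := projT2 (cid (ex o)).
pose xi o : X o -> joint L' -> C := projT1 (cid (ex2 o)).
have xiP o := projT2 (cid (ex2 o)).
exists {o : outcome r & X o}, (fun s => xi (tag s) (tagged s)); split.
  apply: funext => a; apply: funext => b.
  rewrite /mix -(sig_big_dep (fun _ => true) (fun _ _ => true) (fun o x => xi o x a * (xi o x b)^*)) /=.
  apply: eq_bigr => o _; rewrite apply_mix -/(psi o).
  by have := (xiP o).1 => /(congr1 (fun F => F a b)).
rewrite -(sig_big_dep (fun _ => true) (fun _ _ => true) (fun o x => sqn (dotp g (xi o x)))) /=.
rewrite exchange_big /=.
apply: (@le_trans _ _ (\sum_(w : {dffun forall j, W j}) \sum_x sqn (dotp g (xi (f w) x)))).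
  apply: ler_sum => w _; apply: le_trans (xiP (f w)).2.
  rewrite fwf; apply: ler_sum => i _; rewrite le_eqVlt; apply/orP; left; apply/eqP.
  congr (h w _); rewrite /psi; congr appM.
  by apply: functional_extensionality_dep => j; rewrite /KK ffunE enum_rankK.
apply: (@ler_sum_inj R _ _ f (fun o => \sum_x sqn (dotp g (xi o x)))).
  by move=> w w' e; rewrite -[w]fwf e fwf.
by move=> o; apply: sum_sqn_ge0.
Qed.

Lemma locc_fidelity (L L' : 'I_m -> finType) (g : joint L' -> C) (h : (joint L -> C) -> R)
  (I : finType) (phi : I -> joint L -> C) :
  locc_val g h -> exists Lam, @LOCC R m L L' Lam /\
   Num.sqrt (\sum_i h (phi i)) <= fidelity (fun x y => g x * (g y)^*) (Lam (mix phi)).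
Proof.
move=> [Lam [LL hL]]; exists Lam; split=> //.
have [X [xi [e le]]] := hL I phi; rewrite e.
have gp : psdop (fun x y => g x * (g y)^*).
  have := @mix_psd (joint L') unit (fun _ => g).
  suff -> : mix (fun _ : unit => g) = (fun x y => g x * (g y)^*) by [].
  by apply: funext => x; apply: funext => y; rewrite /mix (big_pred1 tt) // => -[].
apply: le_trans (fidelity_ge gp (mix_psd xi)); apply: ler_wsqrtr.
apply: le_trans le _; rewrite le_eqVlt; apply/orP; left; apply/eqP.
apply: (@complexI R); rewrite realC_sum.
have -> : \sum_x \sum_y g x * (g y)^* * mix xi y x = \sum_(s : X) (sqn (dotp g (xi s)))%:C%C.
  rewrite /mix /dotp; under [RHS]eq_bigr do rewrite -mul_conj_sqn mulrC conj_sum mulr_suml.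
  rewrite [RHS]exchange_big /=; apply: eq_bigr => x _.
  under [RHS]eq_bigr do rewrite mulr_sumr.
  rewrite [RHS]exchange_big /=; apply: eq_bigr => y _.
  rewrite mulr_sumr; apply: eq_bigr => s _; rewrite conjM conjCK; ring.
by rewrite -realC_sum.
Qed.

End LOCCvalue.

(** * The three rounds of the protocol *)

Section Protocol.
Variable R : realType.
Local Notation C := R[i].

Lemma sum_option (V : nmodType) (T : finType) (F : option T -> V) :
  \sum_w F w = F None + \sum_t F (Some t).
Proof.
rewrite (bigD1 None) //=; congr (_ + _).
rewrite (reindex_omap Some id) => [|[]//].
by apply: eq_bigl => t; rewrite eqxx.
Qed.

Lemma sum_pair (V : nmodType) (A B : finType) (F : A * B -> V) :
  \sum_p F p = \sum_a \sum_b F (a, b).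
Proof. by rewrite pair_big; apply: eq_bigr => -[]. Qed.

Definition ghz_vec (m k : nat) (x : joint (@qubits m k)) : C :=
  \prod_(l < k) ghz_amp R (fun j => x j l).

Lemma sqrt_exp2 (k : nat) : (Num.sqrt 2 : R) ^+ k = Num.sqrt (2 ^+ k).
Proof.
elim: k => [|k IH]; first by rewrite !expr0 sqrtr1.
by rewrite !exprS sqrtrM // IH.
Qed.

(** The [k] GHZ states form one GHZ state of local dimension 2^k: the amplitude is 2^(-k/2) where
    all parties hold the same string and 0 elsewhere. Party [i] serves to read off the string. *)
Lemma ghz_dot (m k : nat) (i : 'I_m) (xi : joint (@qubits m k) -> C) :
  dotp (@ghz_vec m k) xi =
  (Num.sqrt (2 ^+ k))^-1%:C%C * \sum_(z : {ffun 'I_k -> bool}) xi (finfun (fun j : 'I_m => z : @qubits m k j)).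
Proof.
pose cst (z : {ffun 'I_k -> bool}) : joint (@qubits m k) := finfun (fun j : 'I_m => z : @qubits m k j).
have s2 : (sqrtC 2)^-1 = ((Num.sqrt 2)^-1 : R)%:C%C.
  rewrite -[2 in LHS](realC_nat R 2) sqrtC_realC ?ler0n //.
  exact/esym/(fmorphV (real_complex R)).
have gE x : ghz_vec x = (x == cst (x i))%:R * (Num.sqrt (2 ^+ k))^-1%:C%C.
  rewrite /ghz_vec.
  have [xc|xnc] := eqVneq x (cst (x i)).
    rewrite mul1r (eq_bigr (fun _ => ((Num.sqrt 2)^-1 : R)%:C%C)).
      rewrite prodr_const card_ord -(rmorphXn (real_complex R)).
      by congr (_%:C%C); rewrite exprVn sqrt_exp2.
    move=> l _; rewrite /ghz_amp xc -s2.
    rewrite (_ : _ || _ = true) //.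
    case e : (x i l); [apply/orP; right|apply/orP; left]; apply/forallP => j;
      by rewrite ffunE e.
  rewrite mul0r; have [j hj] : exists j, x j != x i.
    apply/existsP; apply: contraNT xnc => /existsPn h.
    by apply/eqP/ffunP => j; rewrite ffunE; apply/eqP; rewrite -[_ == _]negbK h.
  have [l hl] : exists l, x j l != x i l.
    apply/existsP; apply: contraNT hj => /existsPn h.
    by apply/eqP/ffunP => l; apply/eqP; rewrite -[_ == _]negbK h.
  rewrite (bigD1 l) //= /ghz_amp ifF ?mul0r //; apply/negbTE.
  rewrite negb_or; apply/andP; split; apply/forallPn.
    by case e : (x i l); [exists i|exists j]; rewrite ?e //; move: hl; rewrite e; case: (x j l).
  by case e : (x i l); [exists j|exists i]; rewrite ?e //; move: hl; rewrite e; case: (x j l).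
rewrite /dotp; under eq_bigr do rewrite gE conjM conj_nat conj_realC.
rewrite (eq_bigr (fun x : joint (@qubits m k) => (x == cst (x i))%:R * ((Num.sqrt (2 ^+ k))^-1%:C%C * xi x))); last first.
  by move=> x _; rewrite mulrA.
rewrite mulr_sumr (bigID (fun x : joint (@qubits m k) => x == cst (x i))) /= [X in _ + X]big1 ?addr0; last first.
  by move=> x /negbTE ->; rewrite mul0r.
rewrite (reindex_onto cst (fun x : joint (@qubits m k) => x i : {ffun _ -> _})) /=; last by move=> x /eqP.
apply: eq_big => z; first by rewrite !ffunE !eqxx.
by rewrite !ffunE !eqxx mul1r.
Qed.

Section Rounds.
Variables (m : nat) (L : 'I_m -> finType) (i : 'I_m) (k l : nat) (Rt : finType).
Local Notation Q := {ffun 'I_k -> bool}.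
Local Notation A := {ffun 'I_m -> Q}.
Local Notation Out := {dffun forall j : 'I_m, 'I_(2 ^ l)}.

Definition qx (a d : Q) : Q := [ffun t => a t (+) d t].

Lemma qxK (a d : Q) : qx (qx a d) d = a.
Proof. by apply/ffunP => t; rewrite !ffunE -addbA addbb addbF. Qed.

Lemma qx_inj (d : Q) : injective (fun a => qx a d).
Proof. by move=> a b e; rewrite -[a](qxK a d) e qxK. Qed.

Lemma qx_sum_delta (F : Q -> C) (z d : Q) :
  \sum_a (z == qx a d)%:R * F a = F (qx z d).
Proof.
rewrite -[RHS]sum_delta; apply: eq_bigr => a _.
by have -> : (z == qx a d) = (a == qx z d) by apply/eqP/eqP => ->; rewrite qxK.
Qed.

Definition shifts (z : Q) (d : A) : A := [ffun j => qx z (d j)].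

Variable v : forall j : 'I_m, 'I_(2 ^ l) -> Q -> L j -> C.
Variable V : Out -> forall j : 'I_m, A * Rt -> L j * Q -> C.

(** The amplitude on the GHZ vector after the blocks [o] and the report [(d, t)] of the decoder,
    where [t] names a reference vector. The positions are [shifts z d], and the sum over [z] is the
    coherence that the report leaves intact. Differences are taken to a common offset [z] rather
    than to party [i], so that [i] has a coordinate in [d] like everyone else. [V] is a family over
    all [j] so that the decoder fits into a product whose types depend on the party. *)
Definition amp (o : Out) (d : A) (t : Rt) (phi : joint L -> C) : C :=
  (Num.sqrt (2 ^+ k))^-1%:C%C * \sum_(z : Q) \sum_(x : joint L)
    (\prod_j (if j == i then
        ((Num.sqrt (2 ^+ l))^-1 * (2 ^+ k)^-1)%:C%C * V o (shifts z d, t) (x j, qx z (d j))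
      else v (o j) (qx z (d j)) (x j))) * phi x.

(* after the first round a sender holds its position (inr), while party i still holds its input (inl) *)
Let L1 (j : 'I_m) : finType := (L j + Q)%type.

(** Party [i] does not measure: it draws a dummy block with uniform weight, which gives all parties
    the same type of outcomes. *)
Let K1 (j : 'I_m) (o : 'I_(2 ^ l)) : op R (L j) (L1 j) := fun y x =>
  if j == i then match y with inl x' => (Num.sqrt (2 ^+ l))^-1%:C%C * (x' == x)%:R | inr _ => 0 end
  else match y with inl _ => 0 | inr a => v o a x end.

(** Senders wait, with [None] as their only nonzero outcome. Party [i] applies the decoder together
    with a position [a] of its own, which stays in its register, and reports [(d, t)]. *)
Let K2 (o : Out) (j : 'I_m) (w : option (A * Rt)) : op R (L1 j) (L1 j) := fun y x =>
  if j == i then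
    match w, y, x with
    | Some (d, t), inr a, inl b => ((2 ^+ k)^-1)%:C%C * V o (shifts (qx a (d i)) d, t) (b, a)
    | _, _, _ => 0 end
  else match w with None => (y == x)%:R | Some _ => 0 end.

Let K3 (d : A) (j : 'I_m) (_ : unit) : op R (L1 j) (@qubits m k j) := fun z y =>
  match y with inl _ => 0 | inr a => (z == qx a (d j))%:R end.

Let w2 (p : A * Rt) : {dffun forall j : 'I_m, option (A * Rt)} :=
  [ffun j => if j == i then Some p else None].

Lemma rounds_amp o d t phi :
  dotp (@ghz_vec m k) (appM (fun j => K3 d (j := j) tt)
     (appM (fun j => K2 o (w2 (d, t) j)) (appM (fun j => K1 (o j)) phi))) = amp o d t phi.
Proof.
rewrite (ghz_dot i); congr (_ * _); apply: eq_bigr => z _.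
rewrite (_ : appM (fun j => K2 o (w2 (d, t) j)) (appM (fun j => K1 (o j)) phi) =
   appM (fun j z x => \sum_s K2 o (w2 (d, t) j) z s * K1 (o j) s x) phi); last first.
  by apply: funext => y; rewrite appM_comp.
rewrite appM_comp /appM; apply: eq_bigr => x _; congr (_ * _); apply: eq_bigr => j _.
rewrite ffunE big_sumType /= big1 ?add0r => [|b _]; last by rewrite /K3 mul0r.
rewrite /K3 (qx_sum_delta (fun a => \sum_s K2 o (w2 (d, t) j) (inr a) s * K1 (o j) s (x j)) z (d j)).
rewrite big_sumType /= /K1 /K2 /w2 ffunE; have [ji|ji] := eqVneq j i.
  rewrite [X in _ + X]big1 ?addr0 => [|b _]; last by rewrite mulr0.
  rewrite (eq_bigr (fun b => (b == x j)%:R * ((Num.sqrt (2 ^+ l))^-1%:C%C *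
     ((2 ^+ k)^-1%:C%C * V o (shifts (qx (qx z (d j)) (d i)) d, t) (b, qx z (d j)))))).
    by rewrite sum_delta ji qxK realCM mulrA.
  by move=> b _; ring.
rewrite big1 ?add0r => [|b _]; last by rewrite mulr0.
rewrite (eq_bigr (fun a => (a == qx z (d j))%:R * v (o j) a (x j))); first by rewrite sum_delta.
by move=> a _; rewrite eq_sym.
Qed.

Hypothesis vtight : forall j (x x' : L j), \sum_o \sum_a (v o a x)^* * v o a x' = (x == x')%:R.
Hypothesis Vcontr : forall o (u : L i * Q -> C),
  \sum_x sqn (\sum_b V o x b * u b) <= \sum_b sqn (u b).

Lemma sub1 j (u : L j -> C) :
  \sum_w \sum_y sqn (\sum_x K1 w y x * u x) <= \sum_x sqn (u x).
Proof.
rewrite /K1; have [ji|ji] := eqVneq j i.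
  under eq_bigr => w _.
    rewrite big_sumType /= [X in _ + X]big1 ?addr0 => [|a _]; last first.
      by rewrite big1 ?sqn0 // => x _; rewrite mul0r.
    under eq_bigr => x' _.
      rewrite (eq_bigr (fun x => (x == x')%:R * ((Num.sqrt (2 ^+ l))^-1%:C%C * u x))).
        rewrite sum_delta sqnM sqn_real exprVn sqr_sqrtr ?exprn_ge0 //.
        over.
      by move=> x _; rewrite eq_sym; ring.
    rewrite -mulr_sumr.
    over.
  by rewrite sumr_const card_ord -[leLHS]mulr_natl natrX mulVKf // expf_neq0.
under eq_bigr => w _.
  rewrite big_sumType /= big1 ?add0r => [|x' _]; last first.
    by rewrite big1 ?sqn0 // => x _; rewrite mul0r.
  over.
rewrite pair_big /=.
rewrite (@parseval_fam R ('I_(2 ^ l) * Q)%type (L j) (fun x p => v p.1 p.2 x) (fun _ => 1) u).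
  by apply: ler_sum => x _; rewrite mul1r.
by move=> x x'; rewrite mulr1 -vtight pair_big.
Qed.

Lemma sub3 d j (u : L1 j -> C) :
  \sum_(w : unit) \sum_y sqn (\sum_x K3 d w y x * u x) <= \sum_x sqn (u x).
Proof.
rewrite (big_pred1 tt) => [|[]//]; rewrite [leRHS]big_sumType /=.
apply: (@le_trans _ _ (\sum_a sqn (u (inr a)))); last by rewrite lerDr sum_sqn_ge0.
rewrite (reindex_inj (@qx_inj (d j))) /=.
apply: ler_sum => a _; rewrite big_sumType /= big1 ?add0r => [|x _]; last by rewrite mul0r.
by rewrite (qx_sum_delta (fun a => u (inr a))) qxK.
Qed.

(** The weight 2^(-k) of the decoder has to absorb two factors 2^k in the squared norm: every tuple
    of positions is [shifts z d] for 2^k pairs [(z, d)], and the contraction bound is spent once for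
    each position of party [i]. *)
Lemma sub2 o j (u : L1 j -> C) :
  \sum_w \sum_y sqn (\sum_x K2 o w y x * u x) <= \sum_x sqn (u x).
Proof.
rewrite /K2; have [ji|ji] := eqVneq j i; last first.
  rewrite sum_option /= [X in _ + X]big1 ?addr0 => [|w _]; last first.
    by rewrite big1 // => y _; rewrite big1 ?sqn0 // => x _; rewrite mul0r.
  by apply: ler_sum => y _; rewrite sum_delta_l.
subst j; rewrite sum_option /= big1 ?add0r => [|y _]; last first.
  by rewrite big1 ?sqn0 // => x _; rewrite mul0r.
apply: (@le_trans _ _ (\sum_b sqn (u (inl b)))); last by rewrite [leRHS]big_sumType /= lerDl sum_sqn_ge0.
pose f (p : A * Rt) (c : Q) := sqn (\sum_b V o p (b, c) * u (inl b)).
have fsum c : \sum_p f p c <= \sum_b sqn (u (inl b)).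
  have := Vcontr o (fun bc => (bc.2 == c)%:R * u (inl bc.1)).
  rewrite -(pair_big xpredT xpredT (fun b c' => sqn ((c' == c)%:R * u (inl b)))) /=.
  have -> : \sum_b \sum_c' sqn ((c' == c)%:R * u (inl b)) = \sum_b sqn (u (inl b)).
    apply: eq_bigr => b _; rewrite (bigD1 c) //= eqxx mul1r big1 ?addr0 // => c' /negbTE ->.
    by rewrite mul0r sqn0.
  move=> h; apply: le_trans h; apply: ler_sum => p _.
  rewrite sum_pair /=.
  rewrite /f le_eqVlt; apply/orP; left; apply/eqP; congr sqn.
  apply: eq_bigr => b _; rewrite (eq_bigr (fun c' => (c' == c)%:R * (V o p (b, c') * u (inl b)))).
    by rewrite sum_delta.
  by move=> c' _; ring.
have -> : \sum_(w : A * Rt) \sum_(y : L1 i) sqn (\sum_(x : L1 i) match w with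
     | (d, t) => match y with inl _ => 0 | inr a => match x with
        | inl b => (2 ^+ k)^-1%:C%C * V o (shifts (qx a (d i)) d, t) (b, a) | inr _ => 0 end end end * u x)
   = (2 ^+ k)^-1 ^+ 2 * \sum_d \sum_t \sum_z f (shifts z d, t) (qx z (d i)).
  rewrite mulr_sumr.
  under [RHS]eq_bigr do rewrite mulr_sumr.
  rewrite [RHS]pair_big /=; apply: eq_bigr => -[d t] _ /=.
  rewrite big_sumType /= big1 ?add0r => [|x _]; last first.
    by rewrite big1 ?sqn0 // => b _; rewrite mul0r.
  rewrite (reindex_inj (@qx_inj (d i))) /= mulr_sumr; apply: eq_bigr => z _.
  rewrite big_sumType /= [X in _ + X]big1 ?addr0 => [|x _]; last by rewrite mul0r.
  rewrite qxK /f; under eq_bigr do rewrite -mulrA.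
  by rewrite -mulr_sumr sqnM sqn_real.
have -> : \sum_d \sum_t \sum_z f (shifts z d, t) (qx z (d i)) =
   \sum_(z : Q) \sum_a \sum_t f (a, t) (a i).
  transitivity (\sum_(z : Q) \sum_d \sum_t f (shifts z d, t) (qx z (d i))).
    rewrite [RHS]exchange_big /=; apply: eq_bigr => d _; by rewrite exchange_big.
  apply: eq_bigr => z _.
  have shI : injective (fun d => shifts z d).
    move=> d d' /ffunP e; apply/ffunP => j; have := e j; rewrite !ffunE => /ffunP e2.
    by apply/ffunP => t; have := e2 t; rewrite !ffunE => /addbI.
  rewrite [RHS](reindex_inj shI) /=; apply: eq_bigr => d _; apply: eq_bigr => t _.
  by rewrite ffunE.
rewrite sumr_const card_ffun card_bool card_ord.
have h : \sum_a \sum_t f (a, t) (a i) <= 2 ^+ k * \sum_b sqn (u (inl b)).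
  apply: (@le_trans _ _ (\sum_(c : Q) \sum_p f p c)).
    rewrite [leRHS]exchange_big [leRHS]sum_pair /=.
    apply: ler_sum => a _; apply: ler_sum => t _.
    rewrite (bigD1 (a i)) //= lerDl; apply: sumr_ge0 => c _; exact: sqn_ge0.
  apply: (@le_trans _ _ (\sum_(c : Q) \sum_b sqn (u (inl b)))).
    by apply: ler_sum => c _.
  by rewrite sumr_const card_ffun card_bool card_ord -[leLHS]mulr_natl natrX.
have k0 : 0 < 2 ^+ k :> R by rewrite exprn_gt0.
rewrite -[X in _ * X]mulr_natl natrX expr2 mulrA mulfVK ?gt_eqF // mulrC ler_pdivrMr // mulrC.
by [].
Qed.

Lemma protocol_val (x0 : joint L) :
  locc_val (@ghz_vec m k) (fun phi => \sum_(o : Out) \sum_d \sum_t sqn (amp o d t phi)).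
Proof.
pose y0 : joint L1 := [ffun j => inl (x0 j)].
pose z0 : joint (@qubits m k) :=
  finfun (fun j : 'I_m => [ffun=> false] : @qubits m k j).
have s3 d : locc_val (@ghz_vec m k) (fun phi : joint L1 -> C =>
    sqn (dotp (@ghz_vec m k) (appM (fun j => K3 d (j := j) tt) phi))).
  have := @locc_step R m L1 (@qubits m k) (@qubits m k) (@ghz_vec m k)
    (fun _ => unit) (fun j => @K3 d j) (fun _ phi => sqn (dotp (@ghz_vec m k) phi))
    z0 [ffun=> tt] (@sub3 d) (fun _ => locc_base _).
  apply: locc_mono => phi.
  rewrite (bigD1 [ffun=> tt]) //= (_ : (fun j => K3 d ([ffun=> tt] j)) = fun j => K3 d (j := j) tt).
    by rewrite lerDl; apply: sumr_ge0 => o _; apply: sqn_ge0.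
  by apply: functional_extensionality_dep => j; rewrite ffunE.
have s2 o : locc_val (@ghz_vec m k) (fun phi : joint L1 -> C =>
    \sum_(p : A * Rt) sqn (dotp (@ghz_vec m k) (appM (fun j => K3 p.1 (j := j) tt)
     (appM (fun j => K2 o (w2 p j)) phi)))).
  pose dw (w : {dffun forall j : 'I_m, option (A * Rt)}) : A :=
    if w i is Some p then p.1 else [ffun=> [ffun=> false]].
  have := @locc_step R m L1 L1 (@qubits m k) (@ghz_vec m k)
    (fun _ => option (A * Rt)) (fun j => @K2 o j)
    (fun w phi => sqn (dotp (@ghz_vec m k) (appM (fun j => K3 (dw w) (j := j) tt) phi)))
    y0 [ffun=> None] (@sub2 o) (fun w => s3 (dw w)).
  apply: locc_mono => phi.
  pose F (w : {dffun forall j : 'I_m, option (A * Rt)}) := sqn (dotp (@ghz_vec m k)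
     (appM (fun j => K3 (dw w) (j := j) tt) (appM (fun j => K2 o (w j)) phi))).
  apply: (@le_trans _ _ (\sum_p F (w2 p))); last first.
    apply: (ler_sum_inj (f := w2) (F := F)) => [p p' /ffunP /(_ i)|w]; last exact: sqn_ge0.
    by rewrite !ffunE eqxx => -[].
  by apply: ler_sum => p _; rewrite /F /dw ffunE eqxx.
have := @locc_step R m L L1 (@qubits m k) (@ghz_vec m k)
    (fun _ => 'I_(2 ^ l)) (fun j => @K1 j) _ y0 [ffun=> Ordinal (expn_gt0 2 l)] sub1 s2.
apply: locc_mono => phi; apply: ler_sum => o _.
rewrite pair_big /=; apply: ler_sum => -[d t] _ /=.
by rewrite rounds_amp.
Qed.

End Rounds.
End Protocol.

(** * From the Uhlmann contraction to a decoder *)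

Section Decoder.
Variable R : realType.
Local Notation C := R[i].

Lemma sum_fibre (V : nmodType) (X B : finType) (p : X -> B) (F : X -> V) :
  \sum_b \sum_(x | p x == b) F x = \sum_x F x.
Proof. by rewrite [RHS](partition_big p predT). Qed.

(** Extends a decoder of party [i] to a family over all parties, whose types vary; transport along a
    proof of [i = i] is trivial because equality is decidable. *)
Lemma dep_update (I : eqType) (F : I -> Type) (i : I) (x : F i) (d : forall j, F j) :
  exists f : forall j, F j, f i = x.
Proof.
exists (fun j => match @eqP _ i j with ReflectT e => ecast j (F j) e x | _ => d j end).
by case: eqP => // e; rewrite eq_axiomK.
Qed.

Variables (m : nat) (L : 'I_m -> finType) (i : 'I_m) (k l : nat) (Rt : finType).
Local Notation Q := {ffun 'I_k -> bool}.
Local Notation A := {ffun 'I_m -> Q}.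
Local Notation Out := {dffun forall j : 'I_m, 'I_(2 ^ l)}.
Variable v : forall j : 'I_m, 'I_(2 ^ l) -> Q -> L j -> C.

(** The unnormalized vector of party [i], with its dummy position as second component, given the
    blocks [o] and the positions [a]. The weight 2^(-(k+l)/2) is that of a uniformly drawn dummy
    block and position. *)
Definition branch (phi : joint L -> C) (o : Out) (a : A) (b : L i * Q) : C :=
  (Num.sqrt (2 ^+ (k + l)))^-1%:C%C * ((b.2 == a i)%:R *
    \sum_(x : joint L | x i == b.1) (\prod_(j | j != i) v (o j) (a j) (x j)) * phi x).

Lemma amp_branch V o d (t : Rt) phi :
  amp i v V o d t phi = ((2 ^+ k)^-1)%:C%C *
    \sum_z \sum_b branch phi o (shifts z d) b * V o i (shifts z d, t) b.
Proof.
rewrite /amp !mulr_sumr; apply: eq_bigr => z _.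
rewrite (sum_pair (fun b => branch phi o (shifts z d) b * V o i (shifts z d, t) b)).
rewrite (eq_bigr (fun b => (Num.sqrt (2 ^+ (k + l)))^-1%:C%C *
   \sum_(x : joint L | x i == b) V o i (shifts z d, t) (x i, qx z (d i)) *
    ((\prod_(j | j != i) v (o j) (shifts z d j) (x j)) * phi x))); last first.
  move=> b _.
  rewrite (eq_bigr (fun c => (c == shifts z d i)%:R * ((Num.sqrt (2 ^+ (k + l)))^-1%:C%C *
      (\sum_(x : joint L | x i == b) (\prod_(j | j != i) v (o j) (shifts z d j) (x j)) * phi x)
      * V o i (shifts z d, t) (b, c)))); last by move=> c _; rewrite /branch /=; ring.
  rewrite sum_delta -mulrA mulr_suml; congr (_ * _); apply: eq_bigr => x /eqP <-.
  by rewrite mulrC ffunE.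
rewrite -mulr_sumr (sum_fibre (fun x : joint L => x i)) !mulr_sumr.
apply: eq_bigr => x _.
rewrite (bigD1 i) //= eqxx (eq_bigr (fun j => v (o j) (shifts z d j) (x j))); last first.
  by move=> j /negbTE ->; rewrite ffunE.
have -> : (Num.sqrt (2 ^+ (k + l)))^-1%:C%C =
   (Num.sqrt (2 ^+ k))^-1%:C%C * (Num.sqrt (2 ^+ l))^-1%:C%C :> C.
  by rewrite -realCM exprD sqrtrM ?exprn_ge0 // invfM.
by rewrite realCM; ring.
Qed.

Lemma card_branches : (#|{: Out}| * #|{: A}|)%N%:R = 2 ^+ (k + l) ^+ m :> R.
Proof.
have -> : #|{: Out}| = ((2 ^ l) ^ m)%N.
  rewrite card_dffun (eq_bigr (fun _ => (2 ^ l)%N)) => [|j _]; last by rewrite card_ord.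
  by rewrite prod_nat_const card_ord.
rewrite !card_ffun card_bool !card_ord -expnM -expnM -expnD -exprM -natrX.
by congr ((_ ^ _)%:R); rewrite mulnDl addnC.
Qed.

Variables (phi : Rt -> joint L -> C) (q : Rt -> R) (c : Out -> R).
Hypothesis q0 : forall t, 0 <= q t.
Hypothesis q1 : \sum_t q t <= 1.
Hypothesis trG : \sum_o \sum_(p : A * Rt) \sum_b sqn (branch (phi p.2) o p.1 b) = \sum_t q t.
Hypothesis hc : forall o (U : 'I_#|{: A * Rt}| -> A * Rt -> C), orthobasis U ->
  \sum_s `|complex.Re (\sum_x \sum_y (U s x)^* *
     (\sum_b branch (phi x.2) o x.1 b * (branch (phi y.2) o y.1 b)^*
       - (x == y)%:R * (q x.2 / 2 ^+ (k + l) ^+ m)%:C%C) * U s y)| <= c o.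

(** For each [o] the Uhlmann contraction has a large real overlap with the branches. The overlaps
    are grouped by the report [d], since positions that differ by a common shift stay coherent.
    Cauchy-Schwarz with the weights [q t / D], of total at most 1, then turns this linear bound into
    one for the sum of the squared amplitudes. *)
Lemma decoder : exists V : Out -> forall j : 'I_m, A * Rt -> L j * Q -> C,
  (forall o (u : L i * Q -> C), \sum_x sqn (\sum_b V o i x b * u b) <= \sum_b sqn (u b)) /\
  \sum_t q t - (\sum_o c o) / 2 <=
    Num.sqrt (\sum_t \sum_o \sum_d \sum_t' sqn (amp i v V o d t' (phi t))).
Proof.
set Q0 := \sum_t q t.
have Q1 : Q0 <= 1 := q1.
have trG' : \sum_o \sum_(p : A * Rt) \sum_b sqn (branch (phi p.2) o p.1 b) = Q0 := trG.
set D : R := 2 ^+ (k + l) ^+ m.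
have D0 : 0 < D by rewrite !exprn_gt0.
pose T (p : A * Rt) := Num.sqrt (q p.2 / D).
have T2 p : T p ^+ 2 = q p.2 / D by rewrite sqr_sqrtr // divr_ge0 // ltW.
have ex o : exists W : A * Rt -> L i * Q -> C,
    (forall u, \sum_x sqn (\sum_b W x b * u b) <= \sum_b sqn (u b)) /\
    (\sum_(x : A * Rt) \sum_b sqn (branch (phi x.2) o x.1 b) + \sum_x T x ^+ 2 - c o) / 2 <=
     complex.Re (\sum_x (T x)%:C%C * \sum_b branch (phi x.2) o x.1 b * W x b).
  apply: uhlmann => [p|U Ub]; first exact: sqrtr_ge0.
  apply: le_trans (hc o Ub); apply: ler_sum => s _.
  rewrite le_eqVlt; apply/orP; left; apply/eqP; congr (`|complex.Re _|).
  by apply: eq_bigr => x _; apply: eq_bigr => y _; rewrite T2.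
pose W o := projT1 (cid (ex o)).
have WP o := projT2 (cid (ex o)).
pose V0 o := dep_update (W o) (fun j (_ : A * Rt) (_ : L j * Q) => 0 : C).
pose V o := projT1 (cid (V0 o)).
have Vi o : V o i = W o := projT2 (cid (V0 o)).
exists V; split; first by move=> o u; rewrite Vi; exact: (WP o).1.
pose M o (p : A * Rt) := \sum_b branch (phi p.2) o p.1 b * W o p b.
pose al o d t := amp i v V o d t (phi t).
have alE o d t : al o d t = ((2 ^+ k)^-1)%:C%C * \sum_z M o (shifts z d, t).
  by rewrite /al amp_branch Vi.
pose val := \sum_o \sum_d \sum_t sqn (al o d t).
have val0 : 0 <= val by do 3! (apply: sumr_ge0 => ? _); apply: sqn_ge0.
(* Only the reports that name the right reference vector are kept. *)
have le_val : val <= \sum_t \sum_o \sum_d \sum_t' sqn (amp i v V o d t' (phi t)).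
  rewrite [leRHS]exchange_big /=; apply: ler_sum => o _.
  rewrite [leRHS]exchange_big /=; apply: ler_sum => d _; apply: ler_sum => t _.
  by rewrite (bigD1 t) //= lerDl sum_sqn_ge0.
apply: le_trans (ler_wsqrtr le_val).
pose S := \sum_o complex.Re (\sum_p (T p)%:C%C * M o p).
have S1 : Q0 - (\sum_o c o) / 2 <= S.
  have -> : Q0 - (\sum_o c o) / 2 =
    \sum_o (\sum_(x : A * Rt) \sum_b sqn (branch (phi x.2) o x.1 b) + \sum_x T x ^+ 2 - c o) / 2.
    rewrite -mulr_suml sumrB big_split /= trG'.
    have -> : \sum_(o : Out) \sum_x T x ^+ 2 = Q0.
      rewrite (eq_bigr (fun _ => #|{: A}|%:R * (Q0 / D))) => [|o _]; last first.
        rewrite sum_pair (eq_bigr (fun _ => Q0 / D)) => [|a _].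
          by rewrite sumr_const mulr_natl.
        by rewrite /Q0 mulr_suml; apply: eq_bigr => t _; rewrite T2.
      rewrite sumr_const -[LHS]mulr_natl mulrA -natrM.
      rewrite card_branches -/D.
      by rewrite mulrCA divff ?mulr1 // gt_eqF.
    by field.
  by apply: ler_sum => o _; exact: (WP o).2.
apply: le_trans S1 _.
have SE : S = complex.Re (\sum_(p : Out * (A * Rt)) (Num.sqrt (q p.2.2 / D))%:C%C * al p.1 p.2.1 p.2.2).
  rewrite /S -cRe_sum sum_pair; congr complex.Re; apply: eq_bigr => o _ /=.
  rewrite sum_pair [RHS]sum_pair /= exchange_big [RHS]exchange_big /=.
  apply: eq_bigr => t _.
  rewrite (eq_bigr (fun a => (Num.sqrt (q t / D))%:C%C * M o (a, t))) //.
  rewrite [RHS](eq_bigr (fun d => (Num.sqrt (q t / D))%:C%C * al o d t)) //.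
  rewrite -mulr_sumr -[RHS]mulr_sumr; congr (_ * _).
  rewrite [RHS](eq_bigr (fun d => ((2 ^+ k)^-1)%:C%C * \sum_z M o (shifts z d, t))) => [|d _]; last first.
    exact: alE.
  rewrite -mulr_sumr [in RHS]exchange_big /=.
  (* For fixed [z] the tuple [shifts z d] runs over all positions, so the 2^k values of [z] give
     equal sums and cancel the factor of [alE]. *)
  have sh z : \sum_d M o (shifts z d, t) = \sum_a M o (a, t).
    have shI : injective (fun d : A => shifts z d).
      move=> d d' /ffunP e; apply/ffunP => j; have := e j; rewrite !ffunE => /ffunP e2.
      by apply/ffunP => u; have := e2 u; rewrite !ffunE => /addbI.
    by rewrite [RHS](reindex_inj shI).
  rewrite [in RHS](eq_bigr _ (fun z _ => sh z)) sumr_const card_ffun card_bool card_ord.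
  rewrite -[X in _ = _ * X]mulr_natl mulrA natrX.
  have -> : ((2 ^+ k)^-1)%:C%C * 2 ^+ k = 1 :> C.
    have k0 : (2 ^+ k : R) != 0 by rewrite expf_neq0.
    have -> : 2 ^+ k = (2 ^+ k)%:C%C :> C by rewrite -natrX -(realC_nat R) natrX.
    by rewrite -realCM mulVf.
  by rewrite mul1r.
have S2 : S ^+ 2 <= val.
  rewrite SE; apply: le_trans (sqn_Re2 _) _; apply: le_trans (CS_sqn _ _) _.
  have -> : \sum_p sqn (al p.1 p.2.1 p.2.2) = val.
    by rewrite sum_pair; apply: eq_bigr => o _; rewrite sum_pair.
  rewrite -[leRHS]mul1r; apply: ler_wpM2r => //.
  rewrite (eq_bigr (fun p => q p.2.2 / D)) => [|p _]; last first.
    by rewrite sqn_real sqr_sqrtr // divr_ge0 // ltW.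
  rewrite sum_pair /= sumr_const sum_pair /= sumr_const -mulr_suml.
  rewrite -mulrnA -[leLHS]mulr_natl.
  rewrite mulnC card_branches -/D.
  by rewrite mulrCA divff ?mulr1 // gt_eqF.
apply: le_trans (ler_norm _) _; rewrite -sqrtr_sqr; exact: ler_wsqrtr.
Qed.

End Decoder.

(** * Decoupling *)

Section Kernels.
Variable R : realType.
Local Notation C := R[i].

Definition qf (X : finType) (u : X -> C) (D : X -> X -> C) : R :=
  complex.Re (\sum_x \sum_y (u x)^* * D x y * u y).

Lemma eq_qf (X : finType) (u : X -> C) (D D' : X -> X -> C) :
  (forall x y, D x y = D' x y) -> qf u D = qf u D'.
Proof.
move=> e; congr complex.Re; apply: eq_bigr => x _; apply: eq_bigr => y _; by rewrite e.
Qed.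

Lemma qf_sum (X : finType) (u : X -> C) (I : Type) (s : seq I) (P : pred I)
  (D : I -> X -> X -> C) :
  qf u (fun x y => \sum_(i <- s | P i) D i x y) = \sum_(i <- s | P i) qf u (D i).
Proof.
rewrite /qf -cRe_sum [X in _ = complex.Re X]exchange_big /=; congr complex.Re.
apply: eq_bigr => x _; rewrite [RHS]exchange_big /=; apply: eq_bigr => y _.
by rewrite mulr_sumr mulr_suml.
Qed.

Lemma qf_scale (X : finType) (u : X -> C) (a : R) (D : X -> X -> C) :
  qf u (fun x y => a%:C%C * D x y) = a * qf u D.
Proof.
rewrite /qf -cReMl; congr complex.Re; rewrite mulr_sumr; apply: eq_bigr => x _.
rewrite mulr_sumr; apply: eq_bigr => y _; ring.
Qed.

Lemma qf_trace (X : finType) (U : 'I_#|X| -> X -> C) (D : X -> X -> C) : orthobasis U ->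
  \sum_s qf (U s) D = complex.Re (\sum_x D x x).
Proof.
move=> Ub; rewrite /qf -cRe_sum exchange_big /=; congr complex.Re; apply: eq_bigr => x _.
transitivity (\sum_y (y == x)%:R * D x y); last exact: sum_delta.
rewrite exchange_big /=; apply: eq_bigr => y _.
rewrite -Ub.2 mulr_suml; apply: eq_bigr => s _; ring.
Qed.

Variables (m : nat) (L : 'I_m -> finType) (i : 'I_m) (k l : nat) (Rt : finType).
Local Notation Q := {ffun 'I_k -> bool}.
Local Notation A := {ffun 'I_m -> Q}.
Local Notation Out := {dffun forall j : 'I_m, 'I_(2 ^ l)}.
Variable v : forall j : 'I_m, 'I_(2 ^ l) -> Q -> L j -> C.
Let kernel := forall j : 'I_m, 'I_(2 ^ l) -> Q -> Q -> L j -> L j -> C.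
Let iD : R := (2 ^+ (k + l))^-1.

Definition meask : kernel := fun j o a a' x x' => v o a x * (v o a' x')^*.
#[local] Arguments meask : clear implicits.

Definition depk : kernel := fun j _ a a' x x' => iD%:C%C * ((a == a')%:R * (x == x')%:R).
#[local] Arguments depk : clear implicits.

(** Products of measured and depolarized parties are completely positive, unlike those of
    [diffk]. *)
Definition selk (B : {set 'I_m}) : kernel := fun j => if j \in B then meask j else depk j.
#[local] Arguments selk : clear implicits.

Definition diffk (J : {set 'I_m}) : kernel := fun j o a a' x x' =>
  if j \in J then meask j o a a' x x' - depk j o a a' x x' else depk j o a a' x x'.
#[local] Arguments diffk : clear implicits.

Definition outer (psi : Rt -> joint L -> C) (t : Rt) (x : joint L) (t' : Rt) (x' : joint L) : C :=
  psi t x * (psi t' x')^*.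

(** The matrix over positions and reference that results from applying the product of the kernels to
    the operator [Y] on the parties and the reference. *)
Definition Nk (kap : kernel) (o : Out) (Y : Rt -> joint L -> Rt -> joint L -> C)
    (p p' : A * Rt) : C :=
  \sum_(x : joint L) \sum_(x' : joint L)
    (\prod_j kap j (o j) (p.1 j) (p'.1 j) (x j) (x' j)) * Y p.2 x p'.2 x'.

Lemma Nk_sumY kap o (I : finType) (P : pred I) (Y : I -> Rt -> joint L -> Rt -> joint L -> C) p p' :
  Nk kap o (fun t x t' x' => \sum_(s | P s) Y s t x t' x') p p' = \sum_(s | P s) Nk kap o (Y s) p p'.
Proof.
rewrite /Nk [RHS]exchange_big /=; apply: eq_bigr => x _; rewrite [RHS]exchange_big /=.
by apply: eq_bigr => x' _; rewrite mulr_sumr.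
Qed.

(** Tracing out the register of party [i] identifies its two inputs and its two dummy positions,
    which is the depolarizing kernel: [i] counts as a sender that is already decoupled. *)
Lemma branch_gram (phi : Rt -> joint L -> C) (o : Out) (p p' : A * Rt) :
  \sum_(b : L i * Q) branch v (phi p.2) o p.1 b * (branch v (phi p'.2) o p'.1 b)^* =
  Nk (selk (~: [set i])%SET) o (outer phi) p p'.
Proof.
case: p => a t; case: p' => a' t' /=.
pose F t a (x : joint L) := (\prod_(j | j != i) v (o j) (a j) (x j)) * phi t x.
have s2 : (Num.sqrt (2 ^+ (k + l)))^-1 * (Num.sqrt (2 ^+ (k + l)))^-1 = iD.
  by rewrite -invfM -expr2 sqr_sqrtr ?exprn_ge0.
transitivity (iD%:C%C * ((a i == a' i)%:R * \sum_(x : joint L) \sum_(x' : joint L)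
   (x i == x' i)%:R * (F t a x * (F t' a' x')^*))).
  rewrite sum_pair.
  transitivity (\sum_b iD%:C%C * ((a i == a' i)%:R * ((\sum_(x : joint L | x i == b) F t a x) *
     (\sum_(x : joint L | x i == b) F t' a' x)^*))).
    apply: eq_bigr => b _; rewrite -(sum_delta (a i) (fun c => (c == a' i)%:R * _)) mulr_sumr.
    apply: eq_bigr => c _; rewrite /branch /= !conjM conj_realC conj_nat -s2 realCM -/(F t a) -/(F t' a').
    by ring.
  rewrite -!mulr_sumr; congr (_ * (_ * _)).
  rewrite -(sum_fibre (fun x : joint L => x i)); apply: eq_bigr => b _.
  rewrite mulr_suml; apply: eq_bigr => x /eqP xb.
  rewrite conj_sum mulr_sumr big_mkcond; apply: eq_bigr => x' _.
  by rewrite xb eq_sym; case: eqP => _; rewrite ?mul1r ?mul0r.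
rewrite /Nk !mulr_sumr; apply: eq_bigr => x _; rewrite !mulr_sumr; apply: eq_bigr => x' _ /=.
rewrite [in RHS](bigD1 i) //= /selk !inE eqxx /= /depk /F /outer.
rewrite [in RHS](eq_bigr (fun j => v (o j) (a j) (x j) * (v (o j) (a' j) (x' j))^*)); last first.
  by move=> j ji; rewrite !inE ji.
by rewrite big_split /= -conj_prod conjM; ring.
Qed.

Let iD0 : 0 <= iD. Proof. by rewrite invr_ge0 exprn_ge0. Qed.

(** A single Kraus operator for a measured party, and rescaled matrix units for a depolarized
    one. *)
Definition krausk (B : {set 'I_m}) (j : 'I_m) (w : option (Q * L j)) (o : 'I_(2 ^ l)) (a : Q) (x : L j) : C :=
  match w with
  | None => if j \in B then v o a x else 0
  | Some (a0, x0) => if j \in B then 0 else (Num.sqrt iD)%:C%C * ((a == a0)%:R * (x == x0)%:R)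
  end.

Lemma selk_kraus B j o a a' x x' :
  selk B j o a a' x x' = \sum_w krausk B w o a x * (krausk B w o a' x')^*.
Proof.
rewrite sum_option /= /selk; case: ifP => jB.
  by rewrite big1 ?addr0 // => -[a0 x0] _; rewrite mul0r.
rewrite mul0r add0r sum_pair /=.
rewrite (eq_bigr (fun a0 => (a0 == a)%:R * (\sum_x0 (x0 == x)%:R * (iD%:C%C * ((a' == a0)%:R * (x' == x0)%:R))))).
  by rewrite sum_delta sum_delta /depk [a' == _]eq_sym [x' == _]eq_sym.
move=> a0 _; rewrite mulr_sumr; apply: eq_bigr => x0 _.
rewrite !conjM conj_realC !conj_nat -[iD in RHS](sqr_sqrtr iD0) expr2 realCM.
by rewrite [a == _]eq_sym [x == _]eq_sym; ring.
Qed.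

Lemma selk_psd B o psi (u : A * Rt -> C) : 0 <= qf u (Nk (selk B) o (outer psi)).
Proof.
rewrite /qf.
pose Wt : finType := {dffun forall j, option (Q * L j)}.
pose Kw (w : Wt) (p : A * Rt) (x : joint L) : C := \prod_j krausk B (w j) (o j) (p.1 j) (x j).
have -> : \sum_p \sum_p' (u p)^* * Nk (selk B) o (outer psi) p p' * u p' =
   (\sum_(w : Wt) sqn (\sum_p (u p)^* * \sum_x Kw w p x * psi p.2 x))%:C%C.
  rewrite realC_sum.
  transitivity (\sum_(w : Wt) \sum_p \sum_p' ((u p)^* * \sum_x Kw w p x * psi p.2 x) *
     ((u p')^* * \sum_x Kw w p' x * psi p'.2 x)^*); last first.
    apply: eq_bigr => w _; rewrite -mul_conj_sqn mulr_suml; apply: eq_bigr => p _.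
    by rewrite conj_sum [RHS]mulr_sumr.
  rewrite [RHS]exchange_big /=; apply: eq_bigr => p _.
  rewrite [RHS]exchange_big /=; apply: eq_bigr => p' _.
  transitivity (\sum_(w : Wt) \sum_(x : joint L) \sum_(x' : joint L) ((u p)^* * (Kw w p x * psi p.2 x)) *
     ((u p')^* * (Kw w p' x' * psi p'.2 x'))^*); last first.
    apply: eq_bigr => w _; rewrite mulr_sumr mulr_suml; apply: eq_bigr => x _.
    by rewrite mulr_sumr conj_sum mulr_sumr.
  rewrite [RHS]exchange_big /= /Nk mulr_sumr mulr_suml; apply: eq_bigr => x _.
  rewrite [RHS]exchange_big /= mulr_sumr mulr_suml; apply: eq_bigr => x' _.
  have -> : \prod_j selk B j (o j) (p.1 j) (p'.1 j) (x j) (x' j) =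
     \sum_(w : Wt) Kw w p x * (Kw w p' x')^*.
    rewrite /Wt /Kw (eq_bigr _ (fun j _ => @selk_kraus B j (o j) (p.1 j) (p'.1 j) (x j) (x' j))).
    rewrite -(@sum_dffun_prod C _ (fun j => option (Q * L j) : finType)
     (fun j w => krausk B w (o j) (p.1 j) (x j) * (krausk B w (o j) (p'.1 j) (x' j))^*)).
    by apply: eq_bigr => w _; rewrite big_split /= conj_prod.
  rewrite mulr_suml mulr_sumr mulr_suml; apply: eq_bigr => w _.
  by rewrite /outer !conjM conjCK; ring.
by rewrite cRe_realC sum_sqn_ge0.
Qed.

Lemma joint_delta (x x' : joint L) : \prod_j ((x j == x' j)%:R : C) = (x == x')%:R.
Proof.
have [->|ne] := eqVneq x x'; first by rewrite big1 // => j _; rewrite eqxx.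
have [j hj] : exists j, x j != x' j.
  apply/existsP; apply: contraNT ne => /existsPn h.
  by apply/eqP/ffunP => j; apply/eqP; rewrite -[_ == _]negbK h.
by rewrite (bigD1 j) //= (negbTE hj) mul0r.
Qed.

Lemma card_Q : #|{: Q}|%:R = 2 ^+ k :> R.
Proof. by rewrite card_ffun card_bool card_ord natrX. Qed.

Hypothesis vtight : forall j (x x' : L j), \sum_o \sum_a (v o a x)^* * v o a x' = (x == x')%:R.

(** Each factor preserves the trace once outcomes and positions are summed: by tightness of [v] if
    measured, by counting if depolarized. *)
Lemma selk_trace B psi :
  \sum_o \sum_p complex.Re (Nk (selk B) o (outer psi) p p) = \sum_t \sum_x sqn (psi t x).
Proof.
transitivity (complex.Re (\sum_o \sum_p Nk (selk B) o (outer psi) p p)).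
  by rewrite cRe_sum; apply: eq_bigr => o _; rewrite cRe_sum.
suff -> : \sum_o \sum_p Nk (selk B) o (outer psi) p p = (\sum_t \sum_x sqn (psi t x))%:C%C by [].
rewrite realC_sum.
under eq_bigr do rewrite sum_pair.
have -> : \sum_o \sum_a \sum_t Nk (selk B) o (outer psi) (a, t) (a, t) =
  \sum_t \sum_(x : joint L) \sum_(x' : joint L) (x == x')%:R * outer psi t x t x'.
  under eq_bigr do rewrite exchange_big /=.
  rewrite exchange_big /=; apply: eq_bigr => t _.
  transitivity (\sum_(x : joint L) \sum_(x' : joint L) \sum_(o : Out) \sum_(a : A)
     (\prod_j selk B j (o j) (a j) (a j) (x j) (x' j)) * outer psi t x t x').
    rewrite /Nk /=; under eq_bigr do rewrite exchange_big /=.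
    rewrite exchange_big /=; apply: eq_bigr => x _.
    under eq_bigr do rewrite exchange_big /=.
    by rewrite exchange_big.
  apply: eq_bigr => x _; apply: eq_bigr => x' _.
  under eq_bigr do rewrite -mulr_suml.
  rewrite -mulr_suml; congr (_ * _).
  rewrite -joint_delta.
  rewrite [LHS](eq_bigr (fun o : Out => \prod_j \sum_a selk B j (o j) a a (x j) (x' j))); last first.
    by move=> o _; rewrite bigA_distr_bigA.
  rewrite (@sum_dffun_prod C _ (fun j => 'I_(2 ^ l) : finType)
     (fun j oj => \sum_a selk B j oj a a (x j) (x' j))).
  apply: eq_bigr => j _; rewrite /selk; case: ifP => jB.
    rewrite eq_sym -vtight; apply: eq_bigr => o _; apply: eq_bigr => a _.
    by rewrite mulrC.
  rewrite (eq_bigr (fun _ => \sum_(a : Q) iD%:C%C * (x j == x' j)%:R)) => [|o _]; last first.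
    by apply: eq_bigr => a _; rewrite /depk eqxx mul1r.
  rewrite !sumr_const card_ord -mulrnA -[LHS]mulr_natl mulrA.
  suff -> : (#|{: Q}| * 2 ^ l)%N%:R * iD%:C%C = 1 :> C by rewrite mul1r.
  rewrite -(realC_nat R) -realCM natrM card_Q natrX -exprD /iD.
  by have n0 : (2 ^+ (k + l) : R) != 0 by [rewrite expf_neq0]; rewrite mulfV.
apply: eq_bigr => t _; rewrite realC_sum; apply: eq_bigr => x _.
by rewrite sum_delta_l /outer mul_conj_sqn.
Qed.

(** The target of the decoupling: with all parties depolarized the positions are uniform and
    independent of the reference, whose Gram matrix is diagonal with weights [q]. *)
Lemma selk0_diag (phi : Rt -> joint L -> C) (q : Rt -> R) o p p' :
  (forall t t', \sum_x phi t x * (phi t' x)^* = (t == t')%:R * (q t)%:C%C) ->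
  Nk (selk finset.set0) o (outer phi) p p' = (p == p')%:R * (q p.2 / 2 ^+ (k + l) ^+ m)%:C%C.
Proof.
move=> orth; case: p => a t; case: p' => a' t'; rewrite /Nk /=.
transitivity ((iD ^+ m)%:C%C * ((a == a')%:R * \sum_x \sum_x' (x == x')%:R * outer phi t x t' x')).
  rewrite !mulr_sumr; apply: eq_bigr => x _; rewrite !mulr_sumr; apply: eq_bigr => x' _.
  rewrite (eq_bigr (fun j => iD%:C%C * ((a j == a' j)%:R * (x j == x' j)%:R))); last first.
    by move=> j _; rewrite /selk inE.
  rewrite big_split big_split /= joint_delta prodr_const card_ord.
  have -> : \prod_j ((a j == a' j)%:R : C) = (a == a')%:R.
    have [->|ne] := eqVneq a a'; first by rewrite big1 // => j _; rewrite eqxx.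
    have [j hj] : exists j, a j != a' j.
      apply/existsP; apply: contraNT ne => /existsPn h.
      by apply/eqP/ffunP => j; apply/eqP; rewrite -[_ == _]negbK h.
    by rewrite (bigD1 j) //= (negbTE hj) mul0r.
  by rewrite (rmorphXn (real_complex R)) !mulrA.
under [X in _ * (_ * X)]eq_bigr do rewrite sum_delta_l.
by rewrite orth xpair_eqE -mulnb natrM realCM /iD exprVn; ring.
Qed.

Lemma selk_telescope B o Y p p' :
  Nk (selk B) o Y p p' = \sum_(J : {set 'I_m} | J \subset B) Nk (diffk J) o Y p p'.
Proof.
rewrite /Nk [RHS]exchange_big /=; apply: eq_bigr => x _.
rewrite [RHS]exchange_big /=; apply: eq_bigr => x' _; rewrite -mulr_suml; congr (_ * _).
pose ms j := meask j (o j) (p.1 j) (p'.1 j) (x j) (x' j).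
pose dp j := depk j (o j) (p.1 j) (p'.1 j) (x j) (x' j).
transitivity (\prod_j ((if j \in B then ms j - dp j else 0) + dp j)).
  by apply: eq_bigr => j _; rewrite /selk; case: ifP; rewrite ?add0r ?subrK.
rewrite bigA_distr [LHS](bigID (fun J : {set 'I_m} => J \subset B)) /= [X in _ + X]big1 ?addr0.
  apply: eq_bigr => J /fintype.subsetP JB; apply: eq_bigr => j _; rewrite /diffk.
  by case: ifP => // /JB ->.
move=> J /fintype.subsetPn[j jJ jB]; rewrite (bigD1 j) //= jJ (negbTE jB).
exact: mul0r.
Qed.

(** The kernel of [J] is a difference, so a small trace of [Y] does not bound its form. Expanding
    the product gives a combination of the kernels [selk B] with coefficients -1, 0 or 1; on a
    rank-one [Y] each of these is positive with known trace, and there are 2^m of them. *)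
Lemma diffk_bound J o Y (u : A * Rt -> C) :
  `|qf u (Nk (diffk J) o Y)| <= \sum_(B : {set 'I_m}) `|qf u (Nk (selk B) o Y)|.
Proof.
pose s (B : {set 'I_m}) : R := \prod_j (if j \in B then (j \in J)%:R else if j \in J then -1 else 1).
have sle B : `|s B| <= 1.
  rewrite normr_prod; apply: prodr_ile1 => j _; rewrite normr_ge0 /=.
  by case: (j \in B); case: (j \in J); rewrite ?normr0 ?normrN ?normr1.
have -> : qf u (Nk (diffk J) o Y) = \sum_(B : {set 'I_m}) s B * qf u (Nk (selk B) o Y).
  rewrite (eq_bigr (fun B => qf u (fun p p' => (s B)%:C%C * Nk (selk B) o Y p p'))).
    rewrite -qf_sum; apply: eq_qf => p p'.
    under [RHS]eq_bigr do rewrite /Nk mulr_sumr.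
    rewrite /Nk [RHS]exchange_big /=; apply: eq_bigr => x _.
    under [RHS]eq_bigr do rewrite mulr_sumr.
    rewrite [RHS]exchange_big /=; apply: eq_bigr => x' _.
    under [RHS]eq_bigr do rewrite mulrA.
    rewrite -mulr_suml; congr (_ * _).
    pose ms j := meask j (o j) (p.1 j) (p'.1 j) (x j) (x' j).
    pose dp j := depk j (o j) (p.1 j) (p'.1 j) (x j) (x' j).
    transitivity (\prod_j ((if j \in J then ms j else 0) + (if j \in J then - dp j else dp j))).
      by apply: eq_bigr => j _; rewrite /diffk; case: ifP; rewrite ?add0r.
    rewrite bigA_distr; apply: eq_bigr => B _.
    rewrite realC_prod -big_split /=; apply: eq_bigr => j _; rewrite /selk.
    have e1 : (1 : R)%:C%C = 1 :> C by [].
    have e0 : (0 : R)%:C%C = 0 :> C by [].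
    have eN : (-1 : R)%:C%C = -1 :> C by rewrite -[1 in RHS]e1 -[RHS]sub0r -[in RHS]e0 -realCB sub0r.
    by case: (j \in B); case: (j \in J) => /=; rewrite ?e1 ?e0 ?eN ?mul1r ?mul0r ?mulN1r.
  by move=> B _; rewrite qf_scale.
apply: le_trans (ler_norm_sum _ _ _) _; apply: ler_sum => B _.
by rewrite normrM; apply: ler_piMl.
Qed.

(* kernels depolarizing off J see only the marginal on J, represented by vectors
   supported on the configurations that agree with x0 off J *)
Definition repr (J : {set 'I_m}) (x0 x : joint L) : joint L :=
  [ffun j => if j \in J then x j else x0 j].

Definition agree (J : {set 'I_m}) (y y' : joint L) := [forall j, (j \notin J) ==> (y j == y' j)].

(** Once the inputs are grouped by their representatives, any decomposition [c] of the marginal on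
    [J] and the reference may replace [phi]. *)
Lemma Nk_marginal (J : {set 'I_m}) (x0 : joint L) (phi : Rt -> joint L -> C) (La : finType)
    (c : La -> Rt -> joint L -> C) (kap : kernel) o p p' :
  (forall j, j \notin J -> kap j = depk j) ->
  (forall s t x, repr J x0 x != x -> c s t x = 0) ->
  (forall t t' x x', repr J x0 x = x -> repr J x0 x' = x' ->
     \sum_(y | repr J x0 y == x) \sum_(y' | repr J x0 y' == x')
        (agree J y y')%:R * outer phi t y t' y' = \sum_s c s t x * (c s t' x')^*) ->
  Nk kap o (outer phi) p p' = \sum_s Nk kap o (outer (c s)) p p'.
Proof.
move=> kapd c0 hc.
pose ker (y y' : joint L) : C := \prod_j (if j \in J then kap j (o j) (p.1 j) (p'.1 j) (y j) (y' j)
   else iD%:C%C * (p.1 j == p'.1 j)%:R).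
have kerE (y y' : joint L) : \prod_j kap j (o j) (p.1 j) (p'.1 j) (y j) (y' j) = ker y y' * (agree J y y')%:R.
  have -> : (agree J y y')%:R = \prod_j (if j \in J then 1 else (y j == y' j)%:R) :> C.
    case: (boolP (agree J y y')) => [/forallP h|/forallPn[j]].
      by rewrite big1 // => j _; have := h j; case: ifP => //= _ /eqP ->; rewrite eqxx.
    by rewrite negb_imply => /andP[/negbTE jJ /negbTE ne]; rewrite (bigD1 j) //= jJ ne mul0r.
  rewrite /ker -big_split /=; apply: eq_bigr => j _; case: ifP => jJ; first by rewrite mulr1.
  by rewrite kapd ?jJ // /depk mulrA.
have kerR (y y' : joint L) : ker y y' = ker (repr J x0 y) (repr J x0 y').
  by apply: eq_bigr => j _; rewrite !ffunE; case: ifP.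
have reprK y : repr J x0 (repr J x0 y) = repr J x0 y.
  by apply/ffunP => j; rewrite !ffunE; case: (j \in J).
have agr x x' : repr J x0 x = x -> repr J x0 x' = x' -> agree J x x'.
  move=> <- <-; apply/forallP => j; apply/implyP => /negbTE jJ; by rewrite !ffunE jJ.
transitivity (\sum_(x | repr J x0 x == x) \sum_(x' | repr J x0 x' == x') ker x x' *
   \sum_s c s p.2 x * (c s p'.2 x')^*).
  rewrite /Nk.
  transitivity (\sum_(y : joint L) \sum_(y' : joint L)
     ker (repr J x0 y) (repr J x0 y') * ((agree J y y')%:R * outer phi p.2 y p'.2 y')).
    by apply: eq_bigr => y _; apply: eq_bigr => y' _; rewrite kerE -kerR mulrA.
  rewrite (partition_big (repr J x0) (fun x : joint L => repr J x0 x == x)) /=; last first.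
    by move=> y _; rewrite reprK.
  apply: eq_bigr => x /eqP hx.
  transitivity (\sum_(y | repr J x0 y == x) \sum_(x' | repr J x0 x' == x')
     \sum_(y' | repr J x0 y' == x') ker x x' * ((agree J y y')%:R * outer phi p.2 y p'.2 y')).
    apply: eq_bigr => y /eqP hy.
    rewrite (partition_big (repr J x0) (fun x : joint L => repr J x0 x == x)) /=; last first.
      by move=> y' _; rewrite reprK.
    by apply: eq_bigr => x' /eqP hx'; apply: eq_bigr => y' /eqP hy'; rewrite hy hy'.
  rewrite exchange_big /=; apply: eq_bigr => x' /eqP hx'.
  rewrite -hc // mulr_sumr; apply: eq_bigr => y _; by rewrite mulr_sumr.
rewrite -Nk_sumY /Nk big_mkcond; apply: eq_bigr => x _.
case: ifP => [/eqP hx|/negbT hx]; last first.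
  rewrite big1 // => x' _; rewrite [X in _ * X]big1 ?mulr0 // => s _.
  by rewrite /outer c0 // mul0r.
rewrite big_mkcond; apply: eq_bigr => x' _.
case: ifP => [/eqP hx'|/negbT hx']; last first.
  by rewrite [X in _ * X]big1 ?mulr0 // => s _; rewrite /outer (c0 _ _ _ hx') conjE conjc0 mulr0.
by rewrite kerE agr // mulr1.
Qed.

End Kernels.

(** * The one-shot bound *)

Section OneShot.
Variable R : realType.
Local Notation C := R[i].

Lemma sum_ffun_dffun (V : nmodType) (I T : finType) (F : (I -> T) -> V) :
  \sum_(a : {ffun I -> T}) F a = \sum_(a : {dffun forall _ : I, T}) F a.
Proof.
pose h (a : {dffun forall _ : I, T}) : {ffun I -> T} := [ffun j => a j].
rewrite (reindex h) /=.
  by apply: eq_bigr => a _; congr F; apply: funext => j; rewrite ffunE.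
exists (fun a : {ffun I -> T} => [ffun j => a j] : {dffun forall _ : I, T}) => a _;
  by apply/ffunP => j; rewrite !ffunE.
Qed.

Lemma sum_dffun_pairf (V : nmodType) (I : finType) (T S : I -> finType)
    (F : (forall i, T i) -> (forall i, S i) -> V) :
  \sum_(w : {dffun forall i, (T i * S i)%type}) F (fun i => (w i).1) (fun i => (w i).2)
  = \sum_(f : {dffun forall i, T i}) \sum_(g : {dffun forall i, S i}) F f g.
Proof.
rewrite -(@sum_dffun_pair V I T S (fun f g => F f g)); apply: eq_bigr => w _.
by congr F; apply: functional_extensionality_dep => j; rewrite ffunE.
Qed.

Lemma sum_dffun_quad (V : nmodType) (I : finType) (S T U W : I -> finType)
    (F : (forall i, S i) -> (forall i, T i) -> (forall i, U i) -> (forall i, W i) -> V) :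
  \sum_(w : {dffun forall i, (S i * (T i * (U i * W i)))%type})
     F (fun i => (w i).1) (fun i => (w i).2.1) (fun i => (w i).2.2.1) (fun i => (w i).2.2.2)
  = \sum_(s : {dffun forall i, S i}) \sum_(t : {dffun forall i, T i})
    \sum_(u : {dffun forall i, U i}) \sum_(w : {dffun forall i, W i}) F s t u w.
Proof.
rewrite (@sum_dffun_pairf V I S (fun i => (T i * (U i * W i))%type : finType)
  (fun s r => F s (fun i => (r i).1) (fun i => (r i).2.1) (fun i => (r i).2.2))).
apply: eq_bigr => s _.
rewrite (@sum_dffun_pairf V I T (fun i => (U i * W i)%type : finType)
  (fun t r => F s t (fun i => (r i).1) (fun i => (r i).2))).
by apply: eq_bigr => t _; rewrite (@sum_dffun_pairf V I U W (fun u w => F s t u w)).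
Qed.

Lemma exists_le_avg (Om : finType) (f : Om -> R) (B : R) :
  (0 < #|Om|)%N -> \sum_w f w <= #|Om|%:R * B -> exists w, f w <= B.
Proof.
move=> Om0 h; apply: contrapT => /forallNP hn.
have : \sum_(w : Om) B < \sum_w f w.
  apply: ltr_sum => [|w _]; first by case/card_gt0P: Om0 => w _; apply/hasP; exists w; rewrite ?mem_index_enum.
  by rewrite ltNge; apply/negP; apply: hn.
by rewrite sumr_const -mulr_natl ltNge h.
Qed.

Variables (m : nat) (L : 'I_m -> finType) (i : 'I_m) (k l : nat) (Rt : finType).
Local Notation Q := {ffun 'I_k -> bool}.
Local Notation A := {ffun 'I_m -> Q}.
Local Notation Out := {dffun forall j : 'I_m, 'I_(2 ^ l)}.
Let iD : R := (2 ^+ (k + l))^-1.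

Section Average.
Variables (Om : 'I_m -> finType) (vv : forall j, Om j -> 'I_(2 ^ l) -> Q -> L j -> C).
Hypothesis vvbound : forall j (Y : L j -> L j -> C),
  \sum_w \sum_o \sum_a \sum_a'
     sqn (\sum_x \sum_x' (vv w o a x * (vv w o a' x')^* -
        (a == a')%:R * (x == x')%:R * iD%:C%C) * Y x x')
  <= #|Om j|%:R * (6 * 2 ^+ k / 2 ^+ (k + l)) * \sum_x \sum_x' sqn (Y x x').

Definition vsel (w : {dffun forall j, Om j}) : forall j, 'I_(2 ^ l) -> Q -> L j -> C :=
  fun j => vv (w j).

(** With D = 2^(k+l), a party in [J] contributes 6 * 2^k / D by the random measurement. Off [J] the
    representatives allow only the entry at [x0], so the depolarizing kernel contributes D^(-2) for
    each of the D triples of an outcome and two equal positions, that is 1/D. Without the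
    restriction to [x0] a local dimension would appear. *)
Lemma HS_random_entry (J : {set 'I_m}) (x0 : joint L) (Y : joint L -> joint L -> C) :
  (forall x x', repr J x0 x != x -> Y x x' = 0) ->
  (forall x x', repr J x0 x' != x' -> Y x x' = 0) ->
  \sum_(w : {dffun forall j, Om j}) \sum_(o : Out) \sum_(a : A) \sum_(a' : A)
    sqn (\sum_(x : joint L) \sum_(x' : joint L) (\prod_j @diffk R m L k l (vsel w) J j (o j) (a j) (a' j) (x j) (x' j)) * Y x x')
  <= (\prod_j #|Om j|%:R) * ((6 * 2 ^+ k) ^+ #|J| * iD ^+ m) * \sum_x \sum_x' sqn (Y x x').
Proof.
move=> Y0 Y0'.
pose W j : finType := (Om j * ('I_(2 ^ l) * (Q * Q)))%type.
pose P j : finType := (L j * L j)%type.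
pose M j (w : W j) (p : P j) : C :=
  if j \in J then vv w.1 w.2.1 w.2.2.1 p.1 * (vv w.1 w.2.1 w.2.2.2 p.2)^* -
     (w.2.2.1 == w.2.2.2)%:R * (p.1 == p.2)%:R * iD%:C%C
  else iD%:C%C * (w.2.2.1 == w.2.2.2)%:R * ((p.1 == x0 j)%:R * (p.2 == x0 j)%:R).
pose c j : R := #|Om j|%:R * (if j \in J then 6 * 2 ^+ k * iD else iD).
have hM j (u : P j -> C) : \sum_w sqn (\sum_p M j w p * u p) <= c j * \sum_p sqn (u p).
  rewrite /c /M; case: ifP => jJ.
    have := vvbound (fun x x' => u (x, x')).
    rewrite [X in _ <= _ * X -> _](_ : _ = \sum_p sqn (u p)); last by rewrite sum_pair.
    rewrite [X in X <= _ -> _](_ : _ = \sum_(w : W j) sqn (\sum_p (vv w.1 w.2.1 w.2.2.1 p.1 * (vv w.1 w.2.1 w.2.2.2 p.2)^* -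
     (w.2.2.1 == w.2.2.2)%:R * (p.1 == p.2)%:R * iD%:C%C) * u p)) //.
    rewrite [RHS]sum_pair; apply: eq_bigr => w _.
    rewrite [RHS]sum_pair; apply: eq_bigr => o _.
    rewrite [RHS]sum_pair; apply: eq_bigr => a _; apply: eq_bigr => a' _.
    by congr sqn; rewrite [RHS]sum_pair.
  have e1 w : \sum_p iD%:C%C * (w.2.2.1 == w.2.2.2)%:R * ((p.1 == x0 j)%:R * (p.2 == x0 j)%:R) * u p =
     iD%:C%C * (w.2.2.1 == w.2.2.2)%:R * u (x0 j, x0 j) :> C.
    rewrite sum_pair /=.
    rewrite (eq_bigr (fun x => (x == x0 j)%:R * (iD%:C%C * (w.2.2.1 == w.2.2.2)%:R *
       \sum_x' (x' == x0 j)%:R * u (x, x')))).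
      by rewrite !sum_delta.
    move=> x _; rewrite mulr_sumr mulr_sumr; apply: eq_bigr => x' _; ring.
  under eq_bigr do rewrite e1 !sqnM sqn_real.
  rewrite -mulr_suml -mulr_sumr.
  have -> : \sum_(w : W j) sqn ((w.2.2.1 == w.2.2.2)%:R : C) = #|Om j|%:R * (2 ^+ (k + l)).
    rewrite sum_pair /= sumr_const sum_pair /= sumr_const card_ord sum_pair /=.
    have -> : \sum_(a : Q) \sum_(b : Q) sqn ((a == b)%:R : C) = 2 ^+ k.
      rewrite (eq_bigr (fun _ => 1)) => [|a _]; first by rewrite sumr_const card_Q.
      rewrite (bigD1 a) //= eqxx big1 ?addr0 => [|b /negbTE]; first by rewrite /sqn /= expr1n expr0n addr0.
      by rewrite eq_sym => ->; rewrite sqn0.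
    by rewrite -mulrnA -[LHS]mulr_natl natrM natrX exprD; ring.
  have -> : iD ^+ 2 * (#|Om j|%:R * 2 ^+ (k + l)) = #|Om j|%:R * iD.
    by rewrite /iD; field; rewrite expf_neq0.
  apply: ler_wpM2l; first by rewrite mulr_ge0 // invr_ge0 exprn_ge0.
  by rewrite [leRHS](bigD1 (x0 j, x0 j)) //= lerDl sum_sqn_ge0.
have := @tensor_bound R _ P W M c hM
  (fun p : {dffun forall j, P j} => Y [ffun j => (p j).1] [ffun j => (p j).2]).
rewrite (@sum_dffun_pair R _ L L (fun x x' => sqn (Y x x'))).
have -> : \prod_j c j = (\prod_j #|Om j|%:R) * ((6 * 2 ^+ k) ^+ #|J| * iD ^+ m).
  rewrite /c big_split /=; congr (_ * _).
  rewrite (eq_bigr (fun j => (if j \in J then 6 * 2 ^+ k else 1) * iD)); last first.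
    by move=> j _; case: ifP => _; rewrite ?mul1r.
  by rewrite big_split /= prodr_const card_ord -big_mkcond /= prodr_const.
apply: le_trans.
rewrite le_eqVlt; apply/orP; left; apply/eqP.
pose H (w : forall j, Om j) (o : forall j : 'I_m, 'I_(2 ^ l)) (a a' : 'I_m -> Q) : R :=
  sqn (\sum_(x : joint L) \sum_(x' : joint L) (\prod_j M j (w j, (o j, (a j, a' j))) (x j, x' j)) * Y x x').
transitivity (\sum_(w : {dffun forall j, Om j}) \sum_(o : Out)
   \sum_(a : {dffun forall _ : 'I_m, Q}) \sum_(a' : {dffun forall _ : 'I_m, Q}) H w o a a').
  apply: eq_bigr => w _; apply: eq_bigr => o _.
  rewrite -(sum_ffun_dffun (fun a => \sum_(a' : {dffun forall _ : 'I_m, Q}) H w o a a')).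
  apply: eq_bigr => a _; rewrite -(sum_ffun_dffun (fun a' => H w o a a')).
  apply: eq_bigr => a' _; rewrite /H; congr sqn; apply: eq_bigr => x _; apply: eq_bigr => x' _.
  have [hx|hx] := eqVneq (repr J x0 x) x; last by rewrite Y0 ?mulr0.
  have [hx'|hx'] := eqVneq (repr J x0 x') x'; last by rewrite Y0' ?mulr0.
  congr (_ * _); apply: eq_bigr => j _; rewrite /diffk /M /=; case: ifP => jJ.
    by rewrite /meask /depk /vsel; ring.
  have xj : x j = x0 j by rewrite -hx ffunE jJ.
  have xj' : x' j = x0 j by rewrite -hx' ffunE jJ.
  by rewrite /depk xj xj' !eqxx /=; ring.
have := @sum_dffun_quad R _ Om (fun _ => 'I_(2 ^ l) : finType) (fun _ => Q : finType)
  (fun _ => Q : finType) H.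
move=> <-; apply: eq_bigr => w _; rewrite /H; congr sqn.
rewrite -(@sum_dffun_pair C _ L L (fun x x' => (\prod_j M j ((w j).1, ((w j).2.1,
   ((w j).2.2.1, (w j).2.2.2))) (x j, x' j)) * Y x x')).
apply: eq_bigr => p _; congr (_ * _); apply: eq_bigr => j _.
by rewrite !ffunE -!surjective_pairing.
Qed.

Lemma HS_random (J : {set 'I_m}) (x0 : joint L) (Y : Rt -> joint L -> Rt -> joint L -> C) :
  (forall t t' x x', repr J x0 x != x -> Y t x t' x' = 0) ->
  (forall t t' x x', repr J x0 x' != x' -> Y t x t' x' = 0) ->
  \sum_(w : {dffun forall j, Om j}) \sum_(o : Out) \sum_(p : A * Rt) \sum_(p' : A * Rt)
    sqn (Nk (@diffk R m L k l (vsel w) J) o Y p p')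
  <= (\prod_j #|Om j|%:R) * ((6 * 2 ^+ k) ^+ #|J| * iD ^+ m) *
     \sum_t \sum_t' \sum_x \sum_x' sqn (Y t x t' x').
Proof.
move=> Y0 Y0'; rewrite mulr_sumr.
have -> : \sum_(w : {dffun forall j, Om j}) \sum_(o : Out) \sum_(p : A * Rt) \sum_(p' : A * Rt)
    sqn (Nk (@diffk R m L k l (vsel w) J) o Y p p') =
  \sum_t \sum_t' \sum_(w : {dffun forall j, Om j}) \sum_(o : Out) \sum_(a : A) \sum_(a' : A)
    sqn (Nk (@diffk R m L k l (vsel w) J) o Y (a, t) (a', t')).
  transitivity (\sum_(w : {dffun forall j, Om j}) \sum_(o : Out) \sum_t \sum_t' \sum_(a : A) \sum_(a' : A)
    sqn (Nk (@diffk R m L k l (vsel w) J) o Y (a, t) (a', t'))).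
    apply: eq_bigr => w _; apply: eq_bigr => o _.
    rewrite sum_pair exchange_big /=; apply: eq_bigr => t _.
    transitivity (\sum_(a : A) \sum_t' \sum_(a' : A)
       sqn (Nk (@diffk R m L k l (vsel w) J) o Y (a, t) (a', t'))).
      by apply: eq_bigr => a _; rewrite sum_pair exchange_big.
    by rewrite exchange_big.
  rewrite [RHS](eq_bigr (fun t => \sum_(w : {dffun forall j, Om j}) \sum_(o : Out) \sum_t' \sum_(a : A) \sum_(a' : A)
    sqn (Nk (@diffk R m L k l (vsel w) J) o Y (a, t) (a', t')))).
    rewrite [RHS]exchange_big /=; apply: eq_bigr => w _; by rewrite [RHS]exchange_big.
  move=> t _; rewrite exchange_big /=; apply: eq_bigr => w _; by rewrite exchange_big.
apply: ler_sum => t _; rewrite mulr_sumr; apply: ler_sum => t' _.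
exact: (HS_random_entry (fun x x' => Y0 t t' x x') (fun x x' => Y0' t t' x x')).
Qed.

End Average.

(** The vectors [phi (f t)] are the part of the ensemble that the decoder aims at. [P J] bounds the
    purity of the typical part of the marginal of [J], and [eta J] the weight of the rest. The
    square root is the Hilbert-Schmidt estimate, in which the number of outcomes and positions has
    cancelled the normalization of the kernels; 2^m counts the kernels [selk B] that bound an
    atypical part; the division by 2 comes from the Uhlmann bound. *)
Lemma oneshot (I : finType) (phi : I -> joint L -> C) (f : Rt -> I) (q : Rt -> R)
    (x0 : joint L) (La : {set 'I_m} -> finType)
    (c : forall J, La J -> Rt -> joint L -> C) (typ : forall J, pred (La J))
    (P eta : {set 'I_m} -> R) :
  injective f ->
  (forall j, (#|L j| <= 2 ^ (k + l))%N) ->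
  (forall t, 0 <= q t) -> \sum_t q t <= 1 ->
  (forall t t', \sum_x phi (f t) x * (phi (f t') x)^* = (t == t')%:R * (q t)%:C%C) ->
  (forall J s t x, repr J x0 x != x -> c J s t x = 0) ->
  (forall J t t' x x', repr J x0 x = x -> repr J x0 x' = x' ->
     \sum_(y | repr J x0 y == x) \sum_(y' | repr J x0 y' == x')
        (agree J y y')%:R * (phi (f t) y * (phi (f t') y')^*) = \sum_s c J s t x * (c J s t' x')^*) ->
  (forall J, \sum_t \sum_t' \sum_x \sum_x' sqn (\sum_(s | typ J s) c J s t x * (c J s t' x')^*) <= P J) ->
  (forall J, \sum_(s | ~~ typ J s) \sum_t \sum_x sqn (c J s t x) <= eta J) ->
  exists Lam, @LOCC R m L (@qubits m k) Lam /\
    \sum_t q t - (\sum_(J : {set 'I_m} | (J != finset.set0) && (i \notin J))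
       (Num.sqrt (\sum_(J : {set 'I_m} | (J != finset.set0) && (i \notin J))
           #|Rt|%:R * (6 * 2 ^+ k) ^+ #|J| * P J) + 2 ^+ m * eta J)) / 2
      <= fidelity (ghz_pow R (m := m) (k := k)) (Lam (mix phi)).
Proof.
move=> fI cardL q0 q1 orth c0 cmarg cP ceta.
pose ph t := phi (f t).
have [Om [vv vvP]] : exists (Om : 'I_m -> finType)
    (vv : forall j, Om j -> 'I_(2 ^ l) -> Q -> L j -> C), forall j,
    [/\ (0 < #|Om j|)%N,
      (forall w x x', \sum_o \sum_a (vv j w o a x)^* * vv j w o a x' = (x == x')%:R) &
      (forall Y : L j -> L j -> C,
        \sum_w \sum_o \sum_a \sum_a'
          sqn (\sum_x \sum_x' (vv j w o a x * (vv j w o a' x')^* -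
             (a == a')%:R * (x == x')%:R * ((2 ^+ (k + l))^-1)%:C%C) * Y x x')
        <= #|Om j|%:R * (6 * 2 ^+ k / 2 ^+ (k + l)) * \sum_x \sum_x' sqn (Y x x'))].
  pose rm j := cid (@random_measurement R k l (L j) (cardL j)).
  by exists (fun j => projT1 (rm j)), (fun j => projT1 (cid (projT2 (rm j)))) => j; exact: projT2 (cid (projT2 (rm j))).
have Om0 j : (0 < #|Om j|)%N by have [] := vvP j.
have vvb j (Y : L j -> L j -> C) : \sum_w \sum_o \sum_a \sum_a'
          sqn (\sum_x \sum_x' (vv j w o a x * (vv j w o a' x')^* -
             (a == a')%:R * (x == x')%:R * ((2 ^+ (k + l))^-1)%:C%C) * Y x x')
        <= #|Om j|%:R * (6 * 2 ^+ k / 2 ^+ (k + l)) * \sum_x \sum_x' sqn (Y x x').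
  by have [_ _ h] := vvP j; exact: h.
have vvt j w (x x' : L j) : \sum_o \sum_a (vv j w o a x)^* * vv j w o a x' = (x == x')%:R.
  by have [_ h _] := vvP j; exact: h.
pose X J t x t' x' : C := \sum_(s | typ J s) c J s t x * (c J s t' x')^*.
pose okJ (J : {set 'I_m}) := (J != finset.set0) && (i \notin J).
pose B := \sum_(J | okJ J) #|Rt|%:R * (6 * 2 ^+ k) ^+ #|J| * P J.
pose D : R := 2 ^+ (k + l) ^+ m.
have D0 : 0 < D by rewrite !exprn_gt0.
pose hs J (w : {dffun forall j, Om j}) (o : Out) :=
  \sum_(p : A * Rt) \sum_(p' : A * Rt) sqn (Nk (@diffk R m L k l (vsel vv w) J) o (X J) p p').
have hs0 J w o : 0 <= hs J w o by apply: sumr_ge0 => p _; apply: sum_sqn_ge0.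
have Rt0 : 0 <= #|Rt|%:R :> R by exact: ler0n.
(* One choice of measurements must serve all [J], so it is the sum over [J] that is averaged.
   [D * #|Rt|] is the number of outcome tuples, lost by Cauchy-Schwarz over [o], times the dimension
   lost in passing to the Hilbert-Schmidt norm. *)
have [w wB] : exists w, \sum_(J | okJ J) (D * #|Rt|%:R * \sum_o hs J w o) <= B.
  apply: exists_le_avg.
    by rewrite card_dffun prodn_gt0.
  rewrite exchange_big mulr_sumr /=; apply: ler_sum => J _.
  rewrite -mulr_sumr.
  apply: (@le_trans _ _ (D * #|Rt|%:R * ((\prod_j #|Om j|%:R) * ((6 * 2 ^+ k) ^+ #|J| * iD ^+ m) * P J))).
    apply: ler_wpM2l; first by rewrite mulr_ge0 // ltW.
    apply: (@le_trans _ _ ((\prod_j #|Om j|%:R) * ((6 * 2 ^+ k) ^+ #|J| * iD ^+ m) *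
       \sum_t \sum_t' \sum_x \sum_x' sqn (X J t x t' x'))).
      apply: (HS_random vvb (x0 := x0)) => t t' x x' hx.
        by rewrite /X big1 // => s _; rewrite (c0 _ _ _ _ hx) mul0r.
      by rewrite /X big1 // => s _; rewrite (c0 _ _ _ _ hx) conjE conjc0 mulr0.
    apply: ler_wpM2l; last exact: cP.
    apply: mulr_ge0; first by apply: prodr_ge0 => j _; exact: ler0n.
    apply: mulr_ge0; first by apply: exprn_ge0; apply: mulr_ge0; rewrite ?exprn_ge0 ?ler0n.
    by apply: exprn_ge0; rewrite invr_ge0 exprn_ge0.
  rewrite card_dffun natr_prod.
  have DiD : D * iD ^+ m = 1 by rewrite /iD exprVn mulfV // gt_eqF.
  rewrite le_eqVlt; apply/orP; left; apply/eqP.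
  move: (\prod_j _) (_ ^+ #|J|) (P J) (#|Rt|%:R) => a1 a2 a3 a4.
  transitivity ((D * iD ^+ m) * (a1 * (a4 * a2 * a3))); first by ring.
  by rewrite DiD mul1r.
pose v := vsel vv w.
have vtight j (x x' : L j) : \sum_o \sum_a (v j o a x)^* * v j o a x' = (x == x')%:R.
  exact: vvt.
pose z J (o : Out) := \sum_(s | ~~ typ J s) \sum_(S : {set 'I_m})
   complex.Re (\sum_p Nk (@selk R m L k l v S) o (outer (c J s)) p p).
pose co (o : Out) := \sum_(J | okJ J) (Num.sqrt (#|{: A * Rt}|%:R * hs J w o) + z J o).
have hc o (U : 'I_#|{: A * Rt}| -> A * Rt -> C) : orthobasis U ->
  \sum_s `|complex.Re (\sum_x \sum_y (U s x)^* *
     (\sum_(b : L i * Q) branch v (ph x.2) o x.1 b * (branch v (ph y.2) o y.1 b)^*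
       - (x == y)%:R * (q x.2 / 2 ^+ (k + l) ^+ m)%:C%C) * U s y)| <= co o.
  move=> Ub.
  (* In the expansion the empty [J] is the decoupled target and cancels; sets containing [i] do not
     occur because [i] is depolarized. *)
  have split s : complex.Re (\sum_x \sum_y (U s x)^* *
     (\sum_(b : L i * Q) branch v (ph x.2) o x.1 b * (branch v (ph y.2) o y.1 b)^*
       - (x == y)%:R * (q x.2 / 2 ^+ (k + l) ^+ m)%:C%C) * U s y) =
    \sum_(J | okJ J) (qf (U s) (Nk (@diffk R m L k l v J) o (X J)) +
       \sum_(r | ~~ typ J r) qf (U s) (Nk (@diffk R m L k l v J) o (outer (c J r)))).
    transitivity (\sum_(J | okJ J) qf (U s) (fun p p' => Nk (@diffk R m L k l v J) o (outer ph) p p')).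
      rewrite -qf_sum; apply: eq_qf => p p'.
      rewrite branch_gram -(@selk0_diag R m L k l Rt v ph q o p p' orth) !selk_telescope.
      rewrite [X in _ - X](big_pred1 finset.set0) => [|J]; last by rewrite /= finset.subset0.
      rewrite (bigD1 finset.set0) ?finset.sub0set //= addrC addrK; apply: eq_bigl => J.
      by rewrite /okJ finset.subsetC finset.sub1set inE andbC.
    apply: eq_bigr => J _; rewrite -qf_sum -[qf _ (Nk _ _ (X J))]/(qf _ (fun p p' => Nk _ _ (X J) p p')).
    have -> : forall a b, qf (U s) a + qf (U s) b = qf (U s) (fun p p' => a p p' + b p p').
      move=> a b; rewrite /qf -cReD -big_split /=; congr complex.Re; apply: eq_bigr => x _.
      by rewrite -big_split /=; apply: eq_bigr => y _; rewrite mulrDr mulrDl.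
    apply: eq_qf => p p'.
    rewrite (@Nk_marginal R m L k l Rt J x0 ph (La J) (c J)) //; first last.
    - by move=> t t' x x' hx hx'; rewrite -cmarg.
    - exact: c0.
    - move=> j jJ; rewrite /diffk (negbTE jJ) //.
    rewrite (bigID (typ J)) /=; congr (_ + _).
    by rewrite -Nk_sumY.
  under eq_bigr do rewrite split.
  apply: (@le_trans _ _ (\sum_s \sum_(J | okJ J) (`|qf (U s) (Nk (@diffk R m L k l v J) o (X J))| +
      \sum_(r | ~~ typ J r) \sum_(S : {set 'I_m}) qf (U s) (Nk (@selk R m L k l v S) o (outer (c J r)))))).
    apply: ler_sum => s _; apply: le_trans (ler_norm_sum _ _ _) _; apply: ler_sum => J _.
    apply: le_trans (ler_normD _ _) _; rewrite lerD2l.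
    apply: le_trans (ler_norm_sum _ _ _) _; apply: ler_sum => r _.
    apply: le_trans (diffk_bound _ _ _ _ _) _; apply: ler_sum => S _.
    by rewrite ger0_norm // selk_psd.
  rewrite exchange_big /= /co; apply: ler_sum => J _; rewrite big_split /=; apply: lerD.
    have dH := diag_HS (Nk (@diffk R m L k l v J) o (X J)) Ub.
    rewrite -[leLHS]ger0_norm; last by apply: sumr_ge0.
    by rewrite -sqrtr_sqr ler_wsqrtr.
  rewrite exchange_big /= /z; apply: ler_sum => r _.
  rewrite exchange_big /=; apply: ler_sum => S _.
  by rewrite qf_trace.
have trG : \sum_o \sum_(p : A * Rt) \sum_(b : L i * Q) sqn (branch v (ph p.2) o p.1 b) = \sum_t q t.
  transitivity (\sum_o \sum_p complex.Re (Nk (@selk R m L k l v (~: [set i])%SET) o (outer ph) p p)).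
    apply: eq_bigr => o _; apply: eq_bigr => p _; rewrite -branch_gram cRe_sum.
    by apply: eq_bigr => b _; rewrite mul_conj_sqn.
  rewrite selk_trace //; apply: eq_bigr => t _.
  apply: (@complexI R); have := orth t t; rewrite eqxx mul1r => <-.
  by rewrite realC_sum; apply: eq_bigr => x _; rewrite -mul_conj_sqn.
have [V [Vc Vle]] := @decoder R m L i k l Rt v ph q co q0 q1 trG hc.
have pv := protocol_val vtight Vc x0.
have [Lam [LL fle]] := locc_fidelity phi pv.
exists Lam; split; first exact: LL.
have -> : ghz_pow R (m := m) (k := k) = (fun x y => ghz_vec R x * (ghz_vec R y)^*).
  apply: funext => x; apply: funext => y.
  by rewrite /ghz_pow /ghz_vec conj_prod -big_split.
apply: le_trans fle.
(* The protocol acts on the whole ensemble; vectors outside the image of [f] can only add to the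
   value. *)
apply: le_trans (ler_wsqrtr _); last first.
  apply: (ler_sum_inj (f := f) (F := fun s => \sum_o \sum_d \sum_t sqn (amp i v V o d t (phi s)))) => //.
  by move=> s; apply: sumr_ge0 => o _; apply: sumr_ge0 => d _; apply: sum_sqn_ge0.
apply: le_trans Vle; rewrite lerD2l lerN2 ler_pM2r ?invr_gt0 //.
rewrite /co exchange_big /=; apply: ler_sum => J okj; rewrite big_split /=; apply: lerD.
  rewrite -/B.
  have h1 := CS_real (fun _ : Out => 1 : R) (fun o => Num.sqrt (#|{: A * Rt}|%:R * hs J w o)).
  have S0 : 0 <= \sum_o Num.sqrt (#|{: A * Rt}|%:R * hs J w o).
    by apply: sumr_ge0 => o _; apply: sqrtr_ge0.
  rewrite -[leLHS]ger0_norm // -sqrtr_sqr; apply: ler_wsqrtr.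
  have e1 : \sum_(o : Out) 1 * Num.sqrt (#|{: A * Rt}|%:R * hs J w o) =
     \sum_o Num.sqrt (#|{: A * Rt}|%:R * hs J w o) by apply: eq_bigr => o _; rewrite mul1r.
  rewrite e1 in h1; apply: le_trans h1 _.
  under [X in _ * X]eq_bigr do rewrite sqr_sqrtr ?mulr_ge0 //.
  rewrite sumr_const expr1n -mulr_sumr card_prod natrM.
  have -> : #|{: Out}|%:R * (#|{: A}|%:R * #|Rt|%:R * \sum_o hs J w o) =
     D * #|Rt|%:R * \sum_o hs J w o.
    by rewrite /D -(@card_branches R m k l) natrM; ring.
  apply: le_trans wB; rewrite (bigD1 J) //= lerDl; apply: sumr_ge0 => J' _.
  by rewrite mulr_ge0 ?mulr_ge0 ?sumr_ge0 // ltW.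
rewrite /z exchange_big /=.
apply: (@le_trans _ _ (2 ^+ m * \sum_(s | ~~ typ J s) \sum_t \sum_x sqn (c J s t x))); last first.
  by apply: ler_wpM2l; rewrite ?exprn_ge0.
rewrite mulr_sumr; apply: ler_sum => s _; rewrite exchange_big /=.
rewrite (eq_bigr (fun _ => \sum_t \sum_x sqn (c J s t x))) => [|S _].
  rewrite sumr_const -[leLHS]mulr_natl.
  suff -> : #|{: {set 'I_m}}|%:R = 2 ^+ m :> R by [].
  by rewrite -cardsT -finset.powersetT card_powerset cardsT card_ord natrX.
rewrite -(selk_trace vtight S (c J s)); apply: eq_bigr => o _; by rewrite cRe_sum.
Qed.

End OneShot.

(** * Typical sequences *)

Section Typicality.
Variable R : realType.

(** The variance of a sum of independent centred variables: after expanding the square, every mixed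
    term has a factor with mean 0. *)
Lemma second_moment (I : finType) (p g : I -> R) (n : nat) :
  \sum_x p x = 1 -> \sum_x p x * g x = 0 ->
  \sum_(s : {ffun 'I_n -> I}) (\prod_k p (s k)) * (\sum_k g (s k)) ^+ 2
   = n%:R * \sum_x p x * g x ^+ 2.
Proof.
move=> p1 pg0.
pose w (k k' t : 'I_n) (x : I) : R := p x * ((if t == k then g x else 1) * (if t == k' then g x else 1)).
have e (s : {ffun 'I_n -> I}) : (\prod_k p (s k)) * (\sum_k g (s k)) ^+ 2 =
    \sum_k \sum_k' \prod_t w k k' t (s t).
  rewrite expr2 mulr_suml mulr_sumr; apply: eq_bigr => k _.
  rewrite !mulr_sumr; apply: eq_bigr => k' _.
  rewrite /w big_split big_split /=; congr (_ * (_ * _)).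
    by rewrite -big_mkcond big_pred1_eq.
  by rewrite -big_mkcond big_pred1_eq.
rewrite (eq_bigr _ (fun s _ => e s)) exchange_big /=.
rewrite (eq_bigr (fun _ => \sum_x p x * g x ^+ 2)); first by rewrite sumr_const card_ord mulr_natl.
move=> k _; rewrite exchange_big /= (bigD1 k) //= [X in _ + X]big1 ?addr0 => [|k' k'k].
  rewrite -(bigA_distr_bigA (w k k)) /= (bigD1 k) //= [X in _ * X]big1 ?mulr1 => [|t tk].
    by apply: eq_bigr => x _; rewrite /w eqxx expr2.
  by rewrite -p1; apply: eq_bigr => x _; rewrite /w (negbTE tk) !mulr1.
rewrite -(bigA_distr_bigA (w k k')) /= (bigD1 k) //=.
rewrite (eq_bigr (fun x => p x * g x)) ?pg0 ?mul0r // => x _.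
by rewrite /w eqxx eq_sym (negbTE k'k) mulr1.
Qed.

Lemma sum_prod_prob (I : finType) (p : I -> R) (n : nat) :
  \sum_x p x = 1 -> \sum_(s : {ffun 'I_n -> I}) \prod_k p (s k) = 1.
Proof.
by move=> p1; rewrite -(bigA_distr_bigA (fun _ x => p x)) /= big1.
Qed.

(** Entropy in nats, so that typical probabilities are bounded by values of [expR]. *)
Definition nat_entropy (I : finType) (p : I -> R) : R := - \sum_x p x * ln (p x).

Lemma typical_set (I : finType) (p : I -> R) (d : R) :
  (forall x, 0 <= p x) -> \sum_x p x = 1 -> 0 < d ->
  exists2 V : R, 0 <= V & forall n : nat, exists T : pred {ffun 'I_n -> I},
    (forall s, T s -> expR (- (n%:R * (nat_entropy p + d))) <= \prod_k p (s k)
                       <= expR (- (n%:R * (nat_entropy p - d)))) /\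
    \sum_(s | ~~ T s) \prod_k p (s k) <= V / n%:R.
Proof.
move=> p0 p1 d0; set h := nat_entropy p.
pose g x := - ln (p x) - h.
have pg0 : \sum_x p x * g x = 0.
  under eq_bigr do rewrite /g mulrBr mulrN.
  by rewrite sumrB sumrN -mulr_suml p1 mul1r /h /nat_entropy subrr.
exists ((\sum_x p x * g x ^+ 2) / d ^+ 2).
  by rewrite divr_ge0 ?exprn_ge0 ?(ltW d0) // sumr_ge0 // => x _; rewrite mulr_ge0 ?sqr_ge0.
move=> n.
pose T (s : {ffun 'I_n -> I}) := [forall k, p (s k) != 0] && (`|\sum_k g (s k)| <= n%:R * d).
exists T; split.
  move=> s /andP[/forallP pn]; rewrite ler_norml => /andP[g1 g2].
  have pos k : 0 < p (s k) by rewrite lt_neqAle eq_sym pn p0.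
  have -> : \prod_k p (s k) = expR (- (\sum_k g (s k)) - n%:R * h).
    have -> : - (\sum_k g (s k)) - n%:R * h = \sum_k ln (p (s k)).
      rewrite /g sumrB sumrN sumr_const card_ord -mulr_natl; ring.
    rewrite expR_sum; apply: eq_bigr => k _; by rewrite lnK // posrE.
  by rewrite !ler_expR; apply/andP; split; lra.
(* For [n = 0] the bound [V / n%:R] is 0, so the empty sequence has to be typical. *)
have [n0|n0] := posnP n.
  have no (k : 'I_n) : False by have := leq_trans (ltn_ord k) (eq_leq n0).
  have nR0 : n%:R = 0 :> R by rewrite n0.
  rewrite nR0 invr0 mulr0 big_pred0 // => s; apply/negbTE; rewrite negbK /T nR0 mul0r.
  by apply/andP; split; [apply/forallP => k; case: (no k)|rewrite big1 ?normr0 // => k; case: (no k)].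
have nR : 0 < n%:R :> R by rewrite ltr0n.
pose S := \sum_x p x * g x ^+ 2.
have mom : _ = n%:R * S := second_moment n p1 pg0.
have nd0 : 0 < (n%:R * d) ^+ 2 by rewrite exprn_gt0 // mulr_gt0.
rewrite -(ler_pM2r nd0) -/S.
have -> : S / d ^+ 2 / n%:R * (n%:R * d) ^+ 2 = n%:R * S.
  by field; rewrite !gt_eqF.
rewrite -mom mulr_suml [leRHS](bigID (fun s => ~~ T s)) /=.
apply: (@le_trans _ _ (\sum_(s | ~~ T s) (\prod_k p (s k)) * (\sum_k g (s k)) ^+ 2)); last first.
  rewrite lerDl; apply: sumr_ge0 => s _; apply: mulr_ge0; last exact: sqr_ge0.
  exact: prodr_ge0.
apply: ler_sum => s; rewrite negb_and => /orP[/forallPn[k]|].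
  by rewrite negbK => /eqP pk; rewrite (bigD1 k) //= pk !mul0r.
rewrite -ltNge => hs; apply: ler_wpM2l; first exact: prodr_ge0.
rewrite -[leRHS]real_normK ?num_real //; apply: lerXn2r; rewrite ?nnegrE ?normr_ge0 //.
  by rewrite mulr_ge0 // ltW.
exact: ltW.
Qed.

Lemma typical_card (I : finType) (p : I -> R) (n : nat) (T : pred {ffun 'I_n -> I}) (a : R) :
  (forall x, 0 <= p x) -> \sum_x p x = 1 ->
  (forall s, T s -> expR (- a) <= \prod_k p (s k)) -> #|T|%:R <= expR a.
Proof.
move=> p0 p1 hT.
have : #|T|%:R * expR (- a) <= 1.
  apply: (@le_trans _ _ (\sum_(s | T s) \prod_k p (s k))).
    by rewrite mulr_natl -sumr_const; apply: ler_sum => s; exact: hT.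
  rewrite -[leRHS](sum_prod_prob n p1) [leRHS](bigID T) /=.
  by rewrite lerDl; apply: sumr_ge0 => s _; apply: prodr_ge0.
by rewrite expRN -ler_pdivlMr ?invr_gt0 ?expR_gt0 // invrK mul1r.
Qed.

End Typicality.

(** * From one copy to many *)

Section SingleLetter.
Variable R : realType.
Local Notation C := R[i].

Lemma entropyE (T : finType) (A : op R T T) :
  nat_entropy (fun s : 'I_#|T| => complex.Re (spectral_diag (tomx A) 0 s)) = entropy A * ln 2.
Proof.
rewrite /nat_entropy /entropy mulNr mulr_suml; congr (- _); apply: eq_bigr => s _.
rewrite /xlog2x; case: eqP => [->|_]; first by rewrite !mul0r.
by rewrite /log2 mulrA mulfVK // gt_eqF // ln_gt0 // ltr1n.
Qed.

Lemma spectral_trace (T : finType) (A : op R T T) (U : 'I_#|T| -> T -> C) (lam : 'I_#|T| -> R) :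
  orthobasis U -> (forall x y, A x y = \sum_l (lam l)%:C%C * U l x * (U l y)^*) ->
  \sum_x A x x = (\sum_l lam l)%:C%C.
Proof.
move=> Ub AE; under eq_bigr do rewrite AE.
rewrite exchange_big /= realC_sum; apply: eq_bigr => l _.
rewrite (eq_bigr (fun x => (lam l)%:C%C * ((U l x)^* * U l x))); last by move=> x _; ring.
by rewrite -mulr_sumr Ub.1 eqxx mulr1.
Qed.

Variables (m : nat) (L : 'I_m -> finType) (rho : op R (joint L) (joint L)).
Hypothesis rhoS : is_state rho.

Let rhoP : psdop rho. Proof. exact: rhoS.1. Qed.

(** The eigenvectors are rescaled by the square roots of the eigenvalues; their index is the basis
    of the purifying reference. *)
Lemma state_decomp : exists (phi : 'I_#|joint L| -> joint L -> C) (lam : 'I_#|joint L| -> R),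
  [/\ rho = mix phi,
      (forall s s', \sum_x phi s x * (phi s' x)^* = (s == s')%:R * (lam s)%:C%C),
      (forall s, 0 <= lam s), \sum_s lam s = 1 & nat_entropy lam = entropy rho * ln 2].
Proof.
have [U [Ub AE]] := spectral_op (psd_hermop rhoP).
have l0 := psd_eigen_ge0 rhoP Ub AE.
set lam := fun l => complex.Re (spectral_diag (tomx rho) 0 l) in AE l0.
have s2 s : (Num.sqrt (lam s))%:C%C * (Num.sqrt (lam s))%:C%C = (lam s)%:C%C :> C.
  by rewrite -realCM -expr2 sqr_sqrtr ?l0.
exists (fun s x => (Num.sqrt (lam s))%:C%C * U s x), lam; split => //.
- apply: funext => x; apply: funext => y; rewrite AE /mix; apply: eq_bigr => s _.
  by rewrite conjM conj_realC -s2; ring.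
- move=> s s'.
  rewrite (eq_bigr (fun x => (Num.sqrt (lam s))%:C%C * (Num.sqrt (lam s'))%:C%C * ((U s' x)^* * U s x))).
    rewrite -mulr_sumr Ub.1 eq_sym; case: eqP => [<-|_]; last by rewrite mulr0 mul0r.
    by rewrite mulr1 mul1r s2.
  by move=> x _; rewrite conjM conj_realC; ring.
- by apply: (@complexI R); rewrite -(spectral_trace Ub AE) rhoS.2.
- exact: entropyE.
Qed.

Lemma agree_restr (J : {set 'I_m}) (y y' : joint L) :
  agree J y y' = (restr (~: J)%SET y == restr (~: J)%SET y').
Proof.
apply/forallP/eqP => [h|/ffunP h j].
  apply/ffunP => -[j jJ]; rewrite !ffunE /=; apply/eqP.
  by have := h j; move: (jJ); rewrite inE => -> .
apply/implyP => jJ; have jJ' : j \in (~: J)%SET by rewrite inE.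
by have := h (exist _ j jJ'); rewrite !ffunE /= => ->.
Qed.

Lemma repr_restr (J : {set 'I_m}) (x0 y y' : joint L) :
  (repr J x0 y == repr J x0 y') = (restr (~: ~: J)%SET y == restr (~: ~: J)%SET y').
Proof.
apply/eqP/eqP => /ffunP h; apply/ffunP.
  move=> -[j jJ]; rewrite !ffunE /=; have := h j; rewrite !ffunE.
  by move: (jJ); rewrite finset.setCK => ->.
move=> j; rewrite !ffunE; case: ifP => // jJ.
have jJ' : j \in (~: ~: J)%SET by rewrite finset.setCK.
by have := h (exist _ j jJ'); rewrite !ffunE.
Qed.

Lemma ptrace_herm (K : {set 'I_m}) : hermop (@ptrace R m L K rho).
Proof.
move=> a b; rewrite /ptrace conj_sum.
under [RHS]eq_bigr do rewrite conj_sum.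
rewrite (exchange_big_dep predT) //=; apply: eq_bigr => x _.
apply: eq_big => y; last by move=> _; rewrite -(psd_hermop rhoP).
by rewrite andbCA andbA [X in _ && _ && X]eq_sym -andbA.
Qed.

Lemma ptrace_trace (K : {set 'I_m}) : \sum_a @ptrace R m L K rho a a = 1.
Proof.
rewrite -rhoS.2 /ptrace exchange_big /=; apply: eq_bigr => x _.
rewrite (bigD1 (restr K x)) //= [X in _ + X]big1 ?addr0 => [|a ax]; last first.
  by rewrite big1 // => y /andP[/eqP e _]; rewrite e eqxx in ax.
rewrite (big_pred1 x) // => y; rewrite eqxx /=; apply/andP/eqP => [[/eqP h1 /eqP h2]|->//].
apply/ffunP => j; case: (boolP (j \in K)) => jK.
  by have /ffunP/(_ (exist _ j jK)) := h1; rewrite !ffunE.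
have jK' : j \in (~: K)%SET by rewrite inE.
by have /ffunP/(_ (exist _ j jK')) := h2; rewrite !ffunE.
Qed.

(** Schmidt decomposition of the purification between the parties off [J] and the rest: pairing the
    [phi t] with the eigenvectors of the marginal off [J] gives orthogonal vectors on [J] and the
    reference. Hence the marginal there has the nonzero spectrum of the complementary one. *)
Lemma marginal_decomp (I : finType) (phi : I -> joint L -> C) (J : {set 'I_m}) (x0 : joint L) :
  rho = mix phi ->
  exists (c : 'I_#|subsys L (~: J)%SET| -> I -> joint L -> C)
         (mu : 'I_#|subsys L (~: J)%SET| -> R),
  [/\ (forall s t x, repr J x0 x != x -> c s t x = 0),
      (forall t t' x x', repr J x0 x = x -> repr J x0 x' = x' ->
        \sum_(y | repr J x0 y == x) \sum_(y' | repr J x0 y' == x')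
        (agree J y y')%:R * (phi t y * (phi t' y')^*) = \sum_s c s t x * (c s t' x')^*),
      (forall s s', \sum_t \sum_x c s t x * (c s' t x)^* = (s == s')%:R * (mu s)%:C%C) &
      [/\ (forall s, 0 <= mu s), \sum_s mu s = 1 &
          nat_entropy mu = entropy (@ptrace R m L (~: J)%SET rho) * ln 2]].
Proof.
move=> rhoE.
have [U [Ub AE]] := spectral_op (@ptrace_herm (~: J)%SET).
set mu := fun l => complex.Re (spectral_diag (tomx (@ptrace R m L (~: J)%SET rho)) 0 l) in AE.
pose u s (y : joint L) := U s (restr (~: J)%SET y).
pose c s t (x : joint L) : C := (repr J x0 x == x)%:R * \sum_(y | repr J x0 y == x) (u s y)^* * phi t y.
have reprK y : repr J x0 (repr J x0 y) = repr J x0 y.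
  by apply/ffunP => j; rewrite !ffunE; case: (j \in J).
(* The Gram matrix of the [c s] is the form of the complementary marginal between its own
   eigenvectors, hence diagonal. *)
have csc s s' : \sum_t \sum_x c s t x * (c s' t x)^* = (s == s')%:R * (mu s)%:C%C.
  rewrite mulrC -(spectral_form Ub AE) exchange_big /=.
  transitivity (\sum_(x | repr J x0 x == x) \sum_(y | repr J x0 y == x) \sum_(y' | repr J x0 y' == x)
     (u s y)^* * rho y y' * u s' y').
    rewrite [RHS]big_mkcond; apply: eq_bigr => x _; rewrite /c; case: eqP => _; last first.
      by rewrite big1 // => t _; rewrite !mul0r.
    transitivity (\sum_t \sum_(y | repr J x0 y == x) \sum_(y' | repr J x0 y' == x)
        (u s y)^* * (phi t y * (phi t y')^*) * u s' y').
      apply: eq_bigr => t _; rewrite !mul1r conj_sum mulr_suml; apply: eq_bigr => y _.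
      rewrite mulr_sumr; apply: eq_bigr => y' _; rewrite conjM conjCK; ring.
    rewrite exchange_big /=; apply: eq_bigr => y _; rewrite exchange_big /=; apply: eq_bigr => y' _.
    by rewrite rhoE /mix mulr_sumr mulr_suml.
  transitivity (\sum_(y : joint L) \sum_(y' | repr J x0 y' == repr J x0 y) (u s y)^* * rho y y' * u s' y').
    rewrite [RHS](partition_big (repr J x0) (fun x : joint L => repr J x0 x == x)) /=; last first.
      by move=> y _; rewrite reprK.
    by apply: eq_bigr => x _; apply: eq_bigr => y /eqP <-.
  rewrite (partition_big (restr (~: J)%SET) predT) //=; apply: eq_bigr => a _.
  rewrite [LHS](eq_bigr (fun y => \sum_b \sum_(y' | (repr J x0 y' == repr J x0 y) && (restr (~: J)%SET y' == b))
     (U s a)^* * rho y y' * U s' b)); last first.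
    move=> y /eqP ya; rewrite (partition_big (restr (~: J)%SET) predT) //=; apply: eq_bigr => b _.
    by apply: eq_bigr => y' /andP[_ /eqP yb]; rewrite /u ya yb.
  rewrite exchange_big /=; apply: eq_bigr => b _.
  rewrite /ptrace mulr_sumr mulr_suml big_mkcond; apply: eq_bigr => y _.
  rewrite mulr_sumr mulr_suml; case: (boolP (restr _ y == a)) => ya /=; last by rewrite big_pred0.
  by apply: eq_bigl => y'; rewrite repr_restr andbC [X in _ && X]eq_sym.
exists c, mu; split => //.
- by move=> s t x /negbTE h; rewrite /c h mul0r.
- move=> t t' x x' hx hx'.
  transitivity (\sum_(y | repr J x0 y == x) \sum_(y' | repr J x0 y' == x')
     \sum_s ((u s y)^* * phi t y) * ((u s y')^* * phi t' y')^*).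
    apply: eq_bigr => y _; apply: eq_bigr => y' _.
    have -> : (agree J y y')%:R = \sum_s u s y' * (u s y)^* :> C.
      by rewrite /u Ub.2 agree_restr eq_sym.
    rewrite mulr_suml; apply: eq_bigr => s _; rewrite conjM conjCK; ring.
  rewrite [RHS](eq_bigr (fun s => \sum_(y | repr J x0 y == x) \sum_(y' | repr J x0 y' == x')
     ((u s y)^* * phi t y) * ((u s y')^* * phi t' y')^*)).
    by rewrite [RHS]exchange_big /=; apply: eq_bigr => y _; rewrite [RHS]exchange_big.
  move=> s _; rewrite /c hx hx' !eqxx !mul1r conj_sum mulr_suml; apply: eq_bigr => y _.
  by rewrite mulr_sumr.
- split; last exact: entropyE.
    move=> s; have := csc s s; rewrite eqxx mul1r => e.
    rewrite -(ler0c (mu s)) -e; apply: sumr_ge0 => t _; apply: sumr_ge0 => x _.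
    by rewrite mul_conj_sqn ler0c sqn_ge0.
  by apply: (@complexI R); rewrite -(spectral_trace Ub AE) ptrace_trace.
Qed.

End SingleLetter.

(** * Tensor powers of the single-copy decompositions *)

Section Copies.
Variable R : realType.
Local Notation C := R[i].

Lemma sum_sig (V : nmodType) (T : finType) (P : pred T) (F : T -> V) :
  \sum_(t : {t | P t}) F (val t) = \sum_(t | P t) F t.
Proof.
rewrite [RHS](reindex_omap (val : {t | P t} -> T) (insub : T -> option {t | P t})) => [|t Pt]; last by rewrite insubT.
by apply: eq_bigl => t; rewrite valK eqxx (valP t).
Qed.

(** A sum of orthogonal rank-one terms with eigenvalues [mu s], so its squared Hilbert-Schmidt norm
    is the sum of their squares. *)
Lemma gram_HS (S X : finType) (E : S -> X -> C) (mu : S -> R) (typ : pred S) :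
  (forall s s', \sum_x E s x * (E s' x)^* = (s == s')%:R * (mu s)%:C%C) ->
  \sum_x \sum_y sqn (\sum_(s | typ s) E s x * (E s y)^*) = \sum_(s | typ s) mu s ^+ 2.
Proof.
move=> orth.
have norm s : \sum_x sqn (E s x) = mu s.
  apply: (@complexI R); have := orth s s; rewrite eqxx mul1r => <-.
  by rewrite realC_sum; apply: eq_bigr => x _; rewrite mul_conj_sqn.
rewrite exchange_big /=.
transitivity (\sum_y \sum_(s | typ s) mu s * sqn (E s y)).
  apply: eq_bigr => y _.
  transitivity (\sum_x sqn (\sum_s E s x * (if typ s then (E s y)^* else 0))).
    apply: eq_bigr => x _; congr sqn; rewrite big_mkcond; apply: eq_bigr => s _.
    by case: ifP => _; rewrite ?mulr0.
  rewrite (@parseval_fam R X S E mu (fun s => if typ s then (E s y)^* else 0)).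
    rewrite [RHS]big_mkcond; apply: eq_bigr => s _; case: ifP => _; first by rewrite sqn_conj.
    by rewrite sqn0 mulr0.
  move=> s s'; transitivity (\sum_x E s' x * (E s x)^*).
    by apply: eq_bigr => x _; rewrite mulrC.
  by rewrite orth eq_sym; case: eqP => [->//|_]; rewrite !mul0r.
rewrite exchange_big /=; apply: eq_bigr => s _.
by rewrite -mulr_sumr norm expr2.
Qed.

Lemma bool_prod (n : nat) (b : pred 'I_n) : ([forall k, b k]%:R : C) = \prod_k (b k)%:R.
Proof.
case: (boolP [forall k, b k]) => [/forallP h|/forallPn[k /negbTE bk]].
  by rewrite big1 // => k _; rewrite h.
by rewrite (bigD1 k) //= bk mul0r.
Qed.

Lemma ffun_eq_forall (n : nat) (I : eqType) (r r' : {ffun 'I_n -> I}) :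
  (r == r') = [forall k, r k == r' k].
Proof.
apply/eqP/forallP => [-> k //|h]; apply/ffunP => k; exact/eqP.
Qed.

Variables (m : nat) (L : 'I_m -> finType) (n : nat).
Local Notation Ln := (ncopies L n).

(** Transposes [n] joint configurations into the words of length [n] that the parties hold. *)
Definition pack (g : {ffun 'I_n -> joint L}) : joint Ln :=
  finfun (fun j : 'I_m => [ffun k => g k j] : Ln j).

Lemma slice_pack g k : slice (pack g) k = g k.
Proof. by apply/ffunP => j; rewrite /slice /pack !ffunE. Qed.

Lemma slice_inj (x x' : joint Ln) : (forall k, slice x k = slice x' k) -> x = x'.
Proof.
move=> h; apply/ffunP => j; apply/ffunP => k.
by have /ffunP/(_ j) := h k; rewrite /slice !ffunE.
Qed.

Lemma pack_bij : bijective pack.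
Proof.
exists (fun x => [ffun k => slice x k]) => [g|x].
  by apply/ffunP => k; rewrite ffunE slice_pack.
by apply: slice_inj => k; rewrite slice_pack ffunE.
Qed.

Lemma slice_eq (x x' : joint Ln) : (x == x') = [forall k, slice x k == slice x' k].
Proof.
apply/eqP/forallP => [->//|h]; apply: slice_inj => k; exact/eqP.
Qed.

Lemma sum_slices (F : 'I_n -> joint L -> C) :
  \sum_(x : joint Ln) \prod_k F k (slice x k) = \prod_k \sum_x F k x.
Proof.
rewrite bigA_distr_bigA (reindex _ (onW_bij _ pack_bij)) /=.
by apply: eq_bigr => g _; apply: eq_bigr => k _; rewrite slice_pack.
Qed.

Lemma sum_slices2 (F : 'I_n -> joint L -> joint L -> C) :
  \sum_(x : joint Ln) \sum_(y : joint Ln) \prod_k F k (slice x k) (slice y k)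
   = \prod_k \sum_x \sum_y F k x y.
Proof.
rewrite -sum_slices; apply: eq_bigr => x _.
exact: (sum_slices (fun k => F k (slice x k))).
Qed.

Definition prodv (I : Type) (phi : I -> joint L -> C) (r : 'I_n -> I) (x : joint Ln) : C :=
  \prod_k phi (r k) (slice x k).

Lemma tensor_pow_mix (I : finType) (phi : I -> joint L -> C) :
  tensor_pow (mix phi) (n := n) = mix (fun (r : {ffun 'I_n -> I}) => prodv phi r).
Proof.
apply: funext => x; apply: funext => y; rewrite /tensor_pow /mix bigA_distr_bigA.
by apply: eq_bigr => r _; rewrite /prodv conj_prod -big_split.
Qed.

Lemma prodv_orth (I : finType) (phi : I -> joint L -> C) (lam : I -> R) (r r' : {ffun 'I_n -> I}) :
  (forall s s', \sum_x phi s x * (phi s' x)^* = (s == s')%:R * (lam s)%:C%C) ->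
  \sum_x prodv phi r x * (prodv phi r' x)^* = (r == r')%:R * (\prod_k lam (r k))%:C%C.
Proof.
move=> orth; rewrite ffun_eq_forall bool_prod realC_prod -big_split /=.
under [RHS]eq_bigr do rewrite -orth.
rewrite -sum_slices; apply: eq_bigr => x _.
by rewrite /prodv conj_prod -big_split.
Qed.

Lemma slice_repr (J : {set 'I_m}) (x0 : joint L) (x : joint Ln) k :
  slice (repr J (pack [ffun=> x0]) x) k = repr J x0 (slice x k).
Proof. by apply/ffunP => j; rewrite /slice !ffunE; case: ifP; rewrite ?ffunE. Qed.

Lemma slice_agree (J : {set 'I_m}) (x x' : joint Ln) :
  agree J x x' = [forall k, agree J (slice x k) (slice x' k)].
Proof.
apply/forallP/forallP => [h k|h j].
  apply/forallP => j; apply/implyP => jJ; have := h j; rewrite jJ /= => /eqP e.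
  by rewrite /slice !ffunE e.
apply/implyP => jJ; apply/eqP/ffunP => k.
by have /forallP/(_ j) := h k; rewrite jJ /slice !ffunE => /eqP.
Qed.

Section Marginal.
Variables (I S : finType) (phi : I -> joint L -> C) (c : S -> I -> joint L -> C).
Variables (mu : S -> R) (J : {set 'I_m}) (x0 : joint L).
Let x0n := pack [ffun=> x0].
Hypothesis c0 : forall s t x, repr J x0 x != x -> c s t x = 0.
Hypothesis cmarg : forall t t' x x', repr J x0 x = x -> repr J x0 x' = x' ->
        \sum_(y | repr J x0 y == x) \sum_(y' | repr J x0 y' == x')
        (agree J y y')%:R * (phi t y * (phi t' y')^*) = \sum_s c s t x * (c s t' x')^*.
Hypothesis corth : forall s s', \sum_t \sum_x c s t x * (c s' t x)^* = (s == s')%:R * (mu s)%:C%C.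

Definition prodc (s : 'I_n -> S) (t : 'I_n -> I) (x : joint Ln) : C :=
  \prod_k c (s k) (t k) (slice x k).

Lemma prodc0 s t x : repr J x0n x != x -> prodc s t x = 0.
Proof.
rewrite slice_eq => /forallPn[k]; rewrite slice_repr => hk.
by rewrite /prodc (bigD1 k) //= c0 // mul0r.
Qed.

Lemma prodc_marg (t t' : {ffun 'I_n -> I}) (x x' : joint Ln) :
  repr J x0n x = x -> repr J x0n x' = x' ->
  \sum_(y | repr J x0n y == x) \sum_(y' | repr J x0n y' == x')
    (agree J y y')%:R * (prodv phi t y * (prodv phi t' y')^*)
  = \sum_(s : {ffun 'I_n -> S}) prodc s t x * (prodc s t' x')^*.
Proof.
move=> hx hx'.
pose F k (y y' : joint L) : C := (repr J x0 y == slice x k)%:R * ((repr J x0 y' == slice x' k)%:R *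
   ((agree J y y')%:R * (phi (t k) y * (phi (t' k) y')^*))).
transitivity (\sum_(y : joint Ln) \sum_(y' : joint Ln) \prod_k F k (slice y k) (slice y' k)).
  rewrite big_mkcond; apply: eq_bigr => y _.
  have ind (z w : joint Ln) : (repr J x0n z == w)%:R = \prod_k (repr J x0 (slice z k) == slice w k)%:R :> C.
    by rewrite slice_eq bool_prod; apply: eq_bigr => k _; rewrite slice_repr.
  rewrite [RHS](eq_bigr (fun y' => (repr J x0n y == x)%:R * ((repr J x0n y' == x')%:R * ((agree J y y')%:R *
     (prodv phi t y * (prodv phi t' y')^*))))); last first.
    move=> y' _; rewrite !ind slice_agree bool_prod /prodv conj_prod.
    by rewrite -!big_split.
  case: eqP => _; last by rewrite big1 // => y' _; rewrite mul0r.
  rewrite big_mkcond; apply: eq_bigr => y' _; rewrite mul1r.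
  by case: eqP => _; rewrite ?mul1r ?mul0r.
rewrite sum_slices2.
transitivity (\prod_k \sum_s c s (t k) (slice x k) * (c s (t' k) (slice x' k))^*).
  apply: eq_bigr => k _; rewrite -cmarg; first last.
  - by rewrite -slice_repr hx'.
  - by rewrite -slice_repr hx.
  rewrite [RHS]big_mkcond; apply: eq_bigr => y _; rewrite /F.
  case: eqP => _; last by rewrite big1 // => y' _; rewrite mul0r.
  rewrite [RHS]big_mkcond; apply: eq_bigr => y' _; rewrite mul1r.
  by case: eqP => _; rewrite ?mul1r ?mul0r.
rewrite bigA_distr_bigA; apply: eq_bigr => s _.
by rewrite /prodc conj_prod -big_split.
Qed.

Lemma prodc_orth (s s' : {ffun 'I_n -> S}) :
  \sum_(p : {ffun 'I_n -> I} * joint Ln) prodc s p.1 p.2 * (prodc s' p.1 p.2)^*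
   = (s == s')%:R * (\prod_k mu (s k))%:C%C.
Proof.
rewrite ffun_eq_forall bool_prod realC_prod -big_split /=.
under [RHS]eq_bigr do rewrite -corth.
rewrite sum_pair bigA_distr_bigA; apply: eq_bigr => t _ /=.
rewrite -(sum_slices (fun k x => c (s k) (t k) x * (c (s' k) (t k) x)^*)).
by apply: eq_bigr => x _; rewrite /prodc conj_prod -big_split.
Qed.

End Marginal.

Lemma iid_oneshot (i : 'I_m) (k : nat) (I : finType) (phi : I -> joint L -> C) (lam : I -> R)
   (x0 : joint L) (S : {set 'I_m} -> finType) (c : forall J, S J -> I -> joint L -> C)
   (mu : forall J, S J -> R) (T : pred {ffun 'I_n -> I}) (TJ : forall J, pred {ffun 'I_n -> S J})
   (P eta : {set 'I_m} -> R) :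
  (forall s s', \sum_x phi s x * (phi s' x)^* = (s == s')%:R * (lam s)%:C%C) ->
  (forall s, 0 <= lam s) -> \sum_s lam s = 1 ->
  (forall J s t x, repr J x0 x != x -> c J s t x = 0) ->
  (forall J t t' x x', repr J x0 x = x -> repr J x0 x' = x' ->
        \sum_(y | repr J x0 y == x) \sum_(y' | repr J x0 y' == x')
        (agree J y y')%:R * (phi t y * (phi t' y')^*) = \sum_s c J s t x * (c J s t' x')^*) ->
  (forall J s s', \sum_t \sum_x c J s t x * (c J s' t x)^* = (s == s')%:R * (mu J s)%:C%C) ->
  (forall J s, 0 <= mu J s) -> (forall J, \sum_s mu J s = 1) ->
  (forall J (s : {ffun 'I_n -> S J}), TJ J s -> \prod_k mu J (s k) <= P J) ->
  (forall J, \sum_(s | ~~ TJ J s) \prod_k mu J (s k) <= eta J) ->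
  (forall J, 0 <= P J) ->
  exists Lam, @LOCC R m Ln (@qubits m k) Lam /\
   \sum_(r | T r) \prod_k lam (r k) -
     (\sum_(J : {set 'I_m} | (J != finset.set0) && (i \notin J))
       (Num.sqrt (\sum_(J : {set 'I_m} | (J != finset.set0) && (i \notin J))
           #|T|%:R * (6 * 2 ^+ k) ^+ #|J| * P J) + 2 ^+ m * eta J)) / 2
      <= fidelity (ghz_pow R (m := m) (k := k)) (Lam (tensor_pow (mix phi) (n := n))).
Proof.
move=> orth lam0 lam1 c0 cmarg corth mu0 mu1 hP heta P0.
pose Rt : finType := {r : {ffun 'I_n -> I} | T r}.
(* [l] only has to make 2^(k+l) at least as large as every local dimension; its size does not enter
   the bound, so a crude choice does. *)
pose l := (\max_j #|Ln j|)%N.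
pose q (t : Rt) := \prod_k lam (val t k).
have cRt : #|Rt| = #|T| by rewrite card_sig.
have sq : \sum_t q t = \sum_(r | T r) \prod_k lam (r k).
  by rewrite -(sum_sig T (fun r : {ffun 'I_n -> I} => \prod_k lam (r k))).
rewrite -sq -cRt tensor_pow_mix.
apply: (@oneshot R m Ln i k l Rt _ (fun r : {ffun 'I_n -> I} => prodv phi r) val q (pack [ffun=> x0])
   (fun J => {ffun 'I_n -> S J} : finType)
   (fun J s t x => prodc (@c J) s (val t) x) TJ P eta).
- exact: val_inj.
- move=> j; apply: (@leq_trans (2 ^ l)); last by rewrite leq_exp2l // leq_addl.
  by apply: leq_trans (ltnW (ltn_expl _ (ltnSn 1))); rewrite /l; exact: leq_bigmax.
- by move=> t; apply: prodr_ge0.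
- rewrite sq -[leRHS](sum_prod_prob n lam1) [leRHS](bigID T) /= lerDl.
  by apply: sumr_ge0 => r _; apply: prodr_ge0.
- by move=> t t'; rewrite (prodv_orth _ _ orth) (inj_eq val_inj).
- move=> J s t x; apply: prodc0; exact: c0.
- move=> J t t' x x'; apply: prodc_marg; exact: cmarg.
- move=> J.
  have := gram_HS (TJ J) (prodc_orth (corth J)).
  set tot := \sum_x _ => htot.
  (* The vectors are orthogonal only when summed over the whole reference, so the sum is enlarged
     from typical [t] to all [t] before the spectrum is used. *)
  apply: (@le_trans _ _ tot).
    rewrite /tot.
    pose f (p : Rt * joint Ln) : {ffun 'I_n -> I} * joint Ln := (val p.1, p.2).
    have fI : injective f by move=> [t x] [t' x'] [/val_inj -> ->].
    pose F (p p' : {ffun 'I_n -> I} * joint Ln) := sqn (\sum_(s | TJ J s) prodc (@c J) s p.1 p.2 * (prodc (@c J) s p'.1 p'.2)^*).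
    have F0 p p' : 0 <= F p p' by exact: sqn_ge0.
    apply: (@le_trans _ _ (\sum_(p : Rt * joint Ln) \sum_(p' : Rt * joint Ln) F (f p) (f p'))).
      rewrite le_eqVlt; apply/orP; left; apply/eqP.
      rewrite [RHS]sum_pair; apply: eq_bigr => t _.
      rewrite exchange_big /=; apply: eq_bigr => x _.
      by rewrite [RHS]sum_pair.
    apply: (@le_trans _ _ (\sum_(p : Rt * joint Ln) \sum_p' F (f p) p')).
      by apply: ler_sum => p _; apply: (ler_sum_inj (F := F (f p)) fI).
    apply: (ler_sum_inj (F := fun p => \sum_p' F p p') fI) => p.
    exact: sumr_ge0.
  rewrite htot.
  (* The sum of squares is at most the bound on typical eigenvalues times the total weight. *)
  apply: (@le_trans _ _ (\sum_(s | TJ J s) P J * \prod_k mu J (s k))).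
    apply: ler_sum => s hs; rewrite expr2; apply: ler_wpM2r; last exact: hP.
    exact: prodr_ge0.
  rewrite -mulr_sumr -[leRHS]mulr1; apply: ler_wpM2l => //.
  rewrite -[leRHS](sum_prod_prob n (mu1 J)) [leRHS](bigID (TJ J)) /= lerDl.
  by apply: sumr_ge0 => s _; apply: prodr_ge0.
- move=> J; apply: le_trans (heta J); apply: ler_sum => s _.
  have e : \sum_(p : {ffun 'I_n -> I} * joint Ln) sqn (prodc (@c J) s p.1 p.2) = \prod_k mu J (s k).
    apply: (@complexI R); have := prodc_orth (corth J) s s; rewrite eqxx mul1r => <-.
    by rewrite realC_sum; apply: eq_bigr => p _; rewrite mul_conj_sqn.
  rewrite -e sum_pair /=.
  apply: (ler_sum_inj (f := val : Rt -> _) (F := fun t => \sum_x sqn (prodc (@c J) s t x)) val_inj) => t.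
  exact: sum_sqn_ge0.
Qed.

End Copies.

Local Open Scope classical_set_scope.
Import numFieldNormedType.Exports.
Local Open Scope ring_scope.

(** * Achievable rates *)

Section Rates.
Variable R : realType.
Local Notation C := R[i].

(** The default 1 of the minimum covers an empty range. *)
Lemma finite_gap (I : finType) (P : pred I) (g : I -> R) :
  (forall i, P i -> 0 < g i) -> exists2 d : R, 0 < d & forall i, P i -> d <= g i.
Proof.
move=> gP; exists (\big[Num.min/1]_(i | P i) g i).
  by apply: lt_bigmin.
by move=> i Pi; apply: bigmin_le_cond.
Qed.

(** For [k = 0] the target is the scalar 1, and the parties may measure everything away: only the
    total weight of the ensemble counts. *)
Lemma discard (m : nat) (L : 'I_m -> finType) (i : 'I_m) (x0 : joint L)
    (I : finType) (phi : I -> joint L -> C) :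
  exists Lam, @LOCC R m L (@qubits m 0) Lam /\
   Num.sqrt (\sum_s \sum_x sqn (phi s x)) <= fidelity (ghz_pow R (m := m) (k := 0)) (Lam (mix phi)).
Proof.
pose K j (w : L j) : op R (L j) (@qubits m 0 j) := fun y x => (x == w)%:R.
pose y0 : joint (@qubits m 0) := finfun (fun j : 'I_m => [ffun=> false] : @qubits m 0 j).
have c1 : #|{ffun 'I_0 -> bool}| = 1%N by rewrite card_ffun card_ord expn0.
have Ks j (u : L j -> C) : \sum_w \sum_y sqn (\sum_x K j w y x * u x) <= \sum_x sqn (u x).
  apply: ler_sum => w _; rewrite /K (eq_bigr (fun _ => sqn (u w))) => [|y _].
    by rewrite sumr_const c1.
  by rewrite sum_delta.
have pv := @locc_step R m L (@qubits m 0) (@qubits m 0) (@ghz_vec R m 0) L K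
   (fun _ psi => sqn (dotp (@ghz_vec R m 0) psi)) y0 x0 Ks (fun _ => locc_base _).
have [Lam [LL le]] := locc_fidelity phi pv.
exists Lam; split; first exact: LL.
have -> : ghz_pow R (m := m) (k := 0) = (fun x y => ghz_vec R x * (ghz_vec R y)^*).
  apply: funext => x; apply: funext => y.
  by rewrite /ghz_pow /ghz_vec conj_prod -big_split.
apply: le_trans le; apply: ler_wsqrtr; apply: ler_sum => s _; apply: ler_sum => o _.
rewrite (ghz_dot i) expr0 sqrtr1 invr1 mul1r.
have app y : appM (fun j => K j (o j)) (phi s) y = phi s o.
  rewrite /appM /K; under eq_bigr do rewrite joint_delta.
  exact: sum_delta.
rewrite (eq_bigr (fun _ => phi s o)) => [|z _]; last exact: app.
by rewrite sumr_const c1.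
Qed.

(** [harmonic n] is 1/(n+1); at [n = 0] the inverse on the left is 0. *)
Lemma harmonic_inv (n : nat) : n%:R^-1 <= 2 * harmonic n :> R.
Proof.
case: n => [|n]; first by rewrite invr0 mulr_ge0 // invr_ge0.
rewrite /harmonic /= -div1r ler_pdivrMr ?ltr0n // mulrAC ler_pdivlMr ?ltr0n //.
by rewrite mul1r -natrM ler_nat mulnS -[n.+2]add2n leq_add2l leq_pmull.
Qed.

Lemma harmonic_affine (d : R) (n : nat) : 0 < d ->
  (1 + d * n%:R)^-1 <= (1 + d^-1) * harmonic n.
Proof.
move=> d0; have n0 : 0 <= n%:R :> R by exact: ler0n.
have p1 : 0 < 1 + d * n%:R by nra.
rewrite /harmonic /= -div1r ler_pdivrMr // mulrAC ler_pdivlMr ?ltr0n //.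
rewrite mul1r -natr1.
have -> : (1 + d^-1) * (1 + d * n%:R) = n%:R + 1 + (d * n%:R + d^-1).
  by field; rewrite gt_eqF.
by rewrite lerDl addr_ge0 ?invr_ge0 ?mulr_ge0 ?(ltW d0).
Qed.

Lemma cvg_scale_harmonic (c : R) : (fun n => c * harmonic n : R) @ \oo --> (0 : R).
Proof.
rewrite -[X in _ --> X](mulr0 c); apply: cvgM; first exact: cvg_cst.
exact: cvg_harmonic.
Qed.

Lemma cvg_floor_rate (r : R) : 0 <= r ->
  (fun n => (Num.truncn (n%:R * r))%:R / n%:R : R) @ \oo --> r.
Proof.
move=> r0.
apply: (@squeeze_cvgr _ _ _ _ (fun n => r - 2 * harmonic n) (fun _ => r)).
- near=> n.
  have n0 : (0 < n)%N by near: n; exists 1%N.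
  have nR : 0 < n%:R :> R by rewrite ltr0n.
  have /andP[h1 h2] := truncn_itv (mulr_ge0 (ler0n R n) r0).
  apply/andP; split; last by rewrite ler_pdivrMr // [leRHS]mulrC.
  apply: (@le_trans _ _ (r - n%:R^-1)); first by rewrite lerD2l lerN2 harmonic_inv.
  rewrite ler_pdivlMr // mulrBl mulVf ?gt_eqF //.
  by rewrite lerBlDr natr1 [leLHS]mulrC ltW.
- rewrite -[X in _ --> X]subr0; apply: cvgB; first exact: cvg_cst.
  exact: cvg_scale_harmonic.
- exact: cvg_cst.
Unshelve. all: by end_near.
Qed.

Variables (m : nat) (L : 'I_m -> finType) (rho : op R (joint L) (joint L)).
Hypothesis rhoS : is_state rho.

Lemma joint_inhabited : exists x0 : joint L, True.
Proof.
case: (pickP (fun _ : joint L => true)) => [x _|h]; first by exists x.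
have := rhoS.2; rewrite big_pred0 // => /eqP.
by rewrite eq_sym oner_eq0.
Qed.

(** Rate 0 makes the capacity nonnegative, which settles negative minima and excludes the value
    -oo. *)
Lemma achievable0 (i : 'I_m) : achievable rho 0.
Proof.
have [x0 _] := joint_inhabited.
have [phi [lam [rhoE orth lam0 lam1 _]]] := state_decomp rhoS.
exists (fun _ => 0%N), (fun _ => 0); split; last split.
- move=> n.
  have [Lam [LL le]] := @discard m (ncopies L n) i (pack [ffun=> x0]) _
     (fun r : {ffun 'I_n -> 'I_#|joint L|} => prodv phi r).
  exists Lam; split; first exact: LL.
  rewrite rhoE tensor_pow_mix subr0; apply: le_trans le.
  rewrite (_ : \sum_s _ = 1) ?sqrtr1 //.
  rewrite -(sum_prod_prob n lam1); apply: eq_bigr => r _; apply: (@complexI R).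
  have := prodv_orth r r orth; rewrite eqxx mul1r => <-.
  by rewrite realC_sum; apply: eq_bigr => x _; rewrite mul_conj_sqn.
- exact: cvg_cst.
- have -> : (fun n : nat => 0%:R / n%:R : R) = (fun _ => 0) by apply: funext => n; rewrite mul0r.
  exact: cvg_cst.
Qed.

Lemma achievable_lt (i : 'I_m) (r : R) : 0 <= r ->
  (forall J : {set 'I_m}, (J != finset.set0) && (i \notin J) -> r < coh_info rho J / #|J|%:R) ->
  achievable rho r.
Proof.
move=> r0 hr.
pose okJ (J : {set 'I_m}) := (J != finset.set0) && (i \notin J).
have [x0 _] := joint_inhabited.
have [phi [lam [rhoE orth lam0 lam1 lamH]]] := state_decomp rhoS.
have [c [mu cmu]] : exists (c : forall J : {set 'I_m}, 'I_#|subsys L (~: J)%SET| -> 'I_#|joint L| -> joint L -> C)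
   (mu : forall J : {set 'I_m}, 'I_#|subsys L (~: J)%SET| -> R), forall J,
  [/\ (forall s t x, repr J x0 x != x -> c J s t x = 0),
      (forall t t' x x', repr J x0 x = x -> repr J x0 x' = x' ->
        \sum_(y | repr J x0 y == x) \sum_(y' | repr J x0 y' == x')
        (agree J y y')%:R * (phi t y * (phi t' y')^*) = \sum_s c J s t x * (c J s t' x')^*),
      (forall s s', \sum_t \sum_x c J s t x * (c J s' t x)^* = (s == s')%:R * (mu J s)%:C%C) &
      [/\ (forall s, 0 <= mu J s), \sum_s mu J s = 1 &
          nat_entropy (mu J) = entropy (@ptrace R m L (~: J)%SET rho) * ln 2]].
  pose md J := cid (marginal_decomp rhoS J x0 rhoE).
  by exists (fun J => projT1 (md J)), (fun J => projT1 (cid (projT2 (md J)))) => J;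
    exact: projT2 (cid (projT2 (md J))).
have mu0 J s : 0 <= mu J s by have [_ _ _ [h _ _]] := cmu J; exact: h.
have mu1 J : \sum_s mu J s = 1 by have [_ _ _ [_ h _]] := cmu J.
have muH J : nat_entropy (mu J) = entropy (@ptrace R m L (~: J)%SET rho) * ln 2.
  by have [_ _ _ [_ _ h]] := cmu J.
have ln2 : 0 < ln 2 :> R by rewrite ln_gt0 // ltr1n.
have [d4 d40 gap] : exists2 d : R, 0 < d & forall J, okJ J ->
    d <= nat_entropy (mu J) - nat_entropy lam - #|J|%:R * (r * ln 2).
  apply: finite_gap => J okj; rewrite muH lamH.
  have := hr J okj; have J0 : 0 < #|J|%:R :> R by rewrite ltr0n card_gt0; case/andP: okj.
  rewrite ltr_pdivlMr // /coh_info -subr_gt0 => h.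
  have -> : entropy (@ptrace R m L (~: J)%SET rho) * ln 2 - entropy rho * ln 2 - #|J|%:R * (r * ln 2) =
    (entropy (@ptrace R m L (~: J)%SET rho) - entropy rho - r * #|J|%:R) * ln 2 by ring.
  by rewrite mulr_gt0.
(* A quarter of the gap: the two typicality errors take 2d of the 4d in the exponent, and the
   remaining 2d leave exp(-d n) after the square root. *)
pose d := d4 / 4.
have d0 : 0 < d by rewrite divr_gt0.
have [V V0 hT] := typical_set lam0 lam1 d0.
have [VJ VJP] : exists VJ : {set 'I_m} -> R, forall J, 0 <= VJ J /\ forall n : nat,
    exists T : pred {ffun 'I_n -> 'I_#|subsys L (~: J)%SET|},
    (forall s, T s -> expR (- (n%:R * (nat_entropy (mu J) + d))) <= \prod_k mu J (s k)
                       <= expR (- (n%:R * (nat_entropy (mu J) - d)))) /\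
    \sum_(s | ~~ T s) \prod_k mu J (s k) <= VJ J / n%:R.
  pose ex J := cid2 (typical_set (mu0 J) (mu1 J) d0).
  by exists (fun J => s2val (ex J)) => J; split; [exact: (s2valP (ex J))|exact: (s2valP' (ex J))].
(* Every 6^|J| is bounded by 6^m, so each term of the Hilbert-Schmidt sum is at most 6^m exp(-2 d
   n). *)
pose NJ : R := \sum_(J | okJ J) 6 ^+ m.
(* The contributions are the atypical weight of the state, the Hilbert-Schmidt errors and the
   atypical weights of the marginals; each 1/n is replaced by 2/(n+1). *)
pose Cst : R := 2 * V + (\sum_(J | okJ J) (Num.sqrt NJ * (1 + d^-1) + 2 ^+ m * (2 * VJ J))) / 2.
have H0 n : 0 <= harmonic n :> R by rewrite invr_ge0.
exists (fun n => Num.truncn (n%:R * r)), (fun n => Cst * harmonic n).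
split; last by split; [exact: cvg_scale_harmonic|exact: cvg_floor_rate].
move=> n; set k := Num.truncn _.
have [T [Tbd Tat]] := hT n.
have [TJ TJP] : exists TJ : forall J, pred {ffun 'I_n -> 'I_#|subsys L (~: J)%SET|}, forall J,
    (forall s, TJ J s -> expR (- (n%:R * (nat_entropy (mu J) + d))) <= \prod_k mu J (s k)
                       <= expR (- (n%:R * (nat_entropy (mu J) - d)))) /\
    \sum_(s | ~~ TJ J s) \prod_k mu J (s k) <= VJ J / n%:R.
  pose ex J := cid ((VJP J).2 n).
  by exists (fun J => projT1 (ex J)) => J; exact: (projT2 (ex J)).
have [Lam [LL le]] := @iid_oneshot R m L n i k _ phi lam x0 (fun J => 'I_#|subsys L (~: J)%SET| : finType)
   c mu T TJ (fun J => expR (- (n%:R * (nat_entropy (mu J) - d)))) (fun J => VJ J / n%:R)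
   orth lam0 lam1 (fun J => let: And4 h _ _ _ := cmu J in h)
   (fun J => let: And4 _ h _ _ := cmu J in h) (fun J => let: And4 _ _ h _ := cmu J in h)
   mu0 mu1 (fun J s hs => proj2 (andP ((TJP J).1 s hs))) (fun J => (TJP J).2) (fun J => expR_ge0 _).
exists Lam; split; first exact: LL.
rewrite rhoE; apply: le_trans le.
have cardT : #|T|%:R <= expR (n%:R * (nat_entropy lam + d)).
  by apply: (typical_card lam0 lam1) => s /Tbd/andP[].
have kle : 2 ^+ k <= expR (n%:R * (r * ln 2)).
  have -> : 2 ^+ k = expR (k%:R * ln 2) :> R by rewrite expRM_natl lnK // posrE.
  rewrite ler_expR mulrA; apply: ler_wpM2r; first exact: ltW.
  by have /andP[] := truncn_itv (mulr_ge0 (ler0n R n) r0).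
have Bn : \sum_(J | okJ J) #|T|%:R * (6 * 2 ^+ k) ^+ #|J| * expR (- (n%:R * (nat_entropy (mu J) - d)))
    <= NJ * expR (- (d * n%:R)) ^+ 2.
  rewrite /NJ mulr_suml; apply: ler_sum => J okj.
  have -> : 6 ^+ m * expR (- (d * n%:R)) ^+ 2 = 6 ^+ m * expR (- (2 * d * n%:R)).
    by rewrite -expRM_natl; congr (_ * expR _); ring.
  apply: (@le_trans _ _ (expR (n%:R * (nat_entropy lam + d)) * (6 ^+ m * expR (n%:R * (r * ln 2)) ^+ #|J|)
     * expR (- (n%:R * (nat_entropy (mu J) - d))))).
    apply: ler_wpM2r; first exact: expR_ge0.
    apply: ler_pM => //.
    rewrite exprMn; apply: ler_pM; rewrite ?exprn_ge0 //.
      by rewrite ler_weXn2l ?ler1n // -[X in (_ <= X)%N](card_ord m) max_card.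
    by apply: lerXn2r; rewrite ?nnegrE ?exprn_ge0 ?expR_ge0.
  rewrite -expRM_natl mulrCA -!mulrA; apply: ler_wpM2l; first exact: exprn_ge0.
  rewrite -!expRD ler_expR.
  have := gap J okj; rewrite /d => h.
  have n0 : 0 <= n%:R :> R by exact: ler0n.
  have := ler_wpM2l n0 h; lra.
(* Exponential decay is given up for 1/(1 + d n), so that one multiple of [harmonic] bounds all
   errors; the Chebyshev terms decay no faster. *)
have expd : expR (- (d * n%:R)) <= (1 + d^-1) * harmonic n.
  apply: le_trans (harmonic_affine n d0).
  rewrite expRN lef_pV2 ?posrE ?expR_gt0 ?expR_ge1Dx //.
  by apply: ltr_wpDr => //; rewrite mulr_ge0 // ltW.
have NJ0 : 0 <= NJ by apply: sumr_ge0 => J _; apply: exprn_ge0.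
have sqB : Num.sqrt (\sum_(J | okJ J) #|T|%:R * (6 * 2 ^+ k) ^+ #|J| * expR (- (n%:R * (nat_entropy (mu J) - d))))
    <= Num.sqrt NJ * (1 + d^-1) * harmonic n.
  apply: le_trans (ler_wsqrtr Bn) _; rewrite sqrtrM // sqrtr_sqr ger0_norm ?expR_ge0 // -mulrA.
  by apply: ler_wpM2l => //; exact: sqrtr_ge0.
have QT : 1 - 2 * V * harmonic n <= \sum_(s | T s) \prod_k lam (s k).
  have e : \sum_(s | T s) \prod_k lam (s k) + \sum_(s | ~~ T s) \prod_k lam (s k) = 1.
    by have := sum_prod_prob n lam1; rewrite (bigID T).
  have := harmonic_inv n => hn.
  have : V / n%:R <= 2 * V * harmonic n by rewrite -mulrA mulrCA; apply: ler_wpM2l.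
  move: Tat e; move: (\sum_(s | ~~ T s) _) (\sum_(s | T s) _) => a b; lra.
have SJ : \sum_(J | okJ J) (Num.sqrt (\sum_(J | okJ J) #|T|%:R * (6 * 2 ^+ k) ^+ #|J| *
      expR (- (n%:R * (nat_entropy (mu J) - d)))) + 2 ^+ m * (VJ J / n%:R)) <=
   (\sum_(J | okJ J) (Num.sqrt NJ * (1 + d^-1) + 2 ^+ m * (2 * VJ J))) * harmonic n.
  rewrite mulr_suml; apply: ler_sum => J okj; rewrite [leRHS]mulrDl; apply: lerD; first exact: sqB.
  rewrite -mulrA; apply: ler_wpM2l; first exact: exprn_ge0.
  by rewrite -mulrA mulrCA; apply: ler_wpM2l; [exact: (VJP J).1|exact: harmonic_inv].
move: QT SJ; rewrite /Cst /okJ.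
move: (harmonic n) (\sum_(s | T s) _) => hn a.
move: (\sum_(J | _) (Num.sqrt (\sum_(J0 | _) _) + _)) (\sum_(J | _) (Num.sqrt NJ * _ + _)) => b e.
lra.
Qed.

End Rates.

Local Close Scope classical_set_scope.

Theorem theorem3 (R : realType) (m : nat) (L : 'I_m -> finType)
  (rho : op R (joint L) (joint L)) :
  is_state rho ->
  (\big[Order.max/-oo]_(i < m)
     \big[Order.min/+oo]_(J : {set 'I_m} | (J != finset.set0) && (i \notin J))
        ((coh_info rho J / #|J|%:R)%:E) <= ghz_capacity rho)%E.
Proof.
move=> rhoS; apply: bigmax_le; first exact: leNye.
(* If the capacity were below the minimum for [i], it would be strictly below each of the finitely
   many quotients, which leaves room for a larger achievable rate. *)
move=> i _; rewrite leNgt; apply/negP => lt.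
have ub r : achievable rho r -> (r%:E <= ghz_capacity rho)%E.
  by move=> ar; apply: ereal_sup_ubound; exists r.
have cap0 := ub 0 (achievable0 rhoS i).
have ltJ (J : {set 'I_m}) : (J != finset.set0) && (i \notin J) ->
    (ghz_capacity rho < (coh_info rho J / #|J|%:R)%:E)%E.
  by move=> okJ; apply: lt_le_trans lt _; exact: bigmin_le_cond.
(* [cap0] rules out -oo, and +oo is strictly below nothing. *)
move: cap0 lt ltJ ub; case: (ghz_capacity rho) => [c| |] // c0 lt ltJ ub; last first.
  by move: lt; rewrite ltNge leey.
(* When [i] is the only party there is no [J]; the gap is then the default of [finite_gap], and
   every nonnegative rate is achievable. *)
have [d d0 hd] : exists2 d : R, 0 < d & forall J : {set 'I_m}, (J != finset.set0) && (i \notin J) ->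
    d <= coh_info rho J / #|J|%:R - c.
  by apply: finite_gap => J /ltJ; rewrite lte_fin subr_gt0.
have : achievable rho (c + d / 2).
  apply: (achievable_lt rhoS (i := i)) => [|J /hd h]; last by lra.
  by rewrite lee_fin in c0; lra.
by move/ub; rewrite lee_fin; lra.
Qed.
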